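(* Let $k$ be an algebraically closed field of characteristic $0$, let $n,r,s\ge1$ be integers with $r+s\le n$, put $m=n-1$, and let $\lambda,\mu$ be partitions with $|\lambda|=|\mu|=t$, $l(\mu)\le r$, $l(\lambda)\le s$. Let $\chi=[\lambda,\mu]\in\mathbb Z^n$ be the corresponding dominant weight in the root lattice. For $\nu$ an $m$-tuple of integers $\ge0$ with sum $t$, $P,Q$ ordered tableaux of shapes $\lambda$ and $\mu$ respectively, both of weight $\nu$, and $\alpha:\mu\to\lambda$ a diagram mapping such that $P\circ\alpha=Q$, put $$u_{\nu,P,Q,\alpha}=\sum_{\pi\in C_\mu,\ \sigma\in C_\lambda}\mathrm{sgn}(\pi)\,\mathrm{sgn}(\sigma)\prod_{a\in\mu}x(Q(a))_{r-\pi(a)_1+1,\ \sigma(\alpha(a))_1}\ \in k[\mathrm{Mat}_{rs}^{n-1}].$$ Then the pull-backs $u_{\nu,P,Q,\alpha}\circ\varphi_{r,s,n,n-1}$ along $\varphi_{r,s,n,n-1}:\mathrm{Mat}_n\to\mathrm{Mat}_{rs}^{n-1}$, where $\nu$ ranges over the $m$-tuples of integers $\ge0$ with sum $t$, $P,Q$ range over the ordered tableaux of shapes $\lambda$ and $\mu$ respectively, both of weight $\nu$, and for each $\nu,P,Q$ the map $\alpha$ goes through a set of representatives for the $m$-tuples of special semi-standard tableaux with shapes determined by $Q$ and weights determined by $P$, span the $k[\mathrm{Mat}_n]^{\mathrm{GL}_n}$-module $k[\mathrm{Mat}_n]^{U_n}_\chi$.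
   Context: Varieties and actions. $\mathrm{Mat}_{rs}^m$ is the space of $m$-tuples of $r\times s$ matrices over $k$; $x(l)_{ij}$ is the $(i,j)$ matrix entry function of the $l$-th matrix component. $\mathrm{Mat}_n$ is the space of $n\times n$ matrices. $\mathrm{GL}_n$ acts on $\mathrm{Mat}_n$ by conjugation and on functions by $(S\cdot f)(A)=f(S^{-1}AS)$; $k[\mathrm{Mat}_n]^{\mathrm{GL}_n}$ is the algebra of invariants. $T_n,U_n\le\mathrm{GL}_n$ are the subgroups of diagonal and of upper uni-triangular matrices; characters of $T_n$ are identified with $\mathbb Z^n$ via $D\mapsto\prod_iD_{ii}^{\chi_i}$. $M^{U_n}_\chi$ is the space of $U_n$-invariants of $T_n$-weight $\chi$. $[\lambda,\mu]=(\lambda_1,\lambda_2,\ldots,0,\ldots,0,\ldots,-\mu_2,-\mu_1)\in\mathbb Z^n$. For $X\in\mathrm{Mat}_n$, $\varphi_{r,s,n,n-1}(X)\in\mathrm{Mat}_{rs}^{n-1}$ is the $(n-1)$-tuple whose $i$-th component is the lower left $r\times s$ corner of $X^i$, $i=1,\ldots,n-1$. Diagrams and tableaux. A partition $\lambda$ of length $l(\lambda)$ and with sum of parts $|\lambda|$ is identified with its Young diagram $\{(i,j)\mid1\le i\le l(\lambda),1\le j\le\lambda_i\}$, $i$ being the row index (rows numbered from top to bottom) and $j$ the column index. For a box $b=(i,j)$, $b_1=i$ denotes its row index. A skew diagram is a set $\lambda/\mu$ of boxes of $\lambda$ not in $\mu$, for partitions $\mu\subseteq\lambda$. A tableau of shape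 $E$ is a map $E\to\{1,2,\ldots\}$; it is ordered if its entries are weakly increasing along rows (left to right) and down columns, and semi-standard if its entries are weakly increasing along rows and strictly increasing down columns. Its weight is the tuple whose $i$-th component is the number of occurrences of $i$ (extended with zeros if necessary). $C_\lambda\le\mathrm{Sym}(\lambda)$ is the column stabiliser: the permutations of the boxes of $\lambda$ preserving each column. A diagram mapping is a bijection between (skew) diagrams. For a skew diagram $E$, $S_E$ is the tableau of shape $E$ with all boxes in the $i$-th row filled with $i$. Special tableaux and admissible maps. Let $E,F$ be skew diagrams with the same number of boxes. A semi-standard tableau $S$ of shape $F$ with the same weight as $S_E$ is called special (relative to $E$) if $S=S_E\circ\alpha$ for some diagram mapping $\alpha:F\to E$ such that: (b) if for $a,b\in F$, $\alpha(b)$ occurs strictly below $\alpha(a)$ in the same column, then $b$ occurs in a strictly lower row than $a$. A diagram mapping $\alpha:F\to E$ is called admissible if: (b') if for $a,b\in F$, $\alpha(b)$ occurs strictly below $\alpha(a)$ in the same column, then $b$ occurs in a strictly lower row than $a$ and in a column to the left of $a$ or in the same column. (Every special semi-standard tableau of shape $F$ and weight that of $S_E$ can be written as $S_E\circ\alpha$ with $\alpha$ admissible.) Representatives. Let $P,Q$ be ordered tableaux of shapes $\lambda,\mu$, both of weight $\nu$; then $P^{-1}(i)$ and $Q^{-1}(i)$ are skew diagrams with $\nu_i$ boxes. An $m$-tuple of special semi-standard tableaux with shapes determined by $Q$ and weights determined by $P$ is a tuple $(S_1,\ldots,S_m)$ where $S_i$ is a special semi-standard tableau (relative to $P^{-1}(i)$)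 of shape $Q^{-1}(i)$ and of weight equal to that of $S_{P^{-1}(i)}$. A diagram mapping $\alpha:\mu\to\lambda$ with $P\circ\alpha=Q$ represents $(S_1,\ldots,S_m)$ if, with $\alpha_i:Q^{-1}(i)\to P^{-1}(i)$ the restriction of $\alpha$, one has $S_i=S_{P^{-1}(i)}\circ\alpha_i$ for all $i$; representatives are always required to have all $\alpha_i$ admissible. A set of representatives contains exactly one representative for each such $m$-tuple. *)

(* Defs.v *)
From HB Require Import structures.
From mathcomp Require Import all_boot all_order all_algebra all_fingroup.
From mathcomp Require Import finmap mpoly.

Set Implicit Arguments.
Unset Strict Implicit.
Unset Printing Implicit Defensive.

Import Order.TTheory GRing.Theory Num.Theory.

Local Open Scope nat_scope.
Local Open Scope fset_scope.

(* Boxes (row, column), tableau entries and the indices of x(l)_{ij} all start *)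
(* at 1; only ordinals start at 0.                                            *)
Notation box := (nat * nat)%type.
Notation diagram := {fset box}.

Definition is_partition (la : seq nat) : bool := sorted geq la && (0 \notin la).

Definition young (la : seq nat) : diagram :=
  [fset b in [seq (i, j) | i <- iota 1 (size la), j <- iota 1 (nth 0 la i.-1)]].

Definition row_of (E : diagram) (b : E) : nat := (val b).1.
Definition col_of (E : diagram) (b : E) : nat := (val b).2.

(* The positivity of the entries is part of [ordered] and [semistandard].      *)
Definition tableau (E : diagram) := {ffun E -> nat}.

Definition positive_entries (E : diagram) (T : tableau E) : Prop :=
  forall b, 0 < T b.

Definition row_weak (E : diagram) (T : tableau E) : Prop :=
  forall a b, row_of a = row_of b -> col_of a <= col_of b -> T a <= T b.

Definition ordered (E : diagram) (T : tableau E) : Prop :=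
  [/\ positive_entries T, row_weak T &
      forall a b, col_of a = col_of b -> row_of a <= row_of b -> T a <= T b].

Definition semistandard (E : diagram) (T : tableau E) : Prop :=
  [/\ positive_entries T, row_weak T &
      forall a b, col_of a = col_of b -> row_of a < row_of b -> T a < T b].

Definition occurrences (E : diagram) (T : tableau E) (i : nat) : nat :=
  #|[set b | T b == i]|.

Definition has_weight (E : diagram) (T : tableau E) (nu : seq nat) : Prop :=
  forall i, occurrences T i.+1 = nth 0 nu i.

Definition row_tableau (E : diagram) : tableau E := [ffun b => row_of b].

Definition fiber (E : diagram) (T : tableau E) (i : nat) : diagram :=
  [fset val b | b in [set b : E | T b == i]].

Definition special (E F : diagram) (S : tableau F) : Prop :=
  [/\ semistandard S,
      occurrences S =1 occurrences (row_tableau E) &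
      exists alpha : {ffun F -> E},
        [/\ bijective alpha,
            S = [ffun b => row_tableau E (alpha b)] &
            forall a b, col_of (alpha a) = col_of (alpha b) ->
              row_of (alpha a) < row_of (alpha b) -> row_of a < row_of b]].

Definition admissible (E F : diagram) (alpha : {ffun F -> E}) : Prop :=
  bijective alpha /\
  forall a b, col_of (alpha a) = col_of (alpha b) ->
    row_of (alpha a) < row_of (alpha b) ->
    row_of a < row_of b /\ col_of b <= col_of a.

Section Representatives.

Variables (D E : diagram) (m : nat) (P : tableau D) (Q : tableau E).

(* The component with index [i : 'I_m] is the one numbered [i.+1].             *)
Definition tableau_tuple := forall i : 'I_m, tableau (fiber Q i.+1).

Definition special_tuple (S : tableau_tuple) : Prop :=
  forall i : 'I_m, special (fiber P i.+1) (S i).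

Definition restricts_to (alpha : {ffun E -> D}) (i : nat)
    (alpha_i : {ffun fiber Q i -> fiber P i}) : Prop :=
  forall (a : E) (b : fiber Q i),
    val a = val b -> val (alpha a) = val (alpha_i b).

Definition represents (alpha : {ffun E -> D}) (S : tableau_tuple) : Prop :=
  [/\ bijective alpha,
      forall a, P (alpha a) = Q a &
      forall i : 'I_m, exists alpha_i : {ffun fiber Q i.+1 -> fiber P i.+1},
        [/\ restricts_to alpha alpha_i,
            admissible alpha_i &
            S i = [ffun b => row_tableau (fiber P i.+1) (alpha_i b)]]].

Definition is_rep_set (R : {set {ffun E -> D}}) : Prop :=
  (forall alpha, alpha \in R ->
     exists S, special_tuple S /\ represents alpha S) /\
  (forall S, special_tuple S ->
     exists! alpha, alpha \in R /\ represents alpha S).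

End Representatives.

Definition col_stab (E : diagram) : {set {perm E}} :=
  [set p : {perm E} | [forall b : E, col_of (p b) == col_of b]].

Local Open Scope ring_scope.

(* The values at l = 0, i = 0, j = 0 and out of range are junk; such indices   *)
(* do not occur for tableaux with entries in 1..m and diagrams with at most r  *)
(* (resp. s) rows.                                                            *)
Definition entry_fun (k : fieldType) (m r s : nat) (l i j : nat)
    (M : 'I_m -> 'M[k]_(r, s)) : k :=
  match insub l.-1, insub i.-1, insub j.-1 with
  | Some l', Some i', Some j' => M l' i' j'
  | _, _, _ => 0
  end.

Definition u_fun (k : fieldType) (m r s : nat) (la mu : seq nat)
    (Q : tableau (young mu)) (alpha : {ffun young mu -> young la})
    (M : 'I_m -> 'M[k]_(r, s)) : k :=
  \sum_(p in col_stab (young mu)) \sum_(q in col_stab (young la))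
    (-1) ^+ p * (-1) ^+ q *
    \prod_(a : young mu)
      entry_fun (Q a) (r - row_of (p a) + 1)%N (row_of (q (alpha a))) M.

Section MatrixFunctions.

Variables (k : fieldType) (n : nat).

Definition phi (r s m : nat) (hrs : (r + s <= n)%N) (X : 'M[k]_n) :
    'I_m -> 'M[k]_(r, s) :=
  let hr := leq_trans (leq_addr s r) hrs in
  let hs := leq_trans (leq_addl r s) hrs in
  fun l => mxsub (fun i => rev_ord (widen_ord hr (rev_ord i))) (widen_ord hs)
             (X ^+ l.+1).

(* For infinite k this is the coordinate ring of the affine space Mat_n.       *)
Definition regular (f : 'M[k]_n -> k) : Prop :=
  exists p : {mpoly k[n * n]}, forall A, f A = p.@[fun i => mxvec A ord0 i].

Definition act (S : 'M[k]_n) (f : 'M[k]_n -> k) : 'M[k]_n -> k :=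
  fun A => f (invmx S *m A *m S).

Definition torus (D : 'M[k]_n) : bool := is_diag_mx D && (D \in unitmx).

Definition upper_unitriangular (S : 'M[k]_n) : bool :=
  is_trig_mx S^T && [forall i, S i i == 1].

Definition GL_invariant (f : 'M[k]_n -> k) : Prop :=
  regular f /\ forall S, S \in unitmx -> act S f =1 f.

Definition torus_char (chi : seq int) (D : 'M[k]_n) : k :=
  \prod_(i < n) D i i ^ chi`_i.

Definition U_invariant_of_weight (chi : seq int) (f : 'M[k]_n -> k) : Prop :=
  [/\ regular f,
      forall S, upper_unitriangular S -> act S f =1 f &
      forall D, torus D -> act D f =1 (fun A => torus_char chi D * f A)].

Definition invariant_span (G : ('M[k]_n -> k) -> Prop) (f : 'M[k]_n -> k)
    : Prop :=
  exists (N : nat) (c g : 'I_N -> 'M[k]_n -> k),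
    [/\ forall i, GL_invariant (c i),
        forall i, G (g i) &
        forall A, f A = \sum_(i < N) c i A * g i A].

End MatrixFunctions.

(* [lambda, mu] in Z^n, for l(lambda) + l(mu) <= n.                            *)
Definition bipartition_weight (n : nat) (la mu : seq nat) : seq int :=
  [seq a%:Z | a <- la] ++ nseq (n - size la - size mu) 0
    ++ rev [seq - b%:Z | b <- mu].

Definition tableau_data (t : nat) (la mu nu : seq nat)
    (P : tableau (young la)) (Q : tableau (young mu)) : Prop :=
  [/\ sumn nu = t, ordered P, ordered Q, has_weight P nu & has_weight Q nu].

(* Main.v *)
(* Easy direction: on column-alternating sums a unitriangular factor acts as   *)
(* the identity, because the columns of a diagram are closed downwards, and    *)
(* this applies to the left and the right factor of S^-1 X^l S separately.     *)
(*                                                                             *)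
(* Spanning, first step. Polarize a U-invariant function of weight chi into a  *)
(* tensor with d covariant and d contravariant indices, and trade every        *)
(* covariant index for n - 1 contravariant ones with the Levi-Civita symbol.   *)
(* This gives a highest weight vector of V^{(x) nd} of weight d (1,...,1) +    *)
(* chi, whose diagram is a d x n rectangle from which a rotated mu has been    *)
(* cut and to which lambda has been appended. Such a vector is a sum over a    *)
(* column-alternating function of positions; contracting it again produces     *)
(* products of traces, which are invariants, and of entries of powers of X.    *)
(* Cayley-Hamilton bounds the exponents by n - 1.                              *)
(*                                                                             *)
(* Second step. For fixed labels, Garnir relations straighten the sum of any   *)
(* bijection into those of "pictures" (bijections compatible with both         *)
(* diagrams up to labels), and a picture gives P, Q and special tableaux.      *)
(* Expanding the sums of the chosen representatives in those of pictures, the  *)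
(* matrix is triangular with positive diagonal for a statistic controlled by   *)
(* rearrangement inequalities, hence invertible in characteristic 0.           *)

Require Import Defs.
From HB Require Import structures.
From mathcomp Require Import all_boot all_order all_algebra all_fingroup.
From mathcomp Require Import finmap mpoly.
From mathcomp Require Import zify ring lra.

Set Implicit Arguments.
Unset Strict Implicit.
Unset Printing Implicit Defensive.

Import Order.TTheory GRing.Theory Num.Theory.
Local Open Scope ring_scope.

(** A bijection between the boxes of [mu] and those of [la] puts both diagrams on one finite set of
    strands, and alpha becomes a permutation of it. A pulled back generator is then an
    [alternating_monomial]: a product of entries of powers of X, one for each strand, summed with
    signs over the column stabilisers of both diagrams ([u_funE]).

    Such sums are highest weight vectors. Conjugation multiplies each power of X by a unitriangular
    matrix on either side; the sign sum over a column is a minor on an initial segment of indices,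
    which such a factor does not change ([column_determinant]). A torus element scales every term by
    the same monomial in its diagonal, read off from the row lengths ([alternating_monomial_torus]).

    Conversely, polarization in characteristic 0 turns each homogeneous part of a highest weight
    function into a mixed tensor killed by the raising operators. Levi-Civita symbols make it purely
    contravariant, and there a tensor killed by the raising operators, of the right content, is a
    row symmetrization of a column-alternating function on a diagram ([highest_weight_alternating]).
    Pairing this description with X and multiplying out the determinants produces networks of
    matrices: closed cycles are traces of powers, hence invariants, and the open chains are entries
    of powers joining a box of [mu] to a box of [la] ([tensor_contraction]). So the function is an
    invariant combination of alternating monomials ([highest_weight_spanned]). As r + s <= n, all
    entries involved lie off the diagonal, so Cayley-Hamilton leaves only the exponents 1 to n - 1
    ([alternating_monomial_reduced]), which serve as labels of the strands.

    It remains to pass from arbitrary bijections to the chosen representatives. Column exchanges and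
    Garnir relations on either diagram rewrite every alternating monomial in terms of pictures
    ([straightening]). A picture carries ordered tableaux P and Q and restricts to special tableaux
    on the label classes ([picture_representative]); it is determined by its labels and rows
    ([picture_eq]). Its representative has the same labels and rows. Two rearrangement inequalities
    for [stat] show that the sum of this representative contains the index pattern of its own
    picture with positive coefficient, and besides it only patterns of pictures with larger [stat]
    ([probe_neq0], [probe_diag]). The matrix expressing representatives by pictures is therefore
    invertible ([representatives_span]), so the representatives span as well. *)

(** * Sign characters and sums over symmetric groups *)

Lemma alternating_extend (T : finType) (A : eqType) (c : T -> A) (k : nzRingType) (F : {perm T} -> k) :
  (forall x y s, x != y -> c x = c y -> F (tperm x y * s)%g = - F s) ->
  forall s a : {perm T}, (forall x, c (s x) = c x) -> F (s * a)%g = (-1) ^+ s * F a.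
Proof.
move=> Ht s a.
have [m] := ubnP #|[pred x | s x != x]|; elim: m s => // m IH s lem hs.
have [/existsP[x sx]|/existsPn sid] := boolP [exists x, s x != x]; last first.
  have -> : s = 1%g by apply/permP => x; rewrite perm1; apply/eqP; move: (sid x); rewrite negbK.
  by rewrite mul1g odd_perm1 expr0 mul1r.
pose s' := (tperm x (s x) * s)%g.
have es : s = (tperm x (s x) * s')%g by rewrite /s' mulgA tperm2 mul1g.
have hs' : forall z, c (s' z) = c z.
  by move=> z; rewrite /s' permM hs; case: tpermP => [->|->|//]; rewrite hs.
have lem' : (#|[pred x | s' x != x]| < m)%N.
  rewrite -ltnS; apply: leq_trans lem; rewrite ltnS; apply: proper_card.
  apply/properP; split.
    apply/subsetP => z; rewrite !inE /s' permM; case: tpermP => [->|->|//].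
      by rewrite sx.
    by rewrite eqxx.
  exists (s x); first by rewrite inE (inj_eq perm_inj).
  by rewrite inE /s' permM tpermR eqxx.
rewrite {1}es -mulgA Ht ?hs //; last by rewrite eq_sym.
rewrite (IH s' lem' hs') /s' odd_permM odd_tperm eq_sym sx /=.
by case: (odd_perm s); rewrite ?expr0 ?expr1 ?mulN1r ?mul1r ?opprK.
Qed.

Lemma natf_neq0_char0 (k : fieldType) (hk : [pchar k] =i pred0) n : (n%:R == 0 :> k) = (n == 0)%N.
Proof. by move/pcharf0P: hk => ->. Qed.

Lemma eq_oppr_eq0 (k : fieldType) (hk : [pchar k] =i pred0) (x : k) : x = - x -> x = 0.
Proof.
move=> e; apply/eqP; have : x *+ 2 == 0 by rewrite mulr2n {1}e addNr.
by rewrite -mulr_natl mulf_eq0 natf_neq0_char0.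
Qed.

Lemma perm_on_tperm (T : finType) (B : {set T}) x y : x \in B -> y \in B -> perm_on B (tperm x y).
Proof. by move=> xB yB; apply/subsetP => z; rewrite inE; case: tpermP => [->|->|_ _ /eqP]. Qed.

Lemma perm_on_mull (T : finType) (B : {set T}) t p : perm_on B t -> perm_on B (t * p)%g = perm_on B p.
Proof.
move=> ht; apply/idP/idP => h; last exact: perm_onM.
by rewrite -(mulKg t p); apply: perm_onM h; exact: perm_onV.
Qed.

Lemma perm_on_mulr (T : finType) (B : {set T}) t p : perm_on B t -> perm_on B (p * t)%g = perm_on B p.
Proof.
move=> ht; apply/idP/idP => h; last exact: perm_onM.
by rewrite -(mulgK t p); apply: perm_onM h _; exact: perm_onV.
Qed.

(** Coset decomposition: a permutation of [b |: B] is uniquely [tperm b z] followed by a permutation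
    of [B], where z is the preimage of b. *)
Lemma sum_perm_on_setU1 (P : finType) (k : nmodType) (b : P) (B : {set P}) (G : {perm P} -> k) :
  b \notin B ->
  \sum_(p : {perm P} | perm_on (b |: B) p) G p =
  \sum_(z in b |: B) \sum_(p : {perm P} | perm_on B p) G (tperm b z * p)%g.
Proof.
move=> bB; rewrite (partition_big (fun p : {perm P} => (p^-1)%g b) (mem (b |: B))) /=; last first.
  by move=> p hp; rewrite (perm_closed _ (perm_onV hp)) setU11.
apply: eq_bigr => z hz.
rewrite (reindex_onto (fun p => tperm b z * p)%g (fun p => tperm b z * p)%g) /=; last first.
  by move=> p _; rewrite mulgA tperm2 mul1g.
have ht : perm_on (b |: B) (tperm b z) by rewrite perm_on_tperm ?setU11.
apply: eq_bigl => p; rewrite mulgA tperm2 mul1g eqxx andbT; apply/andP/idP.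
  move=> [h1 /eqP h2].
  have pb : p b = b by rewrite -{2}(permKV (tperm b z * p)%g b) h2 permM tpermR.
  have hp : perm_on (b |: B) p by rewrite -(perm_on_mull p ht).
  apply/subsetP => x; rewrite inE => px; move/subsetP: hp => /(_ x); rewrite inE => /(_ px).
  by rewrite inE in_set1; case: eqP => // xb; move: px; rewrite xb pb eqxx.
move=> hp; have hp' : perm_on (b |: B) p.
  by apply: subset_trans hp _; exact: subsetUr.
split; first exact: perm_onM.
by rewrite -(inj_eq (@perm_inj _ (tperm b z * p)%g)) permKV permM tpermR (out_perm hp).
Qed.

(** * Highest weight vectors as sums of column-alternating functions *)

Section Specht.

Variables (k : fieldType) (P : finType) (rho kap : P -> nat).
Hypothesis hk : [pchar k] =i pred0.
Hypothesis box_inj : forall x y, rho x = rho y -> kap x = kap y -> x = y.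
Hypothesis box_closed : forall x i j, (i <= rho x)%N -> (j <= kap x)%N ->
  exists z, rho z = i /\ kap z = j.

(** [W a] is to be thought of as the coordinate of a tensor at the word that writes the row of box x
    into slot [a x]. Left multiplication permutes boxes, so exchanging two boxes of one row must not
    change the value. *)
Definition row_inv (c : nat) (W : {perm P} -> k) := forall x y a,
  rho x = rho y -> (c <= kap x)%N -> (c <= kap y)%N -> W (tperm x y * a)%g = W a.

(** This is the vanishing of a raising operator, evaluated at the word in which the letter of x has
    been replaced by the smaller letter i: each term changes one letter i into the row of x. *)
Definition raising (c : nat) (W : {perm P} -> k) := forall x i a,
  (c <= kap x)%N -> (i < rho x)%N ->
  W a + \sum_(b | (rho b == i) && (c <= kap b)%N) W (tperm x b * a)%g = 0.

Definition col_alternating (A : pred P) (W : {perm P} -> k) := forall x y a,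
  x != y -> kap x = kap y -> A x -> W (tperm x y * a)%g = - W a.

Definition subcol (c m : nat) : {set P} := [set x | (kap x == c) && (m <= rho x)%N].

Definition antisym (B : {set P}) (W : {perm P} -> k) (a : {perm P}) : k :=
  \sum_(p : {perm P} | perm_on B p) (-1) ^+ p * W (p * a)%g.

Definition row_span (W1 W2 : {perm P} -> k) := exists d : {perm P} -> k,
  (forall s, d s != 0 -> forall x, rho (s x) = rho x) /\
  forall a, W1 a = \sum_s d s * W2 (s * a)%g.

Lemma row_span_trans W1 W2 W3 : row_span W1 W2 -> row_span W2 W3 -> row_span W1 W3.
Proof.
move=> [d [dr hd]] [e [er he]].
exists (fun s => \sum_t d t * e (s * t^-1)%g); split.
  move=> s nz x.
  have [/forallP h|/forallPn [t ht]] := boolP [forall t, d t * e (s * t^-1)%g == 0].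
    by case/eqP: nz; apply: big1 => t _; apply/eqP.
  move: ht; rewrite mulf_eq0 negb_or => /andP[h1 h2].
  by rewrite -(mulgKV t s) permM (dr _ h1) (er _ h2).
move=> a; rewrite hd.
under [RHS]eq_bigr do rewrite mulr_suml.
rewrite exchange_big /=; apply: eq_bigr => t _.
rewrite he mulr_sumr [RHS](reindex_inj (mulIg t)) /=.
by apply: eq_bigr => s _; rewrite mulrA mulgA mulgK.
Qed.

Lemma row_span_eq W1 W2 : W1 =1 W2 -> row_span W1 W2.
Proof.
move=> e; exists (fun s => (s == 1%g)%:R); split.
  by move=> s; case: (s =P 1%g) => [-> _ x|_]; rewrite ?perm1 ?eqxx.
move=> a; rewrite (bigD1 1%g) //= eqxx mul1r mul1g big1 ?addr0 ?e //.
by move=> s; case: eqP => //= _ _; rewrite mul0r.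
Qed.

Lemma antisymN (B : {set P}) W x y a : x != y -> x \in B -> y \in B ->
  antisym B W (tperm x y * a)%g = - antisym B W a.
Proof.
move=> xy xB yB; rewrite /antisym -sumrN.
rewrite (reindex_inj (mulIg (tperm x y))) /=; apply: eq_big => p.
  by rewrite perm_on_mulr ?perm_on_tperm.
move=> _; rewrite -mulgA (mulgA (tperm x y)) tperm2 mul1g.
by rewrite odd_permM odd_tperm xy addbT signrN mulNr.
Qed.

Lemma perm_on_commute (B : {set P}) x y : x \notin B -> y \notin B -> forall a p, perm_on B p ->
  (p * (tperm x y * a) = tperm x y * (p * a))%g.
Proof.
move=> xB yB a p hp; rewrite !mulgA; congr (_ * a)%g.
apply/permP => z; rewrite !permM; case: (tpermP x y z) => [->|->|hx hy].
- by rewrite (out_perm hp) ?tpermL // (out_perm hp).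
- by rewrite (out_perm hp) ?tpermR // (out_perm hp).
- rewrite tpermD //; apply/eqP => e.
  + by case: hx; apply: (@perm_inj _ p); rewrite -e (out_perm hp).
  + by case: hy; apply: (@perm_inj _ p); rewrite -e (out_perm hp).
Qed.

(* Antisymmetrizes column c from the bottom up. At box b in row m, summing over *)
(* the transpositions of b with its row, the raising relations for the boxes   *)
(* below b turn into a nonzero multiple of the antisymmetrizer without b.      *)
Lemma subcol_row_step c m W : row_inv c W -> raising c W ->
  row_span (antisym (subcol c m.+1) W) (antisym (subcol c m) W).
Proof.
move=> hr hW.
have [/existsP[b /andP[/eqP rb /eqP cb]]|/existsPn nob] :=
  boolP [exists b, (rho b == m) && (kap b == c)]; last first.
  apply: row_span_eq => a; rewrite /antisym; suff -> : subcol c m.+1 = subcol c m by [].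
  apply/setP => x; rewrite !inE; case: eqP => //= cx; rewrite ltn_neqAle.
  by case: eqP => // e; have := nob x; rewrite -e cx !eqxx.
have bB : b \notin subcol c m.+1 by rewrite inE rb ltnn andbF.
have eB : subcol c m = b |: subcol c m.+1.
  apply/setP => x; rewrite !inE; apply/andP/orP.
    move=> [/eqP cx]; rewrite leq_eqVlt => /orP[/eqP rx|rx]; last by right; rewrite cx eqxx.
    by left; apply/eqP; apply: box_inj; congruence.
  by case=> [/eqP ->|/andP[-> /ltnW ->//]]; rewrite cb rb eqxx.
pose R := [set x | (rho x == m) && (c <= kap x)%N].
have bR : b \in R by rewrite inE rb cb leqnn eqxx.
(* Each x in [R] contributes one copy of the antisymmetrizer without b; each box of the column below
   b contributes one more through its raising relation. *)
pose N : k := (#|R| + #|subcol c m.+1|)%:R.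
have N0 : N != 0.
  by rewrite natf_neq0_char0 // addn_eq0 negb_and -lt0n (cardD1 b) bR.
suff key : forall a, \sum_(x in R) antisym (subcol c m) W (tperm b x * a)%g =
    N * antisym (subcol c m.+1) W a.
  exists (fun s => N^-1 * \sum_(x in R) (s == tperm b x)%:R); split.
    move=> s nz y.
    have [/existsP[x /andP[xR /eqP ->]]|/existsPn h] := boolP [exists x, (x \in R) && (s == tperm b x)].
      move: xR; rewrite inE => /andP[/eqP rx _].
      by case: tpermP => [->|->|//]; rewrite rx rb.
    case/eqP: nz; rewrite big1 ?mulr0 // => x xR; have := h x; rewrite xR /=.
    by move/negbTE ->.
  move=> a; apply: (mulfI N0); rewrite -key mulr_sumr.
  transitivity (\sum_(s : {perm P}) \sum_(x in R)
      (s == tperm b x)%:R * antisym (subcol c m) W (s * a)%g).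
    rewrite [RHS]exchange_big /=; apply: eq_bigr => x _.
    rewrite (bigD1 (tperm b x)) //= eqxx mul1r big1 ?addr0 // => s.
    by case: (s =P _) => //= _ _; rewrite mul0r.
  by apply: eq_bigr => s _; rewrite mulrA mulrA divff // mul1r mulr_suml.
move=> a; rewrite /antisym mulr_sumr.
under eq_bigr => x _ do rewrite eB sum_perm_on_setU1 // -eB.
have step x : x \in R ->
  \sum_(z in subcol c m) \sum_(p : {perm P} | perm_on (subcol c m.+1) p)
     (-1) ^+ (tperm b z * p)%g * W (tperm b z * p * (tperm b x * a))%g =
  \sum_(p : {perm P} | perm_on (subcol c m.+1) p) (-1) ^+ p * 
     (W (p * a)%g - \sum_(z in subcol c m.+1) W (tperm z x * (p * a))%g).
  move=> xR; have /andP[/eqP rx cx] : (rho x == m) && (c <= kap x)%N by move: xR; rewrite inE.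
  have xB : x \notin subcol c m.+1 by rewrite inE rx ltnn andbF.
  rewrite exchange_big /=; apply: eq_bigr => p hp.
  rewrite eB big_setU1 //= tperm1 mul1g mulrBr; congr (_ + _).
    by rewrite (perm_on_commute bB xB) // hr ?rb ?cb.
  rewrite mulr_sumr -sumrN; apply: eq_bigr => z zB.
  have bz : b != z by apply: contraNneq bB => ->.
  rewrite odd_permM odd_tperm bz addTb signrN mulNr; congr (- (_ * _)).
  rewrite -mulgA (perm_on_commute bB xB) // mulgA.
  rewrite -[LHS](hr b x) ?rb ?cb // !mulgA; congr (W (_ * _ * _)%g).
  have xz : x != z by apply: contraNneq xB => ->.
  by rewrite -{1}(tpermV b x) -!mulgA -conjgE tpermJ tpermL tpermD // tpermC.
rewrite (eq_bigr _ step) exchange_big /=; apply: eq_bigr => p hp.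
rewrite -mulr_sumr mulrCA; congr (_ * _).
rewrite sumrB exchange_big /= sumr_const.
rewrite [X in _ - X](_ : _ = \sum_(z in subcol c m.+1) - W (p * a)%g).
  by rewrite sumr_const mulNrn opprK /N natrD mulrDl !mulr_natl.
apply: eq_bigr => z; rewrite inE => /andP[/eqP cz rz].
apply/eqP; rewrite -addr_eq0 addrC; apply/eqP; rewrite -[RHS](hW z m (p * a)%g) ?cz //.
by congr (_ + _); apply: eq_bigl => x; rewrite inE.
Qed.

Lemma row_span_col c W : row_inv c W -> raising c W -> row_span W (antisym (subcol c 0) W).
Proof.
move=> hr hW; pose M := (\max_x (rho x).+1)%N.
have : row_span (antisym (subcol c M) W) (antisym (subcol c 0) W).
  elim: M => [|m IH]; first exact: row_span_eq.
  by apply: row_span_trans IH; exact: subcol_row_step.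
apply: row_span_trans; apply: row_span_eq => a.
have -> : subcol c M = set0.
  by apply/setP => x; rewrite !inE leqNgt (leq_bigmax (F := fun x => (rho x).+1)) andbF.
rewrite /antisym (big_pred1 1%g) ?odd_perm1 ?mul1r ?mul1g // => p.
apply/idP/eqP => [h|->]; last exact: perm_on1.
by apply/permP => x; rewrite perm1 (out_perm h) ?inE.
Qed.

Lemma antisym_row_inv c W : row_inv c W -> row_inv c.+1 (antisym (subcol c 0) W).
Proof.
move=> hr x y a e hx hy; rewrite /antisym; apply: eq_bigr => p hp.
have nx z : (c < kap z)%N -> z \notin subcol c 0 by move=> h; rewrite inE gtn_eqF.
by rewrite (perm_on_commute (nx _ hx) (nx _ hy)) // hr // ltnW.
Qed.

Lemma antisym_raising c W : row_inv c W -> raising c W -> raising c.+1 (antisym (subcol c 0) W).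
Proof.
move=> hr hW x i a cx ix.
have nx z : (c < kap z)%N -> z \notin subcol c 0 by move=> h; rewrite inE gtn_eqF.
have [bi [ri ci]] := box_closed (ltnW ix) (ltnW cx).
have [bj [rj cj]] := box_closed (leqnn (rho x)) (ltnW cx).
have bij : bi != bj by apply: contraTneq ix => e; rewrite -rj -e ri ltnn.
have xi : x != bi by apply: contraTneq cx => ->; rewrite ci ltnn.
have xj : x != bj by apply: contraTneq cx => ->; rewrite cj ltnn.
(* The box [bi] of column c contributes nothing: row invariance trades x for [bj], the box of column
   c in its row, and the antisymmetrizer changes sign when [bi] and [bj] are exchanged. *)
have Z0 : \sum_(p : {perm P} | perm_on (subcol c 0) p)
    (-1) ^+ p * W (tperm x bi * (p * a))%g = 0.
  set Z := LHS; apply: (eq_oppr_eq0 hk).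
  rewrite {1}/Z (reindex_inj (mulgI (tperm bi bj))) /= -sumrN.
  apply: eq_big => p; first by rewrite perm_on_mull // perm_on_tperm // inE ?ci ?cj eqxx.
  move=> _; rewrite odd_permM odd_tperm bij addTb signrN mulNr; congr (- (_ * _)).
  rewrite -[RHS](hr x bj) ?rj ?cj // 1?ltnW // !mulgA; congr (W (_ * _ * _)%g).
  by rewrite [RHS]conjgC tpermJ tpermL tpermD.
rewrite {1}/antisym; under [X in _ + X]eq_bigr => b _ do rewrite /antisym.
rewrite exchange_big -big_split /= -[RHS]oppr0 -[in RHS]Z0 -sumrN.
apply: eq_bigr => p hp; rewrite -mulr_sumr -mulrDr -mulrN; congr (_ * _).
have := hW x i (p * a)%g (ltnW cx) ix.
rewrite (bigD1 bi) /= ?ri ?ci ?eqxx ?leqnn // addrCA => /eqP; rewrite addrC addr_eq0 => /eqP <-.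
congr (_ + _).
apply: eq_big => b.
  apply/andP/andP; first by move=> [-> h]; rewrite (ltnW h); split => //; apply: contraTneq h => ->; rewrite ci ltnn.
  move=> [/andP[/eqP e h] nb]; rewrite e eqxx; split => //; rewrite ltn_neqAle h andbT.
  by apply: contraNneq nb => e2; apply/eqP/box_inj; congruence.
by move=> /andP[_ h]; rewrite (perm_on_commute (nx _ cx) (nx _ h)).
Qed.

Lemma antisym_alternating c W : col_alternating (fun x => kap x < c)%N W ->
  col_alternating (fun x => kap x < c.+1)%N (antisym (subcol c 0) W).
Proof.
move=> hW x y a xy e; rewrite ltnS leq_eqVlt => /orP[/eqP cx|cx].
  by apply: antisymN => //; rewrite inE -?e cx eqxx.
rewrite /antisym -sumrN; apply: eq_bigr => p hp.
have nx z : (kap z < c)%N -> z \notin subcol c 0 by move=> h; rewrite inE ltn_eqF.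
by rewrite (perm_on_commute (nx _ cx)) ?nx -?e // hW // mulrN.
Qed.

Lemma row_span_alternating c W : row_inv c W -> raising c W ->
  col_alternating (fun x => kap x < c)%N W ->
  exists V, row_span W V /\ col_alternating xpredT V.
Proof.
have [m] := ubnP (\max_x (kap x).+1 - c); elim: m c W => // m IH c W; rewrite ltnS => hm hr hW ha.
have [le|lt] := leqP (\max_x (kap x).+1) c.
  exists W; split; first exact: row_span_eq.
  move=> x y a xy e _; apply: ha => //; apply: leq_trans le.
  exact: (leq_bigmax (F := fun x => (kap x).+1)).
have [|V [h1 h2]] := IH c.+1 _ _ (antisym_row_inv hr) (antisym_raising hr hW) (antisym_alternating ha).
  by lia.
by exists V; split=> //; apply: row_span_trans h1; exact: row_span_col.
Qed.

(** Antisymmetrizing column after column expresses W as a combination of row translates of an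
    alternating V with unknown coefficients. Averaging over the row group, which fixes W, collapses
    these coefficients to their sum, and that scalar is absorbed into V. *)
Theorem highest_weight_alternating W : row_inv 0 W -> raising 0 W ->
  exists V : {perm P} -> k, (forall x y a, x != y -> kap x = kap y -> V (tperm x y * a)%g = - V a) /\
    forall a, W a = \sum_(s : {perm P} | [forall x, rho (s x) == rho x]) V (s * a)%g.
Proof.
move=> hr hW; have [|V [[d [dr hd]] hV]] := @row_span_alternating 0 W hr hW; first by [].
pose R := fun s : {perm P} => [forall x, rho (s x) == rho x].
have RP (s : {perm P}) : reflect (forall x, rho (s x) = rho x) (R s).
  by apply: (iffP forallP) => h x; apply/eqP.
pose D := \sum_s d s; pose N : k := (#|R|)%:R.
have N0 : N != 0.
  rewrite natf_neq0_char0 // -lt0n; apply/card_gt0P; exists 1%g.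
  by apply/RP => x; rewrite perm1.
exists (fun a => N^-1 * D * V a); split.
  by move=> x y a xy e; rewrite hV // mulrN.
move=> a; apply: (mulfI N0); rewrite -mulr_sumr !mulrA divff // mul1r.
have Rinv s : R s -> W (s * a)%g = W a.
  (* Multiplying by the sign turns row invariance into row alternation, so that [alternating_extend]
     applies. *)
  move=> /RP hs; have := @alternating_extend P _ rho k (fun t => (-1) ^+ t * W t) _ s a hs.
  rewrite odd_permM signr_addb -mulrA => h; apply: (mulfI (negbT (signr_eq0 k a))).
  apply: (mulfI (negbT (signr_eq0 k s))).
  rewrite h // => x y t xy e.
  by rewrite odd_permM odd_tperm xy addTb signrN mulNr hr.
rewrite /N mulr_natl -sumr_const.
transitivity (\sum_(s in R) W (s * a)%g); first by apply: eq_bigr => s hs; rewrite Rinv.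
under eq_bigr => s _ do rewrite hd.
rewrite exchange_big /= /D mulr_suml; apply: eq_bigr => t _.
have [->|nz] := eqVneq (d t) 0; first by rewrite mul0r big1 // => s _; rewrite mul0r.
rewrite -mulr_sumr; congr (_ * _); rewrite (reindex_inj (mulgI t^-1%g)) /=.
apply: eq_big => s; last by rewrite mulgA mulKVg.
have ht := dr _ nz.
apply/RP/RP => h x; first by have := h (t x); rewrite permM permK => ->.
by rewrite permM h -ht permKV.
Qed.

End Specht.

(** * Regular and invariant functions *)

Section Regular.
Variables (k : fieldType) (n : nat).
Implicit Types f g c : 'M[k]_n -> k.

Lemma regular_eq f g : f =1 g -> regular f -> regular g.
Proof. by move=> e [p hp]; exists p => A; rewrite -e. Qed.

Lemma regular_const a : regular (fun _ : 'M[k]_n => a).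
Proof. by exists a%:MP => A; rewrite mevalC. Qed.

Lemma regular_entry i j : regular (fun A : 'M[k]_n => A i j).
Proof. by exists 'X_(mxvec_index i j) => A; rewrite mevalXU mxvecE. Qed.

Lemma regularD f g : regular f -> regular g -> regular (fun A => f A + g A).
Proof. by move=> [p hp] [q hq]; exists (p + q) => A; rewrite mevalD hp hq. Qed.

Lemma regularM f g : regular f -> regular g -> regular (fun A => f A * g A).
Proof. by move=> [p hp] [q hq]; exists (p * q) => A; rewrite mevalM hp hq. Qed.

Lemma regular_sum (J : Type) (r : seq J) (P : pred J) (F : J -> 'M[k]_n -> k) :
  (forall j, regular (F j)) -> regular (fun A => \sum_(j <- r | P j) F j A).
Proof.
move=> h; elim: r => [|x r IH].
  by apply: regular_eq (regular_const 0) => A; rewrite big_nil.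
case Px: (P x); last by apply: regular_eq IH => A; rewrite big_cons Px.
by apply: regular_eq (regularD (h x) IH) => A; rewrite big_cons Px.
Qed.

Lemma regular_prod (J : Type) (r : seq J) (P : pred J) (F : J -> 'M[k]_n -> k) :
  (forall j, regular (F j)) -> regular (fun A => \prod_(j <- r | P j) F j A).
Proof.
move=> h; elim: r => [|x r IH].
  by apply: regular_eq (regular_const 1) => A; rewrite big_nil.
case Px: (P x); last by apply: regular_eq IH => A; rewrite big_cons Px.
by apply: regular_eq (regularM (h x) IH) => A; rewrite big_cons Px.
Qed.

Lemma regular_expmx l i j : regular (fun A : 'M[k]_n => (A ^+ l) i j).
Proof.
elim: l i j => [|l IH] i j.
  by apply: regular_eq (regular_const ((1 : 'M[k]_n) i j)) => A; rewrite expr0.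
have h : regular (fun A : 'M[k]_n => \sum_u (A ^+ l) i u * A u j).
  by apply: regular_sum => u; apply: regularM => //; exact: regular_entry.
by apply: regular_eq h => A; rewrite exprSr [in RHS]mxE.
Qed.

Lemma GL_invariant_eq f g : f =1 g -> GL_invariant f -> GL_invariant g.
Proof.
move=> e [r h]; split; first exact: regular_eq r.
by move=> S hS A; rewrite /Defs.act -!e; exact: (h S hS A).
Qed.

Lemma GL_invariant_const a : GL_invariant (fun _ : 'M[k]_n => a).
Proof. by split; first exact: regular_const. Qed.

Lemma GL_invariantD f g : GL_invariant f -> GL_invariant g -> GL_invariant (fun A => f A + g A).
Proof.
move=> [rf hf] [rg hg]; split; first exact: regularD.
by move=> S hS A; rewrite /Defs.act; congr (_ + _); [exact: (hf S hS A)|exact: (hg S hS A)].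
Qed.

Lemma GL_invariantM f g : GL_invariant f -> GL_invariant g -> GL_invariant (fun A => f A * g A).
Proof.
move=> [rf hf] [rg hg]; split; first exact: regularM.
by move=> S hS A; rewrite /Defs.act; congr (_ * _); [exact: (hf S hS A)|exact: (hg S hS A)].
Qed.

Lemma GL_invariant_prod (J : Type) (r : seq J) (P : pred J) (F : J -> 'M[k]_n -> k) :
  (forall j, GL_invariant (F j)) -> GL_invariant (fun A => \prod_(j <- r | P j) F j A).
Proof.
move=> h; split; first by apply: regular_prod => j; case: (h j).
by move=> S hS A; rewrite /Defs.act; apply: eq_bigr => j _; case: (h j) => _ hj; exact: (hj S hS A).
Qed.

Lemma expmx_conj (S A : 'M[k]_n) l : S \in unitmx ->
  (invmx S *m A *m S) ^+ l = invmx S *m A ^+ l *m S.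
Proof.
move=> hS; elim: l => [|l IH]; first by rewrite !expr0 mulmx1 mulVmx.
rewrite !exprSr IH -[LHS]/((invmx S *m A ^+ l *m S) *m (invmx S *m A *m S)).
by rewrite -[A ^+ l * A]/(A ^+ l *m A) !mulmxA mulmxK.
Qed.

Lemma expmxD (A : 'M[k]_n) a b : A ^+ (a + b) = A ^+ a *m A ^+ b.
Proof. by rewrite exprD. Qed.

Lemma GL_invariant_trace l : GL_invariant (fun A : 'M[k]_n => \tr (A ^+ l)).
Proof.
split; first by apply: regular_sum => i; exact: regular_expmx.
by move=> S hS A; rewrite /Defs.act expmx_conj // mxtrace_mulC mulmxA mulmxV ?mul1mx.
Qed.

End Regular.

Section Span.
Variables (k : fieldType) (n : nat) (G : ('M[k]_n -> k) -> Prop).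
Implicit Types f g c : 'M[k]_n -> k.

Lemma span_eq f g : f =1 g -> invariant_span G f -> invariant_span G g.
Proof. by move=> e [N [c [h [h1 h2 h3]]]]; exists N, c, h; split=> // A; rewrite -e. Qed.

Lemma span_gen c g : GL_invariant c -> G g -> invariant_span G (fun A => c A * g A).
Proof. by move=> hc hg; exists 1%N, (fun=> c), (fun=> g); split=> // A; rewrite big_ord1. Qed.

Lemma span0 : invariant_span G (fun=> 0).
Proof. by exists 0%N, (fun=> fun=> 0), (fun=> fun=> 0); split=> [[]|[]|A] //; rewrite big_ord0. Qed.

Lemma spanD f g : invariant_span G f -> invariant_span G g -> invariant_span G (fun A => f A + g A).
Proof.
move=> [N [c [h [h1 h2 h3]]]] [N' [c' [h' [h1' h2' h3']]]].
exists (N + N')%N, (fun i => match split i with inl j => c j | inr j => c' j end),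
  (fun i => match split i with inl j => h j | inr j => h' j end); split.
- by move=> i; case: (split i).
- by move=> i; case: (split i).
move=> A; rewrite big_split_ord /= h3 h3'; congr (_ + _); apply: eq_bigr => i _.
  by rewrite (unsplitK (inl i)).
by rewrite (unsplitK (inr i)).
Qed.

Lemma span_sum (J : Type) (l : seq J) F : (forall j, invariant_span G (F j)) ->
  invariant_span G (fun A => \sum_(j <- l) F j A).
Proof.
move=> h; elim: l => [|x l IH]; first by apply: span_eq span0 => A; rewrite big_nil.
by apply: span_eq (spanD (h x) IH) => A; rewrite big_cons.
Qed.

Lemma spanM c f : GL_invariant c -> invariant_span G f -> invariant_span G (fun A => c A * f A).
Proof.
move=> hc [N [d [h [h1 h2 h3]]]]; exists N, (fun i A => c A * d i A), h; split=> // [i|A].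
  exact: GL_invariantM.
by rewrite h3 mulr_sumr; apply: eq_bigr => i _; rewrite mulrA.
Qed.

End Span.

Lemma span_trans (k : fieldType) n (G G' : ('M[k]_n -> k) -> Prop) f :
  (forall g, G g -> invariant_span G' g) -> invariant_span G f -> invariant_span G' f.
Proof.
move=> hG [N [c [h [h1 h2 h3]]]]; apply: span_eq (fun A => esym (h3 A)) _.
by apply: span_sum => i; apply: spanM => //; exact: hG.
Qed.

(** * Networks of matrices *)

Section TraceNetwork.
Variables (k : fieldType) (n : nat) (I : eqType).
Hypothesis hk : [pchar k] =i pred0.

(* [Rk a h h' b] stands for the rank one matrix X^a e_{j h} e_{i h'}^T X^b. *)
Inductive node := Pow of nat | Rk of nat & I & I & nat.

Definition node_mx (X : 'M[k]_n) (i j : I -> 'I_n) (nd : node) : 'M[k]_n :=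
  match nd with
  | Pow a => X ^+ a
  | Rk a h h' b => X ^+ a *m delta_mx (j h) (i h') *m X ^+ b
  end.

Definition covec_label (nd : node) : seq I := if nd is Rk _ _ h' _ then [:: h'] else [::].
Definition vec_label (nd : node) : seq I := if nd is Rk _ h _ _ then [:: h] else [::].

Definition chains (X : 'M[k]_n) (i j : I -> 'I_n) (L : seq (I * nat * I)) : k :=
  \prod_(x <- L) (X ^+ x.1.2) (i x.1.1) (j x.2).

Definition node_mul (N N' : node) : seq (I * nat * I) * node :=
  match N, N' with
  | Pow a, Pow b => ([::], Pow (a + b))
  | Pow a, Rk c h h' b => ([::], Rk (a + c) h h' b)
  | Rk a h h' b, Pow c => ([::], Rk a h h' (b + c))
  | Rk a h1 h1' b, Rk c h2 h2' d => ([:: (h1', (b + c)%N, h2)], Rk a h1 h2' d)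
  end.

Lemma mulmx_delta_mul (A B : 'M[k]_n) (u v u' v' : 'I_n) :
  delta_mx u v *m A *m delta_mx u' v' = A v u' *: (delta_mx u v' : 'M[k]_n).
Proof.
apply/matrixP => x y; rewrite !mxE (bigD1 u') //= big1 ?addr0; last first.
  by move=> z /negbTE zu; rewrite [X in _ * X]mxE zu mulr0.
rewrite !mxE eqxx /= (bigD1 v) //= big1 ?addr0; last first.
  by move=> z /negbTE zu; rewrite mxE zu andbF mul0r.
by rewrite mxE eqxx andbT; case: eqP => _ /=; rewrite ?mul1r ?mulr1 ?mul0r ?mulr0 //= mulrC.
Qed.

Lemma node_mulP X i j N N' :
  node_mx X i j N *m node_mx X i j N' =
  chains X i j (node_mul N N').1 *: node_mx X i j (node_mul N N').2.
Proof.
case: N N' => [a|a h h' b] [c|c g g' d] /=; rewrite /chains ?big_nil ?scale1r ?big_seq1 /=.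
- by rewrite expmxD.
- by rewrite !mulmxA expmxD.
- by rewrite expmxD -!mulmxA.
- have -> : X ^+ a *m delta_mx (j h) (i h') *m X ^+ b *m (X ^+ c *m delta_mx (j g) (i g') *m X ^+ d)
     = X ^+ a *m (delta_mx (j h) (i h') *m (X ^+ (b + c)) *m delta_mx (j g) (i g')) *m X ^+ d.
    by rewrite expmxD !mulmxA.
  by rewrite mulmx_delta_mul // -!(scalemxAl, scalemxAr).
Qed.

Lemma node_mul_labels N N' h :
  (count_mem h (map (fun x => x.1.1) (node_mul N N').1) + count_mem h (covec_label (node_mul N N').2) =
   count_mem h (covec_label N) + count_mem h (covec_label N'))%N /\
  (count_mem h (map snd (node_mul N N').1) + count_mem h (vec_label (node_mul N N').2) =
   count_mem h (vec_label N) + count_mem h (vec_label N'))%N.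
Proof. by case: N N' => [a|a g g' b] [c|c e e' d] /=; split; lia. Qed.

Definition node_tr (N : node) : seq (I * nat * I) * option nat :=
  match N with Pow a => ([::], Some a) | Rk a h h' b => ([:: (h', (b + a)%N, h)], None) end.

Lemma node_trP X i j N :
  \tr (node_mx X i j N) = chains X i j (node_tr N).1 *
    (if (node_tr N).2 is Some a then \tr (X ^+ a) else 1).
Proof.
case: N => [a|a h h' b] /=; rewrite /chains ?big_nil ?mul1r // big_seq1 mulr1 /=.
rewrite mxtrace_mulC mulmxA -expmxD /mxtrace (bigD1 (i h')) //= big1 ?addr0.
  rewrite mxE (bigD1 (j h)) //= big1 ?addr0 => [|z /negbTE zu].
    by rewrite mxE !eqxx mulr1.
  by rewrite mxE zu mulr0.
by move=> z /negbTE zu; rewrite mxE big1 // => w _; rewrite mxE zu andbF mulr0.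
Qed.

(** Allows one index to be summed out while the sum still runs over all functions on [T]: the index
    becomes a dummy, at the price of a factor n. *)
Lemma sum_update (T : finType) (p : T) (G : {ffun T -> 'I_n} -> k) :
  \sum_(y : {ffun T -> 'I_n}) \sum_u G [ffun q => if q == p then u else y q] = n%:R * \sum_y G y.
Proof.
rewrite exchange_big /=; transitivity (\sum_(y : {ffun T -> 'I_n}) \sum_(u : 'I_n) G y); last first.
  by rewrite mulr_sumr; apply: eq_bigr => y _; rewrite sumr_const card_ord mulr_natl.
rewrite [RHS]exchange_big /=.
transitivity (\sum_(u : 'I_n) \sum_(v : 'I_n) \sum_(y : {ffun T -> 'I_n} | y p == u) G y).
  apply: eq_bigr => u _.
  rewrite (partition_big (fun y : {ffun T -> 'I_n} => y p) xpredT) //=; apply: eq_bigr => v _.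
  rewrite (reindex_onto (fun y : {ffun T -> 'I_n} => [ffun q => if q == p then v else y q])
    (fun y : {ffun T -> 'I_n} => [ffun q => if q == p then u else y q])) /=.
    apply: eq_big => [y|y].
      rewrite ffunE !eqxx andTb; apply/eqP/eqP => [/ffunP/(_ p)|e]; first by rewrite ffunE eqxx.
      by apply/ffunP => q; rewrite !ffunE; case: eqP => // ->.
    move=> /andP[_ /eqP {2}<-]; congr G.
  move=> y /eqP yp; apply/ffunP => q; rewrite !ffunE; case: eqP => // ->; by rewrite yp.
rewrite exchange_big /=; apply: eq_bigr => v _.
by rewrite [RHS](partition_big (fun y : {ffun T -> 'I_n} => y p) xpredT) //=.
Qed.

Lemma chains_cat X i j L L' : chains X i j (L ++ L') = chains X i j L * chains X i j L'.
Proof. exact: big_cat. Qed.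

(* Summing over the index at one slot either takes the trace of its matrix, if *)
(* th fixes the slot, or multiplies two matrices; induction on the slots.      *)
Lemma trace_network (T : finType) (A : {set T}) (th : {perm T}) (N : T -> node) :
  (0 < n)%N -> perm_on A th ->
  exists (c : 'M[k]_n -> k) (L : seq (I * nat * I)),
  [/\ GL_invariant c,
      forall h, (count_mem h (map (fun x => x.1.1) L) = \sum_(p in A) count_mem h (covec_label (N p)))%N,
      forall h, (count_mem h (map snd L) = \sum_(p in A) count_mem h (vec_label (N p)))%N &
      forall X i j, \sum_(y : {ffun T -> 'I_n}) \prod_(p in A) node_mx X i j (N p) (y (th p)) (y p)
        = c X * chains X i j L].
Proof.
move=> n0; have [m] := ubnP #|A|; elim: m A th N => // m IH A th N; rewrite ltnS => Am hth.
have nz : (n%:R : k) != 0 by rewrite natf_neq0_char0 // -lt0n.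
have [A0|[p pA]] := set_0Vmem A.
  exists (fun _ => \sum_(y : {ffun T -> 'I_n}) 1), [::]; split=> [|h|h|X i j].
  - exact: GL_invariant_const.
  - by rewrite A0 big_set0.
  - by rewrite A0 big_set0.
  - by rewrite /chains big_nil mulr1; apply: eq_bigr => y _; rewrite A0 big_set0.
have A'm : (#|A :\ p| < m)%N by move: Am; rewrite (cardsD1 p) pA.
(* [th'] splices p out of its cycle: it fixes p and sends the predecessor of p to [th p]. *)
pose th' := (th * tperm p (th p))%g.
have th'p : th' p = p by rewrite permM tpermR.
have hth' : perm_on (A :\ p) th'.
  apply/subsetP => x; rewrite !inE => thx; apply/andP; split.
    by apply: contraNneq thx => ->; rewrite th'p.
  apply: contraR thx => xA; rewrite /th' permM (out_perm hth xA) tpermD //.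
    by apply: contraNneq xA => <-.
  by apply: contraNneq xA => <-; rewrite (perm_closed _ hth).
pose G X i j (y : {ffun T -> 'I_n}) := \prod_(q in A) node_mx X i j (N q) (y (th q)) (y q).
have GE X i j : \sum_y G X i j y =
    n%:R^-1 * \sum_(y : {ffun T -> 'I_n}) \sum_u G X i j [ffun q => if q == p then u else y q].
  by rewrite sum_update mulrA mulVf // mul1r.
have [fixp|nfix] := eqVneq (th p) p.
  have [c [L [hc h1 h2 h3]]] := IH _ _ N A'm hth'.
  exists (fun X => n%:R^-1 * (if (node_tr (N p)).2 is Some a then \tr (X ^+ a) else 1) * c X),
    ((node_tr (N p)).1 ++ L); split=> [|h|h|X i j].
  - apply: GL_invariantM => //; apply: GL_invariantM; first exact: GL_invariant_const.
    by case: (node_tr (N p)).2 => [a|]; [exact: GL_invariant_trace|exact: GL_invariant_const].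
  - rewrite map_cat count_cat h1 [RHS](big_setD1 p) //=; congr addn.
    by case: (N p).
  - rewrite map_cat count_cat h2 [RHS](big_setD1 p) //=; congr addn.
    by case: (N p).
  rewrite -/(G X i j) GE chains_cat -!mulrA; congr (_ * _).
  transitivity (\tr (node_mx X i j (N p)) * (c X * chains X i j L)); last first.
    by rewrite node_trP -mulrA mulrCA; congr (_ * _); rewrite mulrCA.
  rewrite -h3 mulr_sumr; apply: eq_bigr => y _; rewrite /mxtrace mulr_suml; apply: eq_bigr => u _.
  rewrite /G (big_setD1 p) //= !ffunE fixp !eqxx; congr (_ * _).
  apply: eq_bigr => q; rewrite !inE => /andP[qp qA]; rewrite !ffunE (negbTE qp).
  have tq : th q != p by rewrite -{1}fixp (inj_eq perm_inj).
  by rewrite (negbTE tq) /th' permM fixp tperm1 perm1.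
pose p' := (th^-1)%g p.
have thp' : th p' = p by rewrite permKV.
have p'p : p' != p by apply: contraNneq nfix => e; rewrite -{1}e thp'.
have p'A : p' \in A :\ p by rewrite !inE p'p -(perm_closed _ hth) thp'.
(* Summing over the index at p multiplies the matrices at p and at its predecessor; the product is
   stored at the predecessor. *)
pose N' q := if q == p' then (node_mul (N p) (N p')).2 else N q.
have [c [L [hc h1 h2 h3]]] := IH _ _ N' A'm hth'.
exists (fun X => n%:R^-1 * c X), ((node_mul (N p) (N p')).1 ++ L); split=> [|h|h|X i j].
- by apply: GL_invariantM => //; exact: GL_invariant_const.
- rewrite map_cat count_cat h1 (big_setD1 p' p'A) [in RHS](big_setD1 p pA) [in RHS](big_setD1 p' p'A) /=.
  rewrite {1}/N' eqxx addnA addnA (node_mul_labels _ _ h).1; congr addn.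
  by apply: eq_bigr => q; rewrite !inE => /andP[qp' _]; rewrite /N' (negbTE qp').
- rewrite map_cat count_cat h2 (big_setD1 p' p'A) [in RHS](big_setD1 p pA) [in RHS](big_setD1 p' p'A) /=.
  rewrite {1}/N' eqxx addnA addnA (node_mul_labels _ _ h).2; congr addn.
  by apply: eq_bigr => q; rewrite !inE => /andP[qp' _]; rewrite /N' (negbTE qp').
rewrite -/(G X i j) GE chains_cat -!mulrA; congr (_ * _).
rewrite [RHS]mulrCA -h3 mulr_sumr; apply: eq_bigr => y _.
rewrite (big_setD1 p' p'A) /= {1}/N' eqxx mulrA.
have -> : th' p' = th p by rewrite /th' permM thp' tpermL.
transitivity ((node_mx X i j (N p) *m node_mx X i j (N p')) (y (th p)) (y p') *
  \prod_(q in A :\ p :\ p') node_mx X i j (N q) (y (th q)) (y q)); last first.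
  rewrite node_mulP mxE; congr (_ * _); apply: eq_bigr => q; rewrite !inE => /andP[qp' /andP[qp qA]].
  rewrite /N' (negbTE qp') /th' permM tpermD //.
    by rewrite -thp' (inj_eq perm_inj) eq_sym.
  by rewrite (inj_eq perm_inj) eq_sym.
rewrite mxE mulr_suml; apply: eq_bigr => u _.
rewrite /G (big_setD1 p) //= (big_setD1 p' p'A) /= !ffunE thp' !eqxx (negbTE nfix) (negbTE p'p) mulrA.
congr (_ * _); apply: eq_bigr => q; rewrite !inE => /andP[qp' /andP[qp qA]].
by rewrite !ffunE (negbTE qp) -{1}thp' (inj_eq perm_inj) (negbTE qp').
Qed.

End TraceNetwork.

(** * Cayley-Hamilton with invariant coefficients *)

Section PowerReduction.
Variables (k : fieldType) (n : nat).

Definition poly_regular (F : 'M[k]_n -> {poly k}) := forall i, regular (fun A => (F A)`_i).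

Lemma poly_regular_prod (J : Type) (r : seq J) (F : J -> 'M[k]_n -> {poly k}) :
  (forall j, poly_regular (F j)) -> poly_regular (fun A => \prod_(j <- r) F j A).
Proof.
move=> h; elim: r => [|x r IH] i.
  by apply: regular_eq (regular_const n ((1 : {poly k})`_i)) => A; rewrite big_nil.
have hs : regular (fun A => \sum_(j < i.+1) (F x A)`_j * (\prod_(j <- r) F j A)`_(i - j)).
  by apply: regular_sum => j; apply: regularM; [exact: h|exact: IH].
by apply: regular_eq hs => A; rewrite big_cons coefM.
Qed.

Lemma poly_regular_char_poly : poly_regular (fun A => char_poly A).
Proof.
move=> i; have hs : regular (fun A : 'M[k]_n => \sum_(s : 'S_n) (-1) ^+ s *
    (\prod_j char_poly_mx A j (s j))`_i).
  apply: regular_sum => s; apply: regularM; first exact: regular_const.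
  apply: poly_regular_prod => j d.
  have h2 : regular (fun A : 'M[k]_n => ('X *+ (j == s j))`_d + (- (d == 0%N)%:R) * A j (s j)).
    apply: regularD; first exact: regular_const.
    by apply: regularM; [exact: regular_const|exact: regular_entry].
  apply: regular_eq h2 => A; rewrite !mxE coefB coefC.
  by case: (d == 0%N); rewrite ?mulN1r ?oppr0 ?mul0r ?subr0 ?addr0.
apply: regular_eq hs => A; rewrite /char_poly /determinant coef_sum; apply: eq_bigr => s _.
by case: (odd_perm s); rewrite ?expr0 ?mul1r // !expr1 !mulN1r coefN.
Qed.

Lemma char_poly_conj (S A : 'M[k]_n) : S \in unitmx ->
  char_poly (invmx S *m A *m S) = char_poly A.
Proof.
move=> hS; rewrite /char_poly.
have -> : char_poly_mx (invmx S *m A *m S) =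
    map_mx polyC (invmx S) *m char_poly_mx A *m map_mx polyC S.
  rewrite /char_poly_mx !map_mxM mulmxBr mulmxBl; congr (_ - _).
  by rewrite scalar_mxC -mulmxA -map_mxM mulVmx // map_mx1 mulmx1.
rewrite !det_mulmx !det_map_mx mulrAC -rmorphM /= -det_mulmx mulVmx //.
by rewrite det1 mul1r.
Qed.

Lemma GL_invariant_char_poly i : GL_invariant (fun A : 'M[k]_n => (char_poly A)`_i).
Proof.
split; first exact: poly_regular_char_poly.
by move=> S hS A; rewrite /Defs.act char_poly_conj.
Qed.

Definition power_combination (F : 'M[k]_n -> 'M[k]_n) := exists c : 'I_n -> 'M[k]_n -> k,
  (forall m, GL_invariant (c m)) /\ forall X, F X = \sum_(m < n) c m X *: X ^+ m.

Lemma power_combination_eq F G : F =1 G -> power_combination F -> power_combination G.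
Proof. by move=> e [c [h1 h2]]; exists c; split=> // X; rewrite -e. Qed.

Lemma power_combination_sum (J : Type) (r : seq J) (c : J -> 'M[k]_n -> k) F :
  (forall j, GL_invariant (c j)) -> (forall j, power_combination (F j)) ->
  power_combination (fun X => \sum_(j <- r) c j X *: F j X).
Proof.
move=> hc hF; elim: r => [|x r [d [d1 d2]]].
  exists (fun _ _ => 0); split=> [m|X]; first exact: GL_invariant_const.
  by rewrite big_nil big1 // => m _; rewrite scale0r.
have [e [e1 e2]] := hF x; exists (fun m X => c x X * e m X + d m X); split=> [m|X].
  by apply: GL_invariantD => //; exact: GL_invariantM.
rewrite big_cons d2 e2 scaler_sumr -big_split /=; apply: eq_bigr => m _.
by rewrite scalerDl scalerA.
Qed.

Lemma power_combination_expr l : (l <= n)%N -> power_combination (fun X => X ^+ l).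
Proof.
rewrite leq_eqVlt => /orP[/eqP ->|ln]; last first.
  exists (fun m _ => (m == l :> nat)%:R); split=> [m|X]; first exact: GL_invariant_const.
  rewrite (bigD1 (Ordinal ln)) //= eqxx scale1r big1 ?addr0 // => m nm.
  by rewrite -[m == l :> nat]/(m == Ordinal ln) (negbTE nm) scale0r.
exists (fun m X => - (char_poly X)`_m); split=> [m|X].
  have h := GL_invariantM (GL_invariant_const n (-1)) (GL_invariant_char_poly m).
  by apply: GL_invariant_eq h => X; rewrite mulN1r.
case: n X => [|n'] X; first by apply/matrixP => -[].
have := Cayley_Hamilton X; rewrite -{1}[char_poly X]coefK size_char_poly poly_def.
rewrite rmorph_sum big_ord_recr /= => /eqP; rewrite addrC addr_eq0 => /eqP.
have -> : (char_poly X)`_n'.+1 = 1.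
  by have := char_poly_monic X; rewrite monicE /lead_coef size_char_poly => /eqP.
rewrite scale1r rmorphXn /= horner_mx_X => ->; rewrite -sumrN; apply: eq_bigr => m _.
by rewrite linearZ /= rmorphXn /= horner_mx_X scaleNr.
Qed.

Lemma power_combination_pow l : power_combination (fun X => X ^+ l).
Proof.
elim: l => [|l [c [c1 c2]]]; first exact: power_combination_expr.
have h := @power_combination_sum _ (index_enum 'I_n) c (fun (m : 'I_n) X => X ^+ m.+1) c1
  (fun m => power_combination_expr (ltn_ord m)).
apply: power_combination_eq h => X; rewrite exprS c2 mulr_sumr; apply: eq_bigr => m _.
by rewrite exprS -[RHS]scalemxAr.
Qed.

(** Cayley-Hamilton reduces to the exponents 0 to n - 1, and the exponent 0 gives the identity
    matrix, which has no off-diagonal entries. *)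
Lemma offdiag_power_reduction l : exists c : 'I_n.-1 -> 'M[k]_n -> k,
  (forall m, GL_invariant (c m)) /\
  forall (X : 'M[k]_n) (i j : 'I_n), i != j -> (X ^+ l) i j = \sum_(m < n.-1) c m X * (X ^+ m.+1) i j.
Proof.
have [c [c1 c2]] := power_combination_pow l.
have e (m : 'I_n.-1) : (m.+1 < n)%N by have := ltn_ord m; lia.
exists (fun m => c (Ordinal (e m))); split=> // X i j ij; rewrite c2 summxE.
case: n c c1 c2 e X i j ij => [|n'] c c1 c2 e X i j ij; first by case: i ij.
rewrite big_ord_recl /= mxE expr0 mxE (negbTE ij) mulr0 add0r; apply: eq_bigr => m _.
by rewrite mxE; congr (c _ X * _); apply: val_inj.
Qed.

End PowerReduction.

(** Every label starts exactly one chain and ends exactly one chain, so following chains from start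
    to end is a permutation. *)
Lemma chains_bijection (k : fieldType) (n : nat) (I : finType) (L : seq (I * nat * I)) :
  (forall h, count_mem h (map (fun x => x.1.1) L) = 1%N) ->
  (forall h, count_mem h (map snd L) = 1%N) ->
  exists (l : I -> nat) (al : {perm I}), forall (X : 'M[k]_n) i j,
    chains X i j L = \prod_h (X ^+ l h) (i h) (j (al h)).
Proof.
move=> h1 h2.
have ex h : {x | x \in L & x.1.1 = h}.
  have /mapP/sig2_eqW[x xL e] : h \in map (fun x => x.1.1) L by rewrite -has_pred1 has_count h1.
  by exists x.
pose g h := s2val (ex h).
have gL h : g h \in L by rewrite /g; case: (ex h).
have g1 h : (g h).1.1 = h by rewrite /g; case: (ex h).
have u1 : uniq (map (fun x : I * nat * I => x.1.1) L).
  by apply: count_mem_uniq => h; rewrite h1 -has_pred1 has_count h1.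
have sz : size L = #|I|.
  rewrite -(size_map (fun x => x.1.1)) cardE; apply/perm_size/uniq_perm; rewrite ?enum_uniq //.
  by move=> h; rewrite mem_enum inE -has_pred1 has_count h1.
have ug : uniq (map g (enum I)).
  by rewrite map_inj_uniq ?enum_uniq // => x y e; rewrite -(g1 x) e g1.
have pL : perm_eq L (map g (enum I)).
  rewrite perm_sym; apply: uniq_perm; rewrite ?(map_uniq u1) //.
  have [] := @uniq_min_size _ (map g (enum I)) L ug; last by [].
    by move=> x /mapP[h _ ->].
  by rewrite size_map -cardE sz.
have inj : injective (fun h => (g h).2).
  apply/injectiveP; rewrite /injectiveb /dinjectiveb.
  rewrite (map_comp snd g) -(perm_uniq (perm_map snd pL)).
  by apply: count_mem_uniq => h; rewrite h2 -has_pred1 has_count h2.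
exists (fun h => (g h).1.2), (perm inj) => X i j.
rewrite /chains (perm_big _ pL) big_map big_enum /=.
by apply: eq_bigr => h _; rewrite permE g1.
Qed.

(** * Levi-Civita symbols and duality *)

Definition upd (T : finType) (A : Type) (y : {ffun T -> A}) (p : T) (v : A) : {ffun T -> A} :=
  [ffun q => if q == p then v else y q].

Lemma updE (T : finType) (A : Type) (y : {ffun T -> A}) p v q :
  upd y p v q = if q == p then v else y q.
Proof. by rewrite ffunE. Qed.

Lemma upd_upd (T : finType) (A : Type) (y : {ffun T -> A}) p v w : upd (upd y p v) p w = upd y p w.
Proof. by apply/ffunP => q; rewrite !ffunE; case: eqP. Qed.

Lemma upd_id (T : finType) (A : Type) (y : {ffun T -> A}) p : upd y p (y p) = y.
Proof. by apply/ffunP => q; rewrite !ffunE; case: eqP => [->|]. Qed.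

Lemma updC (T : finType) (A : Type) (y : {ffun T -> A}) p q v w : p != q ->
  upd (upd y p v) q w = upd (upd y q w) p v.
Proof.
move=> pq; apply/ffunP => x; rewrite !ffunE; case: (x =P q) => // ->.
by rewrite eq_sym (negbTE pq).
Qed.

Section LeviCivita.
Variables (k : fieldType) (n : nat).
Hypothesis hk : [pchar k] =i pred0.

Definition unit_rows (z : 'I_n -> 'I_n) : 'M[k]_n := \matrix_(c, u) (z c == u)%:R.
Definition eps (z : 'I_n -> 'I_n) : k := \det (unit_rows z).

Lemma eps_upd (z : {ffun 'I_n -> 'I_n}) c v : eps (upd z c v) = cofactor (unit_rows z) c v.
Proof.
rewrite /eps (expand_det_row _ c) (bigD1 v) //= big1 ?addr0 => [|w /negbTE wv].
  rewrite mxE updE !eqxx mul1r /cofactor; congr (_ * \det _).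
  by apply/matrixP => i j; rewrite !mxE updE (_ : (lift c i == c) = false) // eq_sym (negbTE (neq_lift _ _)).
by rewrite mxE updE eqxx eq_sym wv mul0r.
Qed.

(* The symbol is killed by the Lie algebra element E_uv of sl_n. *)
Lemma eps_raising (z : {ffun 'I_n -> 'I_n}) u v : u != v ->
  \sum_(c | z c == u) eps (upd z c v) = 0.
Proof.
move=> uv; transitivity ((\adj (unit_rows z) *m unit_rows z) v u); last first.
  by rewrite mul_adj_mx mxE eq_sym (negbTE uv).
rewrite [RHS]mxE [LHS]big_mkcond /=; apply: eq_bigr => c _.
by rewrite eps_upd !mxE; case: eqP; rewrite ?mulr1 ?mulr0.
Qed.

Lemma eps_noninj (z : 'I_n -> 'I_n) c c' : c != c' -> z c = z c' -> eps z = 0.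
Proof. by move=> cc e; apply: (determinant_alternate cc) => u; rewrite !mxE e. Qed.

Lemma eps_inj (z : 'I_n -> 'I_n) : eps z != 0 -> injective z.
Proof.
move=> h c c' e; apply/eqP; apply: contraNT h => cc; apply/eqP; exact: eps_noninj cc e.
Qed.

Lemma eps_perm (s : 'S_n) : eps s = (-1) ^+ s.
Proof. by rewrite -det_perm; congr (\det _); apply/matrixP => i j; rewrite !mxE. Qed.

Lemma eps_sqr (z : {ffun 'I_n -> 'I_n}) : eps z ^+ 2 = (injectiveb z)%:R.
Proof.
case: injectiveP => [h|h].
  have -> : eps z = eps (perm h) by congr (\det _); apply/matrixP => i j; rewrite !mxE permE.
  by rewrite eps_perm -exprM mulnC exprM sqrrN expr1n expr1n.
have [->|/eps_inj//] := eqVneq (eps z) 0; by rewrite expr0n.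
Qed.

End LeviCivita.

Arguments eps k {n} z.

Section LeviCivitaPos.
Variables (k : fieldType) (n : nat).
Hypothesis hk : [pchar k] =i pred0.
Local Notation eps := (@eps k n.+1).

Definition eps_norm : k := \sum_(z : {ffun 'I_n.+1 -> 'I_n.+1} | z ord0 == ord0) eps z ^+ 2.

Lemma eps_norm_neq0 : eps_norm != 0.
Proof.
rewrite /eps_norm; under eq_bigr => z _ do rewrite eps_sqr.
rewrite -natr_sum natf_neq0_char0 // (bigD1 [ffun x => x]) /= ?ffunE //.
have -> : injectiveb [ffun x : 'I_n.+1 => x]; last by rewrite add1n.
by apply/injectiveP => x y; rewrite !ffunE.
Qed.

Lemma eps_normE (i : 'I_n.+1) : \sum_(z : {ffun 'I_n.+1 -> 'I_n.+1} | z ord0 == i) eps z ^+ 2 = eps_norm.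
Proof.
rewrite /eps_norm (reindex_inj (h := fun z : {ffun 'I_n.+1 -> 'I_n.+1} => [ffun c => tperm i ord0 (z c)])) /=; last first.
  by move=> z z' /ffunP e; apply/ffunP => c; have := e c; rewrite !ffunE => /perm_inj.
apply: eq_big => z; first by rewrite ffunE (canF_eq (tpermK _ _)) tpermL.
rewrite !eps_sqr => _; congr (_%:R); congr nat_of_bool; apply/injectiveP/injectiveP => h x y.
  by move=> e; apply: h; rewrite !ffunE e.
by rewrite !ffunE => /perm_inj; exact: h.
Qed.

(** Two symbols contracted in all slots but the first give a multiple of the identity. The value of
    z in slot 0 is overwritten in both symbols; fixing it to j only makes each choice of the other
    slots count once. *)
Lemma eps_pairing (i i' j : 'I_n.+1) :
  \sum_(z : {ffun 'I_n.+1 -> 'I_n.+1} | z ord0 == j) eps (upd z ord0 i) * eps (upd z ord0 i') =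
  (i == i')%:R * eps_norm.
Proof.
have [<-|ii] := eqVneq i i'; last first.
  rewrite mul0r big1 // => z _; apply/eqP; rewrite mulf_eq0 -implyNb; apply/implyP => h.
  have inj := eps_inj h.
  have [c ec] : exists c, upd z ord0 i c = i'.
    by exists ((perm inj)^-1%g i'); rewrite -[upd _ _ _ _](permE inj) permKV.
  have c0 : c != ord0 by apply: contraNneq ii => e; rewrite -ec e updE eqxx.
  apply/eqP; apply: (eps_noninj k c0).
  by rewrite !updE eqxx (negbTE c0) -ec updE (negbTE c0).
rewrite mul1r -(eps_normE i).
rewrite (reindex_onto (fun z : {ffun 'I_n.+1 -> 'I_n.+1} => upd z ord0 j) (fun z => upd z ord0 i)) /=; last first.
  by move=> z /eqP <-; rewrite upd_upd upd_id.
apply: eq_big => z; last by rewrite upd_upd => /andP[_ /eqP ->]; rewrite expr2.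
rewrite updE !eqxx upd_upd andTb; apply/eqP/eqP => [<-|<-]; first by rewrite updE eqxx.
by rewrite upd_id.
Qed.

End LeviCivitaPos.

(** * A product of determinants as one signed sum *)

Section BlockDet.
Variables (k : comNzRingType) (d n : nat).
Local Notation R0 := ('I_d * 'I_n)%type.

Lemma det_blocks (M : 'I_d -> 'M[k]_n) : \prod_q \det (M q) =
  \sum_(s : {perm R0} | [forall x, (s x).1 == x.1]) (-1) ^+ s * \prod_x M x.1 x.2 (s x).2.
Proof.
rewrite /determinant bigA_distr_bigA /=.
have pinj (F : {ffun 'I_d -> 'S_n}) : injective (fun x : R0 => (x.1, F x.1 x.2)).
  by move=> [a b] [c e] /= [<- /perm_inj <-].
pose sF F : {perm R0} := perm (pinj F).
have sF_inj : injective sF.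
  move=> F G /permP e; apply/ffunP => q; apply/permP => c.
  by have := e (q, c); rewrite !permE /= => -[].
have sF_surj (s : {perm R0}) : (forall x, (s x).1 = x.1) -> exists F, sF F = s.
  move=> h; have finj q : injective (fun c => (s (q, c)).2).
    move=> c c' e; have : s (q, c) = s (q, c').
      by rewrite [LHS]surjective_pairing [RHS]surjective_pairing e !h.
    by move/perm_inj => [].
  exists [ffun q => perm (finj q)]; apply/permP => -[q c]; rewrite permE ffunE permE /=.
  by rewrite -{1}[q]/((q, c).1) -h -surjective_pairing.
pose Fs s := odflt [ffun=> 1%g] [pick F | sF F == s].
have FsK F : Fs (sF F) = F.
  rewrite /Fs; case: pickP => [G /eqP /sF_inj //|/(_ F)]; by rewrite eqxx.
have sF1 F x : (sF F x).1 = x.1 by rewrite permE.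
pose pres (s : {perm R0}) := [forall x, (s x).1 == x.1].
have pres_sF F : pres (sF F) by apply/forallP => x; rewrite sF1.
have sF_one : sF [ffun=> 1%g] = 1%g.
  by apply/permP => x; rewrite perm1 permE ffunE perm1 -surjective_pairing.
(* The product of block signs, extended by 0 to permutations mixing blocks, is alternating within
   blocks; by [alternating_extend] it is the global sign on block permutations. *)
have sgn F : (-1) ^+ sF F = \prod_q (-1) ^+ F q :> k.
  pose V (s : {perm R0}) : k := if pres s then \prod_q (-1) ^+ Fs s q else 0.
  have V1 : V 1%g = 1.
    by rewrite -sF_one /V pres_sF FsK big1 // => q _; rewrite ffunE odd_perm1.
  have VF G : V (sF G) = \prod_q (-1) ^+ G q by rewrite /V pres_sF FsK.
  have := @alternating_extend R0 _ fst k V _ (sF F) 1%g; rewrite mulg1 V1 mulr1 VF => <- //.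
  move=> x y s xy exy.
  have tpres : pres (tperm x y * s)%g = pres s.
    have h3 z : (tperm x y z).1 = z.1 by case: tpermP => [->|->|].
    apply/forallP/forallP => h z.
      by have := h (tperm x y z); rewrite permM tpermK h3.
    by rewrite permM (eqP (h _)) h3.
  rewrite /V tpres; case hs: (pres s); last by rewrite oppr0.
  have [G <-] := sF_surj s (fun x => eqP (forallP hs x)).
  have h2 : x.2 != y.2.
    by apply: contraNneq xy => e; rewrite [x]surjective_pairing [y]surjective_pairing exy e.
  have -> : (tperm x y * sF G)%g = sF [ffun q => if q == x.1 then (tperm x.2 y.2 * G q)%g else G q].
    apply/permP => z; rewrite permM !permE ffunE /=.
    have [->|zx] := eqVneq z x; first by rewrite eqxx -exy permM tpermL.
    have [->|zy] := eqVneq z y; first by rewrite -exy eqxx permM tpermR.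
    case: eqP => [e|//]; rewrite permM tpermD //.
      by apply: contraNneq zx => e2; rewrite [x]surjective_pairing [z]surjective_pairing e e2.
    by apply: contraNneq zy => e2; rewrite [y]surjective_pairing [z]surjective_pairing -exy e e2.
  rewrite !FsK (bigD1 x.1) //= [in RHS](bigD1 x.1) //= ffunE eqxx odd_permM odd_tperm h2.
  rewrite addTb signrN mulNr; congr (- (_ * _)).
  by apply: eq_bigr => q /negbTE qx; rewrite ffunE qx.
rewrite [RHS](reindex_onto sF Fs) /=; last first.
  by move=> s /forallP hs; have [G <-] := sF_surj s (fun x => eqP (hs x)); rewrite FsK.
apply: eq_big => F; first by rewrite -/(pres _) pres_sF FsK eqxx.
move=> _; rewrite sgn big_split /=; congr (_ * _); rewrite pair_big /=.
by apply: eq_bigr => x _; rewrite permE.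
Qed.
End BlockDet.

(** * Trading covariant indices for contravariant ones *)

Section Tensor.
Variables (k : fieldType) (d n : nat).
Hypothesis hk : [pchar k] =i pred0.
Local Notation idx := {ffun 'I_d -> 'I_n.+1}.
Local Notation R0 := ('I_d * 'I_n.+1)%type.
Local Notation eps := (@eps k n.+1).
Variable a : idx -> idx -> k.

Definition slot0 (y : {ffun R0 -> 'I_n.+1}) : idx := [ffun q => y (q, ord0)].
Definition slice (y : {ffun R0 -> 'I_n.+1}) (q : 'I_d) : {ffun 'I_n.+1 -> 'I_n.+1} := [ffun c => y (q, c)].

(* The covariant index i q is replaced by the indices y (q, c), c > 0, of the  *)
(* Levi-Civita symbol; y (q, 0) is the q-th contravariant index.               *)
Definition dual_tensor (y : {ffun R0 -> 'I_n.+1}) : k :=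
  \sum_(i : idx) a i (slot0 y) * \prod_q eps (upd (slice y q) ord0 (i q)).

Definition det_monomial (X : 'M[k]_n.+1) (y : {ffun R0 -> 'I_n.+1}) : k :=
  \prod_q \sum_i X i (y (q, ord0)) * eps (upd (slice y q) ord0 i).

(** The slots (q, 0) reproduce the action on the contravariant indices of [a], the other slots minus
    the action on the covariant ones; the infinitesimal invariance of [a] makes the two cancel. *)
Lemma dual_tensor_raising (u v : 'I_n.+1) :
  u != v ->
  (forall i j : idx, \sum_(q | j q == u) a i (upd j q v) = \sum_(q | i q == v) a (upd i q u) j) ->
  forall y : {ffun R0 -> 'I_n.+1}, \sum_(p | y p == u) dual_tensor (upd y p v) = 0.
Proof.
move=> uv ha y; set j := slot0 y.
pose e q i := eps (upd (slice y q) ord0 i).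
have slice_ne q c q' : q' != q -> slice (upd y (q, c) v) q' = slice y q'.
  by move=> h; apply/ffunP => c'; rewrite !ffunE xpair_eqE (negbTE h).
have slice_eq q c : slice (upd y (q, c) v) q = upd (slice y q) c v.
  by apply/ffunP => c'; rewrite !ffunE xpair_eqE eqxx.
transitivity (\sum_q \sum_(c | y (q, c) == u) dual_tensor (upd y (q, c) v)).
  by rewrite [RHS]pair_big_dep /=; apply: eq_big => [[q c]|[q c]].
have E0 q : dual_tensor (upd y (q, ord0) v) = \sum_(i : idx) a i (upd j q v) * \prod_q e q (i q).
  apply: eq_bigr => i _; congr (a i _ * _).
    by apply/ffunP => q'; rewrite !ffunE xpair_eqE eqxx andbT.
  apply: eq_bigr => q' _; have [->|h] := eqVneq q' q; last by rewrite slice_ne.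
  by rewrite slice_eq upd_upd.
have E1 q c : c != ord0 -> dual_tensor (upd y (q, c) v) = \sum_(i : idx) a i j *
    ((\prod_(q' | q' != q) e q' (i q')) * eps (upd (upd (slice y q) ord0 (i q)) c v)).
  move=> c0; apply: eq_bigr => i _; congr (a i _ * _).
    by apply/ffunP => q'; rewrite !ffunE xpair_eqE [ord0 == c]eq_sym (negbTE c0) andbF.
  rewrite (bigD1 q) //= slice_eq updC // mulrC; congr (_ * _).
  by apply: eq_bigr => q' h; rewrite slice_ne.
(* By [eps_raising] the slots c > 0 contribute minus the missing slot 0 term, in which the covariant
   index [i q] goes from u to v; reindexing i moves this change into [a]. *)
have S1 q : \sum_(c | (y (q, c) == u) && (c != ord0)) dual_tensor (upd y (q, c) v) =
    - \sum_(i : idx | i q == v) a (upd i q u) j * \prod_q e q (i q).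
  under eq_bigr => c /andP[_ c0] do rewrite E1 //.
  rewrite exchange_big /=.
  under eq_bigr => i _ do rewrite -mulr_sumr -mulr_sumr.
  have es (i : idx) : \sum_(c | (y (q, c) == u) && (c != ord0)) eps (upd (upd (slice y q) ord0 (i q)) c v) =
      - (if i q == u then e q v else 0).
    have := eps_raising k (upd (slice y q) ord0 (i q)) uv.
    rewrite (bigID (fun c => c != ord0)) /= => /eqP; rewrite addr_eq0 => /eqP h.
    rewrite (_ : (if i q == u then e q v else 0) =
        \sum_(c | (upd (slice y q) ord0 (i q) c == u) && ~~ (c != ord0)) eps (upd (upd (slice y q) ord0 (i q)) c v)).
      by rewrite -h; apply: eq_bigl => c; case: (altP (c =P ord0)) => [_|c0]; rewrite ?andbF // updE (negbTE c0) ffunE.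
    case: eqP => iu.
      rewrite (big_pred1 ord0) ?upd_upd // => c; rewrite negbK andbC /=; case: (c =P ord0) => //= ->.
      by rewrite updE eqxx iu eqxx.
    rewrite big_pred0 // => c; rewrite negbK andbC /=; case: (c =P ord0) => //= ->.
    by rewrite updE eqxx; apply/eqP.
  under eq_bigr => i _ do rewrite es.
  rewrite -sumrN [RHS](reindex_onto (fun i : idx => upd i q v) (fun i => upd i q u)) /=; last first.
    by move=> i /eqP <-; rewrite upd_upd upd_id.
  rewrite (bigID (fun i : idx => i q == u)) /= [X in _ + X]big1 ?addr0; last first.
    by move=> i /negbTE ->; rewrite oppr0 !mulr0.
  apply: eq_big => i.
    by rewrite updE !eqxx upd_upd /=; apply/eqP/eqP => [<-|<-]; rewrite ?upd_id // updE eqxx.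
  move=> /eqP iu; rewrite iu eqxx upd_upd mulrN mulrN; congr (- _).
  rewrite -iu upd_id; congr (_ * _); rewrite [RHS](bigD1 q) //= updE eqxx mulrC; congr (_ * _).
  by apply: eq_bigr => q' h; rewrite updE (negbTE h).
transitivity (\sum_(i : idx) (\sum_(q | j q == u) a i (upd j q v) - \sum_(q | i q == v) a (upd i q u) j)
    * \prod_q e q (i q)); last by rewrite big1 // => i _; rewrite ha subrr mul0r.
transitivity (\sum_q ((if j q == u then \sum_(i : idx) a i (upd j q v) * \prod_q e q (i q) else 0) -
    \sum_(i : idx | i q == v) a (upd i q u) j * \prod_q e q (i q))).
  apply: eq_bigr => q _; rewrite (bigID (fun c => c != ord0)) /= addrC S1; congr (_ - _).
  case: (altP (j q =P u)) => h.
    rewrite (big_pred1 ord0) ?E0 // => c; rewrite negbK andbC /=; case: (c =P ord0) => //= ->.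
    by rewrite -h ffunE eqxx.
  rewrite big_pred0 // => c; rewrite negbK andbC /=; case: (c =P ord0) => //= ->.
  by move: h; rewrite ffunE; apply: negbTE.
rewrite sumrB -big_mkcond /=; under [RHS]eq_bigr => i _ do rewrite mulrBl !mulr_suml.
rewrite sumrB; congr (_ - _); first by rewrite exchange_big.
rewrite (exchange_big_dep xpredT) //=.
Qed.

(** Dualizing loses nothing: for each q the symbol in [dual_tensor] and the one in [det_monomial]
    contract to the identity by [eps_pairing]. *)
Lemma dual_tensor_pairing (X : 'M[k]_n.+1) :
  \sum_y dual_tensor y * det_monomial X y =
  eps_norm k n ^+ d * \sum_(i : idx) \sum_(j : idx) a i j * \prod_q X (i q) (j q).
Proof.
under eq_bigr => y _ do rewrite mulr_suml.
rewrite exchange_big /= mulr_sumr; apply: eq_bigr => i _.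
rewrite (partition_big slot0 xpredT) //= mulr_sumr; apply: eq_bigr => j _.
pose g q (z : {ffun 'I_n.+1 -> 'I_n.+1}) :=
  eps (upd z ord0 (i q)) * \sum_u X u (z ord0) * eps (upd z ord0 u).
transitivity (a i j * \sum_(y | slot0 y == j) \prod_q g q (slice y q)).
  rewrite mulr_sumr; apply: eq_bigr => y /eqP <-; rewrite -mulrA; congr (_ * _).
  by rewrite /det_monomial -big_split /=; apply: eq_bigr => q _; rewrite /g ffunE.
rewrite mulrCA; congr (_ * _).
pose cur (Y : {ffun 'I_d -> {ffun 'I_n.+1 -> 'I_n.+1}}) : {ffun R0 -> 'I_n.+1} := [ffun p => Y p.1 p.2].
rewrite (reindex cur); last first.
  exists (fun y => [ffun q => slice y q]) => Y _; first by apply/ffunP => q; apply/ffunP => c; rewrite !ffunE.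
  by apply/ffunP => -[q c]; rewrite !ffunE.
have -> : eps_norm k n ^+ d = \prod_(q < d) eps_norm k n by rewrite prodr_const card_ord.
rewrite -big_split /=.
transitivity (\prod_q \sum_(z : {ffun 'I_n.+1 -> 'I_n.+1} | z ord0 == j q) g q z).
  rewrite bigA_distr_big_dep /=; apply: eq_big => [Y|Y _].
    apply/eqP/familyP => [<- q|h]; first by rewrite unfold_in /= !ffunE.
    by apply/ffunP => q; rewrite !ffunE; apply/eqP; have := h q; rewrite unfold_in.
  by apply: eq_bigr => q _; congr (g q _); apply/ffunP => c; rewrite !ffunE.
apply: eq_bigr => q _.
transitivity (\sum_u X u (j q) * ((i q == u)%:R * eps_norm k n)).
  under [RHS]eq_bigr => u _ do rewrite -(eps_pairing k (i q) u (j q)) mulr_sumr.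
  rewrite exchange_big /=; apply: eq_bigr => z /eqP e.
  by rewrite /g mulr_sumr; apply: eq_bigr => u _; rewrite e; ring.
rewrite (bigD1 (i q)) //= eqxx mul1r big1 ?addr0 1?mulrC // => u /negbTE h.
by rewrite eq_sym h mul0r mulr0.
Qed.

Lemma det_monomialE X y : det_monomial X y =
  \prod_q \det (\matrix_(c, u) (if c == ord0 then X u (y (q, ord0)) else (y (q, c) == u)%:R)).
Proof.
apply: eq_bigr => q _; rewrite (expand_det_row _ ord0); apply: eq_bigr => u _.
rewrite mxE eqxx eps_upd; congr (_ * (_ * \det _)).
by apply/matrixP => i j; rewrite !mxE ffunE (_ : (lift ord0 i == ord0) = false) // eq_sym (negbTE (neq_lift _ _)).
Qed.

End Tensor.

Lemma big_in_setT (R : Type) (idx : R) (op : R -> R -> R) (T : finType) (F : T -> R) :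
  \big[op/idx]_(i in [set: T]) F i = \big[op/idx]_i F i.
Proof. by apply: eq_bigl => i; rewrite inE. Qed.

(** * Contracting an alternating function to traces and entries of powers *)

Section Contraction.
Variables (k : fieldType) (d n : nat) (I : finType).
Hypothesis hk : [pchar k] =i pred0.
Local Notation R0 := ('I_d * 'I_n.+1)%type.
Variables (iota : I -> R0) (rho : R0 -> 'I_n.+1) (kap : R0 -> nat) (V : {perm R0} -> k).
Hypothesis iota_inj : injective iota.
Hypothesis rho_out : forall x, x \notin codom iota -> rho x = x.2.
Hypothesis kap_out : forall x, x \notin codom iota -> kap x = x.1.
Hypothesis V_alt : forall x y a, x != y -> kap x = kap y -> V (tperm x y * a)%g = - V a.

(* [(c, l, al)] stands for c(X) prod_h (X^{l h})_{i h, j (al h)}. *)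
Definition network_term := ({c : 'M[k]_n.+1 -> k | GL_invariant c} * (I -> nat) * {perm I})%type.

Definition expandable (F : 'M[k]_n.+1 -> (I -> 'I_n.+1) -> (I -> 'I_n.+1) -> k) :=
  exists s : seq network_term, forall X i j,
    F X i j = \sum_(x <- s) sval x.1.1 X * \prod_h (X ^+ x.1.2 h) (i h) (j (x.2 h)).

Lemma expandable_eq F G : (forall X i j, F X i j = G X i j) -> expandable F -> expandable G.
Proof. by move=> e [s h]; exists s => X i j; rewrite -e. Qed.

Lemma expandable_sum (J : Type) (r : seq J) (P : pred J) (c : J -> k) F : (forall x, P x -> expandable (F x)) ->
  expandable (fun X i j => \sum_(x <- r | P x) c x * F x X i j).
Proof.
move=> hF; elim: r => [|x r [s hs]]; first by exists [::] => X i j; rewrite !big_nil.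
case Px: (P x); last by exists s => X i j; rewrite big_cons Px.
have [s' hs'] := hF x Px.
pose sc (y : network_term) : network_term :=
  (exist _ _ (GL_invariantM (GL_invariant_const n.+1 (c x)) (svalP y.1.1)), y.1.2, y.2).
exists (map sc s' ++ s) => X i j; rewrite big_cons Px big_cat big_map hs /= hs' mulr_sumr.
by congr (_ + _); apply: eq_bigr => y _; rewrite mulrA.
Qed.

(* The boxes of the rotated mu removed from the rectangle R0 (the holes iota h) *)
(* are reused as the boxes of the appended lambda.                             *)
Definition hole x := [pick h | iota h == x].

Lemma hole_iota h : hole (iota h) = Some h.
Proof. by rewrite /hole; case: pickP => [g /eqP /iota_inj ->|/(_ h)] //; rewrite eqxx. Qed.

Lemma holeP x : (exists2 h, x = iota h & hole x = Some h) \/ (x \notin codom iota /\ hole x = None).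
Proof.
have [/codomP[h ->]|hx] := boolP (x \in codom iota); first by left; exists h; rewrite ?hole_iota.
right; split=> //; rewrite /hole; case: pickP => // h /eqP e.
by case/negP: hx; rewrite -e codom_f.
Qed.

Definition filled_row (a : {perm R0}) (i : I -> 'I_n.+1) (y : {ffun R0 -> 'I_n.+1}) x u : k :=
  if hole x is Some h then (i h == u)%:R else (y (a x) == u)%:R.

Definition filled_det a i y : k := \prod_q \det (\matrix_(c, u) filled_row a i y (q, c) u).
Definition fixed_slots (a : {perm R0}) (j : I -> 'I_n.+1) (y : {ffun R0 -> 'I_n.+1}) : k :=
  \prod_h (y (a (iota h)) == j h)%:R.

(** A version of the pairing with free indices: i is inserted at the holes of the rectangle, j is
    prescribed at the slots of the appended boxes. In this form it is visibly alternating in both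
    and visibly a network; [contraction_base] recovers the pairing itself. *)
Definition contraction X i j : k :=
  \sum_a V a * \sum_y det_monomial X y * filled_det a i y * fixed_slots a j y.

Lemma contraction_ext X i i' j j' : i =1 i' -> j =1 j' -> contraction X i j = contraction X i' j'.
Proof.
move=> ei ej; apply: eq_bigr => a _; congr (_ * _); apply: eq_bigr => y _; congr (_ * _ * _).
  apply: eq_bigr => q _; congr (\det _); apply/matrixP => c u; rewrite !mxE /filled_row.
  by case: (hole _) => [h|]; rewrite ?ei.
by apply: eq_bigr => h _; rewrite ej.
Qed.

Lemma contraction_alt_left X i j h h' : h != h' -> (iota h).1 = (iota h').1 ->
  contraction X (fun g => i (tperm h h' g)) j = - contraction X i j.
Proof.
move=> hh e1; rewrite /contraction -sumrN; apply: eq_bigr => a _; rewrite -mulrN -sumrN; congr (_ * _).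
apply: eq_bigr => y _; rewrite -mulNr -mulrN; congr (_ * _ * _).
rewrite /filled_det (bigD1 (iota h).1) //= [in RHS](bigD1 (iota h).1) //= -mulNr; congr (_ * _).
  set M := (X in _ = - \det X).
  have c_ne : (iota h).2 != (iota h').2.
    apply: contraNneq hh => e2; apply/eqP/iota_inj.
    by rewrite [iota h]surjective_pairing [iota h']surjective_pairing e1 e2.
  transitivity (\det (row_perm (tperm (iota h).2 (iota h').2) M)).
    congr (\det _); apply/matrixP => c u; rewrite !mxE /filled_row.
    case: tpermP => [->|->|/eqP n1 /eqP n2].
    - by rewrite -surjective_pairing e1 -surjective_pairing !hole_iota tpermL.
    - by rewrite -surjective_pairing e1 -surjective_pairing !hole_iota tpermR.
    - case: (holeP ((iota h).1, c)) => [[g eg ->]|[_ ->]] //.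
      rewrite tpermD //; apply/eqP => eh.
        by move: n1; rewrite eh -eg eqxx.
      by move: n2; rewrite eh -eg eqxx.
  by rewrite row_permE det_mulmx det_perm odd_tperm c_ne expr1 mulN1r.
apply: eq_bigr => q qh; congr (\det _); apply/matrixP => c u; rewrite !mxE /filled_row.
case: (holeP (q, c)) => [[g eg ->]|[_ ->]] //.
rewrite tpermD //; apply/eqP => eh; move: qh; first by rewrite eh -eg eqxx.
by rewrite e1 eh -eg eqxx.
Qed.

Lemma contraction_alt_right X i j h h' : h != h' -> kap (iota h) = kap (iota h') ->
  contraction X i (fun g => j (tperm h h' g)) = - contraction X i j.
Proof.
move=> hh e1; rewrite /contraction -sumrN.
rewrite (reindex_inj (mulgI (tperm (iota h) (iota h')))) /=; apply: eq_bigr => a _.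
rewrite V_alt ?(inj_eq iota_inj) // mulNr; congr (- (_ * _)); apply: eq_bigr => y _; congr (_ * _ * _).
  apply: eq_bigr => q _; congr (\det _); apply/matrixP => c u; rewrite !mxE /filled_row.
  case: (holeP (q, c)) => [[g eg ->]|[ng ->]] //.
  by rewrite permM tpermD //; apply: contraNneq ng => <-; rewrite codom_f.
rewrite /fixed_slots (reindex_inj (@perm_inj _ (tperm h h'))) /=; apply: eq_bigr => g _.
rewrite tpermK permM; congr ((y (a _) == _)%:R).
case: (tpermP h h' g) => [->|->|/eqP n1 /eqP n2]; rewrite ?tpermL ?tpermR //.
by rewrite tpermD // (inj_eq iota_inj) eq_sym.
Qed.

Definition left_stab (p : {perm I}) := [forall h, (iota (p h)).1 == (iota h).1].
Definition right_stab (p : {perm I}) := [forall h, kap (iota (p h)) == kap (iota h)].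

Lemma contraction_perm X i j p q : left_stab p -> right_stab q ->
  contraction X (fun h => i (p h)) (fun h => j (q h)) = (-1) ^+ p * (-1) ^+ q * contraction X i j.
Proof.
move=> /forallP hp /forallP hq.
have := @alternating_extend I _ (fun h => (iota h).1) k
  (fun p => contraction X (fun h => i (p h)) (fun h => j (q h))) _ p 1%g _.
rewrite mulg1 => -> //; last first.
- by move=> h; apply/eqP.
- move=> h h' s hh e; rewrite -(contraction_alt_left X (fun h => i (s h)) _ hh e).
  by apply: contraction_ext => // g; rewrite permM.
rewrite -mulrA; congr (_ * _).
have := @alternating_extend I _ (fun h => kap (iota h)) k
  (fun q => contraction X i (fun h => j (q h))) _ q 1%g _.
rewrite mulg1 => h; transitivity (contraction X i (fun h => j (q h))).
  by apply: contraction_ext => // g; rewrite perm1.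
rewrite h //; last first.
- by move=> g; apply/eqP.
- move=> g g' s gg e; rewrite -(contraction_alt_right X i (fun h => j (s h)) gg e).
  by apply: contraction_ext => // z; rewrite permM.
by congr (_ * _); apply: contraction_ext => // g; rewrite perm1.
Qed.

Definition base_left h := (iota h).2.
Definition base_right h := rho (iota h).

(** At [base_left] each hole carries its own row index, so in the expansion of [filled_det] only the
    column permutations s fixing the holes survive. Together with [fixed_slots] they force y to be
    the word of [rho] twisted by s, and the alternation of V absorbs the sign of s. The factor N
    counts these s. *)
Lemma contraction_base : exists N : k, N != 0 /\ forall X,
  contraction X base_left base_right =
  N * \sum_a V a * det_monomial X [ffun p => rho ((a^-1)%g p)].
Proof.
pose S (s : {perm R0}) := [forall x, ((s x).1 == x.1) && ((x \in codom iota) ==> (s x == x))].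
exists (#|S|)%:R; split.
  rewrite natf_neq0_char0 // -lt0n; apply/card_gt0P; exists 1%g.
  by apply/forallP => x; rewrite perm1 !eqxx implybT.
move=> X; rewrite mulr_natl -sumr_const.
have SP s : S s -> [/\ forall x, kap (s x) = kap x & forall x, x \notin codom iota -> s x \notin codom iota].
  move=> /forallP h.
  have h2 x : x \notin codom iota -> s x \notin codom iota.
    move=> nx; apply: contra nx => nsx; have /andP[_ /implyP/(_ nsx) /eqP/perm_inj e] := h (s x).
    by rewrite -e.
  split=> // x; have /andP[/eqP h1 /implyP h3] := h x.
  have [xi|xi] := boolP (x \in codom iota); first by rewrite (eqP (h3 xi)).
  by rewrite !kap_out ?h2 // h1.
have key a y : filled_det a base_left y * fixed_slots a base_right y =
    \sum_(s | S s) (-1) ^+ s * (y == [ffun p => rho (s ((a^-1)%g p))])%:R.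
  rewrite /filled_det det_blocks mulr_suml.
  rewrite (bigID (fun s : {perm R0} => [forall x, (x \in codom iota) ==> (s x == x)])) /=.
  rewrite [X in _ + X]big1 ?addr0; last first.
    move=> s /andP[/forallP h1 /forallPn[x]]; rewrite negb_imply => /andP[/codomP[h ex] sx].
    rewrite (bigD1 x) //= mxE /filled_row -surjective_pairing ex hole_iota /base_left.
    suff -> : ((iota h).2 == (s (iota h)).2) = false by rewrite mul0r mulr0 mul0r.
    apply: contraNF sx => /eqP e; rewrite ex; apply/eqP.
    by rewrite [s _]surjective_pairing -e (eqP (h1 _)) -surjective_pairing.
  apply: eq_big => [s|s /andP[/forallP h1 /forallP h2]].
    by apply/andP/forallP => [[/forallP h1 /forallP h2] x|h]; [rewrite h1 h2|split; apply/forallP => x; have /andP[] := h x].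
  have /SP[hkap hout] : S s by apply/forallP => x; rewrite h1 h2.
  rewrite -mulrA; congr (_ * _).
  have [e|ne] := eqVneq y [ffun p => rho (s ((a^-1)%g p))].
    rewrite [fixed_slots _ _ _]big1 ?mulr1 => [|h _]; last first.
      by rewrite e ffunE permK (eqP (implyP (h2 _) (codom_f _ _))) eqxx.
    rewrite big1 // => x _.
    rewrite mxE /filled_row -surjective_pairing; case: (holeP x) => [[h -> ->]|[nx ->]].
      by rewrite (eqP (implyP (h2 _) (codom_f _ _))) eqxx.
    by rewrite e ffunE permK rho_out ?hout // eqxx.
  have [x nx] : exists x, y (a x) != rho (s x).
    apply/existsP; apply: contraNT ne => /existsPn h; apply/eqP/ffunP => p.
    by rewrite ffunE -{1}(permKV a p); apply/eqP; have := h ((a^-1)%g p); rewrite negbK.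
  case: (holeP x) => [[h ex _]|[nix hx]].
    rewrite /fixed_slots [X in _ * X](bigD1 h) //= -ex.
    have sx : s x = x by apply/eqP/(implyP (h2 _)); rewrite ex codom_f.
    by rewrite /base_right -ex; rewrite sx in nx; rewrite (negbTE nx) mul0r mulr0.
  rewrite (bigD1 x) //= mxE /filled_row -surjective_pairing hx -(rho_out (hout _ nix)).
  by rewrite (negbTE nx) !mul0r.
transitivity (\sum_a V a * \sum_(y : {ffun R0 -> 'I_n.+1}) \sum_(s | S s)
    (-1) ^+ s * (y == [ffun p => rho (s ((a^-1)%g p))])%:R * det_monomial X y).
  apply: eq_bigr => a _; congr (_ * _); apply: eq_bigr => y _.
  by rewrite -mulrA key mulrC mulr_suml.
transitivity (\sum_(s | S s) \sum_a V a * ((-1) ^+ s * det_monomial X [ffun p => rho (s ((a^-1)%g p))])).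
  rewrite exchange_big /=; apply: eq_bigr => a _; rewrite -mulr_sumr; congr (_ * _).
  rewrite exchange_big /=; apply: eq_bigr => s _.
  rewrite (bigD1 [ffun p => rho (s ((a^-1)%g p))]) //= eqxx mulr1 big1 ?addr0 // => y /negbTE ->.
  by rewrite mulr0 mul0r.
apply: eq_bigr => s Ss; rewrite (reindex_inj (mulgI s)) /=; apply: eq_bigr => a _.
have [hkap _] := SP s Ss.
rewrite (alternating_extend (c := kap) V_alt) // mulrACA -mulrA mulrA -signr_addb addbb mul1r.
by congr (_ * det_monomial X _); apply/ffunP => p; rewrite !ffunE invMg permM permKV.
Qed.

(** X enters only through the first row of each determinant in [det_monomial], hence the exponent 1
    exactly at the slots (q, 0). A hole cuts the chain open by a rank one matrix. *)
Definition slot_node (a s : {perm R0}) (p : R0) : node I :=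
  let e := nat_of_bool (p.2 == ord0) in
  if hole (s p) is Some h then Rk 0 h h e else Pow I e.

Lemma contraction_network a X i j (y : {ffun R0 -> 'I_n.+1}) :
  det_monomial X y * filled_det a i y * fixed_slots a j y =
  \sum_(s : {perm R0} | [forall x, (s x).1 == x.1]) (-1) ^+ s *
     \prod_p node_mx X i j (slot_node a s p) (y ((s * a)%g p)) (y p).
Proof.
pose Y (p : R0) : 'M[k]_n.+1 := if p.2 == ord0 then X else 1%:M.
have YE p : Y p = X ^+ (p.2 == ord0) by rewrite /Y; case: eqP => _; rewrite ?expr1 ?expr0.
rewrite det_monomialE /filled_det -big_split /=.
under eq_bigr => q _ do rewrite -[X in _ * X]det_tr -det_mulmx.
rewrite (det_blocks (fun q => _ *m _)) mulr_suml; apply: eq_bigr => s /forallP s1.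
rewrite -mulrA; congr (_ * _).
have -> : fixed_slots a j y = \prod_p (if hole (s p) is Some h then (y (a (s p)) == j h)%:R else 1).
  pose F p : k := if hole p is Some h then (y (a p) == j h)%:R else 1.
  rewrite -[RHS]/(\prod_p F (s p)); transitivity (\prod_p F p); last first.
    by rewrite [LHS](reindex_inj (@perm_inj _ s)).
  rewrite (bigID (mem [set iota h | h in [set: I]])) /= [X in _ = _ * X]big1 ?mulr1; last first.
    move=> p np; rewrite /F; case: (holeP p) => [[h e _]|[_ ->]] //.
    by case/negP: np; rewrite e imset_f.
  rewrite big_imset /=; last by move=> h h' _ _; exact: iota_inj.
  by rewrite big_in_setT; apply: eq_bigr => h _; rewrite /F hole_iota.
rewrite -big_split /=; apply: eq_bigr => p _.
have esp : (p.1, (s p).2) = s p by rewrite -(eqP (s1 p)) -surjective_pairing.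
have AE u : (if p.2 == ord0 then X u (y (p.1, ord0)) else (y (p.1, p.2) == u)%:R) = Y p u (y p).
  rewrite /Y -surjective_pairing; case: eqP => [e|_]; last by rewrite mxE eq_sym.
  by rewrite -e -surjective_pairing.
have ME v : \sum_u Y p u (y p) * (v == u)%:R = Y p v (y p).
  rewrite (bigD1 v) //= eqxx mulr1 big1 ?addr0 // => u /negbTE h.
  by rewrite eq_sym h mulr0.
rewrite mxE; under eq_bigr => u _ do rewrite !mxE AE esp.
rewrite /slot_node permM /filled_row; case: (holeP (s p)) => [[h _ ->]|[_ ->]]; last first.
  by rewrite ME mulr1 /= YE.
rewrite ME /= expr0 mul1mx YE mulrC.
rewrite mxE (bigD1 (i h)) //= big1 ?addr0; last first.
  by move=> u /negbTE hu; rewrite mxE hu andbF mul0r.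
by rewrite mxE eqxx andbT.
Qed.

Lemma contraction_expandable : expandable contraction.
Proof.
have term_exp a s : expandable (fun X i j => \sum_(y : {ffun R0 -> 'I_n.+1})
    \prod_p node_mx X i j (slot_node a s p) (y ((s * a)%g p)) (y p)).
  have one (label_of : node I -> seq I) (hlab : forall e, label_of (Pow I e) = [::])
      (hlab2 : forall h e, label_of (Rk 0 h h e) = [:: h]) h :
      (\sum_(p in [set: R0]) count_mem h (label_of (slot_node a s p)) = 1)%N.
    rewrite big_in_setT (bigD1 ((s^-1)%g (iota h))) //= {1}/slot_node permKV hole_iota hlab2 /= eqxx.
    rewrite big1 // => p hp; rewrite /slot_node; case: (holeP (s p)) => [[g eg ->]|[_ ->]].
      rewrite hlab2 /= addn0; case: eqP => // e; case/eqP: hp.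
      by rewrite -e -eg permK.
    by rewrite hlab.
  have [|c [L [hc h1 h2 h3]]] := @trace_network k n.+1 I hk R0 setT (s * a)%g (slot_node a s) isT.
    by apply/subsetP => x; rewrite !inE.
  have [|h|l [al hL]] := @chains_bijection k n.+1 I L.
  - by move=> h; rewrite h1; apply: one.
  - by rewrite h2; apply: one.
  exists [:: (exist _ c hc, l, al)] => X i j; rewrite big_seq1 /= -hL -h3.
  by apply: eq_bigr => y _; rewrite big_in_setT.
have e2 : expandable (fun X i j => \sum_a V a * \sum_(s : {perm R0} | [forall x, (s x).1 == x.1])
    (-1) ^+ s * \sum_(y : {ffun R0 -> 'I_n.+1})
    \prod_p node_mx X i j (slot_node a s p) (y ((s * a)%g p)) (y p)).
  by do 2 (apply: expandable_sum => ? _).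
apply: expandable_eq e2 => X i j; apply: eq_bigr => a _; congr (_ * _).
under [RHS]eq_bigr => y _ do rewrite contraction_network.
by rewrite [RHS]exchange_big /=; apply: eq_bigr => s _; rewrite mulr_sumr.
Qed.

(** By [contraction_perm] the base value equals the signed average of [contraction] over both column
    groups; expanding each averaged term as a network gives the double alternating sum. *)
Theorem tensor_contraction : exists s : seq network_term, forall X,
  \sum_a V a * det_monomial X [ffun p => rho ((a^-1)%g p)] =
  \sum_(x <- s) sval x.1.1 X * \sum_(p | left_stab p) \sum_(q | right_stab q)
     (-1) ^+ p * (-1) ^+ q *
     \prod_h (X ^+ x.1.2 h) (base_left (p h)) (base_right (q (x.2 h))).
Proof.
have [N [N0 hN]] := contraction_base.
have [s hs] := contraction_expandable.
pose M : k := (#|left_stab| * #|right_stab|)%:R.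
have M0 : M != 0.
  rewrite natf_neq0_char0 // muln_eq0 negb_or -!lt0n; apply/andP; split; apply/card_gt0P; exists 1%g;
    by apply/forallP => h; rewrite perm1.
pose sc (y : network_term) : network_term :=
  (exist _ _ (GL_invariantM (GL_invariant_const n.+1 (M * N)^-1) (svalP y.1.1)), y.1.2, y.2).
exists (map sc s) => X; rewrite big_map /=.
have MN0 : M * N != 0 by rewrite mulf_neq0.
apply: (mulfI MN0); rewrite [RHS]mulr_sumr -mulrA -hN.
under [RHS]eq_bigr => x _ do rewrite /= mulrA mulrA divff // mul1r.
transitivity (\sum_(p | left_stab p) \sum_(q | right_stab q) (-1) ^+ p * (-1) ^+ q *
    contraction X (fun h => base_left (p h)) (fun h => base_right (q h))).
  transitivity (\sum_(p | left_stab p) \sum_(q | right_stab q) contraction X base_left base_right).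
    rewrite sumr_const -sumr_const exchange_big /= !sumr_const -mulrnA.
    by rewrite /M mulr_natl mulnC.
  apply: eq_bigr => p hp; apply: eq_bigr => q hq; rewrite contraction_perm // mulrA.
  by rewrite mulrACA -!signr_addb !addbb !mul1r.
transitivity (\sum_(p | left_stab p) \sum_(q | right_stab q) \sum_(x <- s)
   sval x.1.1 X * ((-1) ^+ p * (-1) ^+ q *
     \prod_h (X ^+ x.1.2 h) (base_left (p h)) (base_right (q (x.2 h))))).
  apply: eq_bigr => p _; apply: eq_bigr => q _; rewrite hs mulr_sumr; apply: eq_bigr => x _.
  by rewrite mulrCA.
transitivity (\sum_(x <- s) \sum_(p | left_stab p) \sum_(q | right_stab q)
   sval x.1.1 X * ((-1) ^+ p * (-1) ^+ q *
     \prod_h (X ^+ x.1.2 h) (base_left (p h)) (base_right (q (x.2 h))))).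
  rewrite [RHS]exchange_big /=; apply: eq_bigr => p _.
  by rewrite [RHS]exchange_big /=.
apply: eq_bigr => x _; rewrite mulr_sumr; apply: eq_bigr => p _.
by rewrite mulr_sumr.
Qed.

End Contraction.

(** * Polarization *)

Lemma poly_fun_eq0 (k : fieldType) (hk : [pchar k] =i pred0) (p : {poly k}) :
  (forall t, p.[t] = 0) -> p = 0.
Proof.
move=> h; apply/eqP; apply: contraT => pn0.
have := max_poly_roots (rs := [seq i%:R | i <- iota 0 (size p)]) pn0.
rewrite size_map size_iota ltnn; apply.
  by apply/allP => x _; apply/rootP.
rewrite map_inj_uniq ?iota_uniq // => x y.
wlog: x y / (x <= y)%N.
  by move=> H e; case/orP: (leq_total x y) => l; [|apply/esym]; apply: H.
move=> xy e; apply/eqP; rewrite eqn_leq xy /= -subn_eq0 -(natf_neq0_char0 hk).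
by rewrite natrB // e subrr.
Qed.

Lemma regular_monomials (k : fieldType) n (f : 'M[k]_n -> k) : regular f ->
  exists L : seq (k * seq ('I_n * 'I_n)), forall X, f X = \sum_(t <- L) t.1 * \prod_(x <- t.2) X x.1 x.2.
Proof.
move=> [p hp].
have ex (i : 'I_(n * n)) : {x : 'I_n * 'I_n | mxvec_index x.1 x.2 == i}.
  by apply/sigW; case/mxvec_indexP: i => u v; exists (u, v).
pose pr i := sval (ex i).
have prE (X : 'M[k]_n) i : mxvec X ord0 i = X (pr i).1 (pr i).2.
  by rewrite -{1}(eqP (svalP (ex i))) mxvecE.
exists [seq (p@_m, flatten [seq nseq (m i) (pr i) | i <- enum 'I_(n * n)]) | m <- msupp p] => X.
rewrite hp mevalE [RHS]big_map /=; apply: eq_bigr => m _; congr (_ * _).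
rewrite big_flatten big_map big_enum /=; apply: eq_bigr => i _.
by rewrite big_nseq prE; elim: (m i) => [|e IH]; rewrite ?expr0 //= exprS IH.
Qed.

Section Polarization.
Variables (k : fieldType) (n : nat).
Hypothesis hk : [pchar k] =i pred0.
Variable L : seq (k * seq ('I_n.+1 * 'I_n.+1)).

Definition homog_part (d : nat) (X : 'M[k]_n.+1) : k :=
  \sum_(t <- L | size t.2 == d) t.1 * \prod_(x <- t.2) X x.1 x.2.

Lemma homog_part_scale d c X : homog_part d (c *: X) = c ^+ d * homog_part d X.
Proof.
rewrite /homog_part mulr_sumr; apply: eq_bigr => t /eqP <-.
rewrite mulrCA; congr (_ * _).
by elim: t.2 => [|x s IH]; rewrite ?big_nil ?mulr1 // !big_cons IH mxE /= exprS mulrACA.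
Qed.

Lemma sum_homog_parts : exists D, forall X : 'M[k]_n.+1, \sum_(t <- L) t.1 * \prod_(x <- t.2) X x.1 x.2 =
  \sum_(d < D) homog_part d X.
Proof.
exists (\max_(t <- L) (size t.2).+1)%N => X.
rewrite /homog_part (exchange_big_dep xpredT) //= big_seq [RHS]big_seq; apply: eq_bigr => t tL.
have lt : (size t.2 < \max_(t <- L) (size t.2).+1)%N by apply: (leq_bigmax_seq (F := fun t => (size t.2).+1)).
rewrite (big_pred1 (Ordinal lt)) // => d.
Qed.

(** Replacing X by t X separates the degrees, because a polynomial in t vanishing at all points of a
    field of characteristic 0 is zero. *)
Lemma homog_part_invariant D (phi : 'M[k]_n.+1 -> 'M[k]_n.+1) c :
  (forall t X, phi (t *: X) = t *: phi X) ->
  (forall X, \sum_(d < D) homog_part d (phi X) = c * \sum_(d < D) homog_part d X) ->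
  forall d : 'I_D, forall X, homog_part d (phi X) = c * homog_part d X.
Proof.
move=> hphi h d X; pose p := \poly_(d < D) (homog_part d (phi X) - c * homog_part d X).
have p0 : p = 0.
  apply: (poly_fun_eq0 hk) => t; rewrite horner_poly.
  have := h (t *: X); rewrite hphi => /eqP; rewrite -subr_eq0 mulr_sumr -sumrB => /eqP e.
  by rewrite -[RHS]e; apply: eq_bigr => e' _; rewrite !homog_part_scale; ring.
have := congr1 (fun q : {poly k} => q`_d) p0; rewrite coef_poly ltn_ord coef0 => /eqP.
by rewrite subr_eq0 => /eqP.
Qed.

Definition polar d (Y : 'I_d -> 'M[k]_n.+1) : k :=
  \sum_(t <- L | size t.2 == d) t.1 * \sum_(s : 'S_d) \prod_(q < d)
     Y (s q) (nth (ord0, ord0) t.2 q).1 (nth (ord0, ord0) t.2 q).2.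

Lemma polar_ext d (Y Y' : 'I_d -> 'M[k]_n.+1) : (forall q, Y q = Y' q) -> polar Y = polar Y'.
Proof.
move=> e; apply: eq_bigr => t _; congr (_ * _); apply: eq_bigr => s _; apply: eq_bigr => q _.
by rewrite e.
Qed.

Lemma polar_diag d X : polar (fun _ : 'I_d => X) = d`!%:R * homog_part d X.
Proof.
rewrite /polar mulr_sumr; apply: eq_bigr => t /eqP sz.
rewrite mulrCA; congr (_ * _); rewrite sumr_const card_Sn mulr_natl; congr (_ *+ _).
by rewrite (big_nth (ord0, ord0)) sz big_mkord.
Qed.

Lemma sum_sign_supset d (B : {set 'I_d}) :
  \sum_(J : {set 'I_d} | B \subset J) (-1) ^+ #|~: J| = (B == setT)%:R :> k.
Proof.
have [->|nB] := eqVneq B setT.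
  rewrite (big_pred1 setT) ?setCT ?cards0 // => J.
  by rewrite subTset.
have [u uB] : exists u, u \notin B.
  by apply/existsP; apply: contraNT nB => /existsPn h; rewrite -subTset; apply/subsetP => x _; have := h x; rewrite negbK.
set Z := LHS; apply: (eq_oppr_eq0 hk).
pose tog (J : {set 'I_d}) := if u \in J then J :\ u else u |: J.
have togK : involutive tog.
  move=> J; rewrite /tog; case: (boolP (u \in J)) => uJ; first by rewrite setD11 setD1K.
  by rewrite setU11 setU1K.
rewrite {1}/Z (reindex_inj (inv_inj togK)) /= -sumrN; apply: eq_big => J.
  rewrite /tog; case: ifP => uJ.
    by rewrite subsetD1 uB andbT.
  by rewrite -[in RHS](setU1K (negbT uJ)) subsetD1 uB andbT.
move=> _; rewrite /tog; case: ifP => uJ.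
  have -> : ~: (J :\ u) = u |: ~: J by apply/setP => x; rewrite !inE; case: eqP.
  by rewrite cardsU1 inE uJ /= exprS mulN1r.
have -> : ~: J = u |: ~: (u |: J) by apply/setP => x; rewrite !inE; case: eqP => // ->; rewrite uJ.
by rewrite cardsU1 !inE eqxx /= exprS mulN1r opprK.
Qed.

(* Inclusion-exclusion over the sets of arguments that are actually used. *)
Lemma polarE d (Y : 'I_d -> 'M[k]_n.+1) :
  polar Y = \sum_(J : {set 'I_d}) (-1) ^+ #|~: J| * homog_part d (\sum_(q in J) Y q).
Proof.
rewrite /polar /homog_part; under [RHS]eq_bigr => J _ do rewrite mulr_sumr.
rewrite [RHS]exchange_big /=; apply: eq_bigr => t /eqP sz.
under [RHS]eq_bigr => J _ do rewrite mulrCA.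
rewrite -mulr_sumr; congr (_ * _).
pose x q := nth (ord0, ord0) t.2 q.
transitivity (\sum_(phi : {ffun 'I_d -> 'I_d}) \sum_(J : {set 'I_d} | [set phi q | q in 'I_d] \subset J)
   (-1) ^+ #|~: J| * \prod_q Y (phi q) (x q).1 (x q).2); last first.
  rewrite (exchange_big_dep xpredT) //=; apply: eq_bigr => J _.
  rewrite -mulr_sumr; congr (_ * _).
  transitivity (\prod_(q < d) \sum_(q' in J) Y q' (x q).1 (x q).2); last first.
    by rewrite [RHS](big_nth (ord0, ord0)) sz big_mkord; apply: eq_bigr => q _; rewrite summxE.
  rewrite bigA_distr_big /=; apply: eq_bigl => phi.
  apply/subsetP/ffun_onP => [h q|h z /imsetP[q _ ->]]; last exact: h.
  by apply: h; apply: imset_f.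
under [RHS]eq_bigr => phi _ do rewrite -mulr_suml sum_sign_supset.
rewrite [RHS](bigID (fun phi : {ffun 'I_d -> 'I_d} => injectiveb phi)) /= [X in _ + X]big1 ?addr0; last first.
  move=> phi ninj; case: eqP => // e; last by rewrite mul0r.
  have /imset_injP h : #|[set phi q | q in 'I_d]| == #|'I_d| by rewrite e cardsT.
  by case/negP: ninj; apply/injectiveP => z z2; exact: h.
rewrite [RHS](reindex (fun s : 'S_d => [ffun q => s q])) /=; last first.
  have one : forall phi : {ffun 'I_d -> 'I_d}, {s : 'S_d | injectiveb phi -> [ffun q => s q] = phi}.
    move=> phi; case: (boolP (injectiveb phi)) => [/injectiveP h|_]; last by exists 1%g.
    by exists (perm h) => _; apply/ffunP => q; rewrite ffunE permE.
  exists (fun phi => sval (one phi)) => [s h|phi h]; last exact: (svalP (one phi)).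
  have e := svalP (one [ffun q => s q]) h.
  by apply/permP => q; have := congr1 (fun g : {ffun 'I_d -> 'I_d} => g q) e; rewrite !ffunE.
apply: eq_big => [s|s _]; first by apply/esym/injectiveP => q q'; rewrite !ffunE => /perm_inj.
have -> : [set [ffun q => s q] q | q in 'I_d] = setT.
  by apply/setP => q; rewrite inE; apply/imsetP; exists ((s^-1)%g q) => //; rewrite ffunE permKV.
by rewrite eqxx mul1r; apply: eq_bigr => q _; rewrite ffunE.
Qed.

Lemma polar_invariant d (phi : 'M[k]_n.+1 -> 'M[k]_n.+1) c :
  phi 0 = 0 -> (forall X X', phi (X + X') = phi X + phi X') ->
  (forall X, homog_part d (phi X) = c * homog_part d X) ->
  forall Y : 'I_d -> 'M[k]_n.+1, polar (fun q => phi (Y q)) = c * polar Y.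
Proof.
move=> h0 hD hc Y; rewrite !polarE mulr_sumr; apply: eq_bigr => J _.
by rewrite -(big_morph phi hD h0) hc mulrCA.
Qed.

Definition polar_tensor d (i j : {ffun 'I_d -> 'I_n.+1}) : k :=
  polar (fun q => delta_mx (i q) (j q)).

Lemma polar_multilinear d (Y : 'I_d -> 'M[k]_n.+1) :
  polar Y = \sum_(i : {ffun 'I_d -> 'I_n.+1}) \sum_(j : {ffun 'I_d -> 'I_n.+1})
    polar_tensor i j * \prod_q Y q (i q) (j q).
Proof.
rewrite pair_big /=.
pose un (z : {ffun 'I_d -> 'I_n.+1} * {ffun 'I_d -> 'I_n.+1}) := [ffun q => (z.1 q, z.2 q)].
rewrite (reindex (fun z : {ffun 'I_d -> 'I_n.+1 * 'I_n.+1} => ([ffun q => (z q).1], [ffun q => (z q).2]))) /=; last first.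
  exists un => [z|[i j]] _; first by apply/ffunP => q; rewrite !ffunE -surjective_pairing.
  by congr pair; apply/ffunP => q; rewrite !ffunE.
rewrite /polar_tensor /polar.
under [RHS]eq_bigr => z _ do rewrite mulr_suml.
rewrite [RHS]exchange_big /=; apply: eq_bigr => t _.
under [RHS]eq_bigr => z _ do rewrite -mulrA mulr_suml.
rewrite -mulr_sumr; congr (_ * _); rewrite [RHS]exchange_big /=; apply: eq_bigr => s _.
pose x q := nth (ord0, ord0) t.2 q.
pose x' (q : 'I_d) := x ((s^-1)%g q).
transitivity (\prod_q Y q (x' q).1 (x' q).2).
  by rewrite [RHS](reindex_inj (@perm_inj _ s)) /=; apply: eq_bigr => q _; rewrite /x' permK.
transitivity (\prod_q \sum_(z : 'I_n.+1 * 'I_n.+1) (delta_mx z.1 z.2 : 'M[k]_n.+1) (x' q).1 (x' q).2 * Y q z.1 z.2).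
  apply: eq_bigr => q _; rewrite (bigD1 (x' q)) //= mxE !eqxx mul1r big1 ?addr0 // => z.
  rewrite mxE [z]surjective_pairing [x' q]surjective_pairing xpair_eqE /= ![_ == (x' q).1]eq_sym ![_ == (x' q).2]eq_sym.
  by move/negbTE => ->; rewrite mul0r.
rewrite bigA_distr_bigA /=; apply: eq_bigr => z _; rewrite big_split /=; congr (_ * _).
  rewrite (reindex_inj (@perm_inj _ s)) /=; apply: eq_bigr => q _; rewrite /x' permK !ffunE //.
by apply: eq_bigr => q _; rewrite !ffunE.
Qed.

End Polarization.

(** * Infinitesimal invariance and weight of the polarized tensor *)

Lemma coef1_prod (R : comNzRingType) (T : finType) (F : T -> {poly R}) :
  (\prod_q F q)`_1 = \sum_q (F q)`_1 * \prod_(q' | q' != q) (F q')`_0.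
Proof.
have gen (r : seq T) : uniq r -> (\prod_(q <- r) F q)`_1 =
    \sum_(q <- r) (F q)`_1 * \prod_(q' <- r | q' != q) (F q')`_0.
  elim: r => [|x r IH] /=; first by rewrite !big_nil coef1.
  move=> /andP[xr ur]; rewrite !big_cons eqxx /= coefM !big_ord_recl big_ord0 addr0 /= IH //.
  rewrite addrC; congr (_ + _).
    congr (_ * _); rewrite -[LHS]/((\prod_(q <- r) F q)`_0) -horner_coef0 horner_prod.
    rewrite [in RHS]big_seq_cond [in LHS]big_seq; apply: eq_big => [q|q _]; last by rewrite horner_coef0.
    by case qr: (q \in r) => //=; apply/esym; apply: contraNneq xr => <-.
  rewrite mulr_sumr; apply: eq_big_seq => q qr; rewrite big_cons.
  have -> : x != q by apply: contraNneq xr => ->.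
  by rewrite mulrCA.
by rewrite gen // index_enum_uniq.
Qed.

Section TensorInvariance.
Variables (k : fieldType) (n : nat).
Hypothesis hk : [pchar k] =i pred0.
Variables (L : seq (k * seq ('I_n.+1 * 'I_n.+1))) (d : nat).
Local Notation polar := (@polar k n L d).
Local Notation tensor := (@polar_tensor k n L d).
Local Notation idx := {ffun 'I_d -> 'I_n.+1}.

Lemma polar_scale (c : 'I_d -> k) Y : polar (fun q => c q *: Y q) = (\prod_q c q) * polar Y.
Proof.
rewrite !polar_multilinear mulr_sumr; apply: eq_bigr => i _; rewrite mulr_sumr; apply: eq_bigr => j _.
rewrite mulrCA; congr (_ * _); rewrite -big_split /=; apply: eq_bigr => q _; by rewrite mxE.
Qed.

Lemma polar_slot (q : 'I_d) (c1 c2 : k) B1 B2 Y :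
  polar (fun q' => if q' == q then c1 *: B1 - c2 *: B2 else Y q') =
  c1 * polar (fun q' => if q' == q then B1 else Y q') - c2 * polar (fun q' => if q' == q then B2 else Y q').
Proof.
rewrite !polar_multilinear !mulr_sumr -sumrB; apply: eq_bigr => i _.
rewrite !mulr_sumr -sumrB; apply: eq_bigr => j _.
rewrite !(bigD1 q (P := xpredT)) //= eqxx !mxE.
have E B : \prod_(q' | q' != q) (if q' == q then B else Y q') (i q') (j q') =
   \prod_(q' | q' != q) Y q' (i q') (j q').
  by apply: eq_bigr => q' /negbTE ->.
by rewrite !E; ring.
Qed.

(** The invariance under 1 + t E_uv is a polynomial identity in t; its linear coefficient is the
    claim. *)
Lemma polar_tensor_raising (u v : 'I_n.+1) : u != v ->
  (forall t Y, polar (fun q => (1%:M - t *: delta_mx u v) *m Y q *m (1%:M + t *: delta_mx u v)) = polar Y) ->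
  forall i j : idx, \sum_(q | j q == u) tensor i (upd j q v) = \sum_(q | i q == v) tensor (upd i q u) j.
Proof.
move=> uv hinv i j.
pose A0 q : 'M[k]_n.+1 := delta_mx (i q) (j q).
pose A1 q : 'M[k]_n.+1 := (j q == u)%:R *: delta_mx (i q) v - (i q == v)%:R *: delta_mx u (j q).
pose A2 q : 'M[k]_n.+1 := - ((i q == v) && (j q == u))%:R *: delta_mx u v.
have expand t q : (1%:M - t *: delta_mx u v) *m A0 q *m (1%:M + t *: delta_mx u v) =
    A0 q + t *: A1 q + t ^+ 2 *: A2 q.
  rewrite /A0 /A1 /A2 mulmxBl mul1mx mulmxDr mulmx1 mulmxBl -scalemxAl -!scalemxAr.
  rewrite !mul_delta_mx_cond -!scaler_nat -!scalemxAl !mul_delta_mx_cond -!scaler_nat [v == _]eq_sym.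
  apply/matrixP => x y; rewrite !mxE.
  (* The entries of the four matrix units are generalised to variables, after which [ring] settles
     the cases of the two remaining indicators. *)
  do 4 (match goal with |- context[GRing.natmul 1 (nat_of_bool (eq_op x ?b && ?c))] =>
    move: (GRing.natmul 1 (nat_of_bool (eq_op x b && c))) => ? end).
  by case: (i q == v); case: (j q == u); rewrite /=; ring.
pose Fp (z : idx * idx) q : {poly k} :=
  (A0 q (z.1 q) (z.2 q))%:P + A1 q (z.1 q) (z.2 q) *: 'X + A2 q (z.1 q) (z.2 q) *: 'X^2.
pose P : {poly k} := \sum_(z : idx * idx) tensor z.1 z.2 *: \prod_q Fp z q - (tensor i j)%:P.
have P0 : P = 0.
  apply: (poly_fun_eq0 hk) => t; rewrite hornerD hornerN hornerC horner_sum.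
  apply/eqP; rewrite subr_eq0; apply/eqP; rewrite -[RHS](hinv t) polar_multilinear pair_big /=.
  apply: eq_bigr => z _; rewrite hornerZ horner_prod; congr (_ * _); apply: eq_bigr => q _.
  rewrite expand /Fp !hornerD !hornerZ hornerC hornerX hornerXn !mxE.
  by rewrite ![t * _]mulrC ![t ^+ 2 * _]mulrC.
have := congr1 (fun q : {poly k} => q`_1) P0; rewrite coef0 coefB coefC subr0 coef_sum.
have Fp0 z q : (Fp z q)`_0 = A0 q (z.1 q) (z.2 q).
  by rewrite !coefD !coefZ coefC coefX coefXn /= !mulr0 !addr0.
have Fp1 z q : (Fp z q)`_1 = A1 q (z.1 q) (z.2 q).
  by rewrite !coefD !coefZ coefC coefX coefXn /= mulr0 mulr1 addr0 add0r.
under eq_bigr => z _ do rewrite coefZ coef1_prod mulr_sumr.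
rewrite exchange_big /= => h.
have : \sum_q polar (fun q' => if q' == q then A1 q else A0 q') = 0.
  rewrite -[RHS]h; apply: eq_bigr => q _; rewrite polar_multilinear pair_big /=.
  apply: eq_bigr => z _; congr (_ * _); rewrite (bigD1 q) //= eqxx Fp1; congr (_ * _).
  by apply: eq_bigr => q' /negbTE h'; rewrite h' Fp0.
have es q : polar (fun q' => if q' == q then A1 q else A0 q') = _ := polar_slot q _ _ _ _ A0.
rewrite (eq_bigr _ (fun q _ => es q)).
rewrite sumrB => /eqP; rewrite subr_eq0 => /eqP e.
rewrite [LHS]big_mkcond [RHS]big_mkcond /=.
transitivity (\sum_q (j q == u)%:R * polar (fun q' => if q' == q then delta_mx (i q) v else A0 q')).
  apply: eq_bigr => q _; case: eqP => _; rewrite ?mul0r // mul1r; apply: polar_ext => q'.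
  by rewrite updE; case: eqP => // ->.
rewrite e; apply: eq_bigr => q _; case: eqP => _; rewrite ?mul0r // mul1r; apply: polar_ext => q'.
by rewrite updE; case: eqP => // ->.
Qed.

Lemma natz_pow2_inj (a b : nat) (c : int) : (2%:R : k) ^+ a = 2%:R ^ c * 2%:R ^+ b -> a%:Z = c + b%:Z.
Proof.
have n2 : (2%:R : k) != 0 by rewrite natf_neq0_char0.
have inj x y : (2%:R : k) ^+ x = 2%:R ^+ y -> x = y.
  wlog xy : x y / (x <= y)%N.
    by move=> H e; case/orP: (leq_total x y) => l; [exact: H|apply/esym/H].
  rewrite -!natrX => e; apply/eqP; rewrite -(@eqn_exp2l 2) //.
  rewrite eqn_leq leq_exp2l // xy /= -subn_eq0 -(natf_neq0_char0 hk).
  by rewrite natrB ?leq_exp2l // e subrr.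
case: c => c e; first by move: e; rewrite -exprnP -exprD => /inj; lia.
have : (2%:R : k) ^+ (a + c.+1) = 2%:R ^+ b.
  by rewrite exprD e NegzE -exprnN mulrAC mulVf ?mul1r // expf_neq0.
by move/inj; rewrite NegzE; lia.
Qed.

(** One torus element with a single entry 2 suffices to read off the weight at u, since distinct
    powers of 2 differ in characteristic 0. *)
Lemma polar_tensor_weight (u : 'I_n.+1) (c : int) :
  (forall S : 'M[k]_n.+1, S \in unitmx -> is_diag_mx S -> (forall w, S w w = 2%:R ^+ (w == u)) ->
     forall Y, polar (fun q => invmx S *m Y q *m S) = 2%:R ^ c * polar Y) ->
  forall i j : idx, tensor i j != 0 ->
  (#|[pred q | j q == u]|)%:Z = c + (#|[pred q | i q == u]|)%:Z.
Proof.
move=> hinv i j nz.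
have n2 : (2%:R : k) != 0 by rewrite natf_neq0_char0.
pose s (w : 'I_n.+1) : k := 2%:R ^+ (w == u).
have s0 w : s w != 0 by rewrite expf_neq0.
pose S : 'M[k]_n.+1 := diag_mx (\row_w s w).
have SE w : S w w = s w by rewrite !mxE eqxx.
have Su : S \in unitmx.
  by rewrite unitmxE det_diag unitfE; apply/prodf_neq0 => w _; rewrite mxE.
have phiE a b : invmx S *m delta_mx a b *m S = ((s a)^-1 * s b) *: delta_mx a b.
  have e1 : delta_mx a b *m S = s b *: delta_mx a b.
    apply/matrixP => x y; rewrite mul_mx_diag !mxE.
    by case: (y =P b) => [->|_]; rewrite ?andbF ?mul0r ?mulr0 // mulrC.
  have e2 : S *m delta_mx a b = s a *: delta_mx a b.
    apply/matrixP => x y; rewrite mul_diag_mx !mxE.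
    by case: (x =P a) => [->|_] //=; rewrite !mulr0.
  have e3 : invmx S *m delta_mx a b = (s a)^-1 *: delta_mx a b.
    apply: (can_inj (mulKmx Su)); rewrite mulKVmx // -scalemxAr e2 scalerA mulVf ?scale1r //.
  by rewrite e3 -scalemxAl e1 scalerA.
have := hinv S Su (diag_mx_is_diag _) SE (fun q => delta_mx (i q) (j q)).
rewrite (@polar_ext _ _ _ _ _ (fun q => ((s (i q))^-1 * s (j q)) *: delta_mx (i q) (j q))); last first.
  by move=> q; rewrite phiE.
rewrite polar_scale -/(tensor i j) => /(mulIf nz).
rewrite big_split /= prodfV => e; apply: natz_pow2_inj.
have prodE (z : idx) : \prod_q s (z q) = 2%:R ^+ #|[pred q | z q == u]|.
  rewrite /s -prodr_const [RHS]big_mkcond /=; apply: eq_bigr => q _.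
  by rewrite inE; case: eqP.
rewrite -!prodE -e mulrAC mulVf ?mul1r //; apply/prodf_neq0 => q _; exact: s0.
Qed.

End TensorInvariance.

(** * Spanning by alternating monomials *)

(* A diagram is given by the row and column functions on an abstract set of    *)
(* boxes; later mu and lambda share one set of boxes, via a fixed bijection.   *)
Record is_shape (S : finType) (rw cl : S -> nat) : Prop := IsShape {
  shape_row : forall x, (0 < rw x)%N;
  shape_col : forall x, (0 < cl x)%N;
  shape_inj : forall x y, rw x = rw y -> cl x = cl y -> x = y;
  shape_closed : forall x i j, (0 < i <= rw x)%N -> (0 < j <= cl x)%N -> exists z, rw z = i /\ cl z = j }.

Definition stab (I : finType) (c : I -> nat) (p : {perm I}) := [forall h, c (p h) == c h].

Lemma perm_of_counts (T : finType) (A : eqType) (f g : T -> A) :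
  (forall u, #|[pred x | f x == u]| = #|[pred x | g x == u]|) ->
  exists a : {perm T}, forall x, f (a x) = g x.
Proof.
move=> h; pose B u := enum [pred p | f p == u]; pose C u := enum [pred p | g p == u].
pose a x := nth x (B (g x)) (index x (C (g x))).
have xC x : x \in C (g x) by rewrite mem_enum inE.
have lt x : (index x (C (g x)) < size (B (g x)))%N by rewrite -cardE h cardE index_mem.
have fa x : f (a x) = g x.
  by have := mem_nth x (lt x); rewrite mem_enum inE => /eqP.
have inj : injective a.
  move=> x x' e; have eg : g x = g x' by rewrite -!fa e.
  have lt' : (index x' (C (g x)) < size (B (g x)))%N by have := lt x'; rewrite -eg.
  move: e; rewrite /a -eg (set_nth_default x' x (lt x)) => /eqP.
  rewrite nth_uniq ?enum_uniq // => /eqP e.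
  by rewrite -(nth_index x (xC x)) e eg nth_index.
by exists (perm inj) => x; rewrite permE.
Qed.

(** In a nonzero term every Levi-Civita factor uses each index exactly once, so [i q] is the one
    index missing among the y (q, c) with c > 0. *)
Lemma dual_tensor_content (k : fieldType) (d n : nat) (a : {ffun 'I_d -> 'I_n.+1} -> {ffun 'I_d -> 'I_n.+1} -> k) y :
  dual_tensor a y != 0 -> exists2 i, a i (slot0 y) != 0 &
    forall u, (#|[pred p | y p == u]| + #|[pred q | i q == u]| = d + #|[pred q | slot0 y q == u]|)%N.
Proof.
move=> nz; have [i hi] : exists i, a i (slot0 y) * \prod_q eps k (upd (slice y q) ord0 (i q)) != 0.
  apply/existsP; apply: contraNT nz => /existsPn h.
  by rewrite /dual_tensor big1 // => i _; apply/eqP; have := h i; rewrite negbK.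
move: hi; rewrite mulf_eq0 negb_or => /andP[ha /prodf_neq0 he].
exists i => // u.
have one q : (\sum_c (y (q, c) == u) + (i q == u) = 1 + (slot0 y q == u))%N.
  have inj := eps_inj (he q isT).
  have [c ec] : exists c, upd (slice y q) ord0 (i q) c = u.
    by exists ((perm inj)^-1%g u); rewrite -[upd _ _ _ _](permE inj) permKV.
  have : (\sum_c (upd (slice y q) ord0 (i q) c == u) = 1)%N.
    rewrite (bigD1 c) //= ec eqxx big1 // => c' nc; case: eqP => // e.
    by case/eqP: nc; apply: inj; rewrite e ec.
  have -> : (\sum_c (upd (slice y q) ord0 (i q) c == u) =
      (i q == u) + \sum_(c | c != ord0) (y (q, c) == u))%N.
    rewrite (bigD1 ord0) //= updE eqxx; congr addn.
    by apply: eq_bigr => c' /negbTE nc; rewrite updE nc ffunE.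
  rewrite [in X in _ -> X](bigD1 ord0) //= ffunE; set S := (\sum_(c | _) _)%N.
  move: S (i q == u) (y (q, ord0) == u) => S b b'; case: b; case: b'; lia.
have card_sum (T : finType) (P : pred T) : #|[pred x | P x]| = (\sum_x P x)%N.
  by rewrite -sum1_card big_mkcond; apply: eq_bigr => x _; rewrite inE; case: (P x).
rewrite !card_sum; have -> : (\sum_x (y x == u) = \sum_q \sum_c (y (q, c) == u))%N.
  by rewrite pair_big /=; apply: eq_bigr => -[q c].
rewrite -big_split /=; under eq_bigr => q _ do rewrite one.
by rewrite big_split /= sum1_card card_ord.
Qed.

(** * Highest weight functions are combinations of alternating monomials *)

Section HighestWeight.
Variables (k : fieldType) (n : nat) (I : finType) (r1 c1 r2 c2 : I -> nat) (r s : nat).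
Hypothesis hk : [pchar k] =i pred0.
Hypothesis sh1 : is_shape r1 c1.
Hypothesis sh2 : is_shape r2 c2.
Hypothesis le1 : forall h, (r1 h <= r)%N.
Hypothesis le2 : forall h, (r2 h <= s)%N.
Hypothesis hrs : (r + s <= n.+1)%N.
Hypothesis r_gt0 : (0 < r)%N.

Definition weight_at (u : 'I_n.+1) : int :=
  #|[pred h | r2 h == u.+1]|%:Z - #|[pred h | r1 h == (n.+1 - u)%N]|%:Z.

(* The lower left corner of X^l: for matrices of size N = n.+1, row i of mu     *)
(* stands for matrix row N + 1 - i and row j of lambda for matrix column j,    *)
(* with values shifted by 1 since ordinals start at 0.                         *)
Definition low_index h : 'I_n.+1 := inord (n.+1 - r1 h).
Definition high_index h : 'I_n.+1 := inord (r2 h).-1.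

Lemma low_indexE h : val (low_index h) = (n.+1 - r1 h)%N.
Proof. by rewrite /= inordK //; have := shape_row sh1 h; lia. Qed.

Lemma high_indexE h : val (high_index h) = (r2 h).-1.
Proof. by rewrite /= inordK //; have := le2 h; lia. Qed.

Definition alternating_monomial (l : I -> nat) (al : {perm I}) (X : 'M[k]_n.+1) : k :=
  \sum_(p | stab c1 p) \sum_(q | stab c2 q) (-1) ^+ p * (-1) ^+ q *
    \prod_h (X ^+ l h) (low_index (p h)) (high_index (q (al h))).

Definition is_alternating_monomial (g : 'M[k]_n.+1 -> k) : Prop :=
  exists l al, g = alternating_monomial l al.
Local Notation spanned := (invariant_span is_alternating_monomial).

Definition is_reduced_monomial (g : 'M[k]_n.+1 -> k) : Prop :=
  exists (l : {ffun I -> 'I_n}) al, g = alternating_monomial (fun h => (l h).+1) al.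

Section Degree.
Variables (d : nat) (a : {ffun 'I_d -> 'I_n.+1} -> {ffun 'I_d -> 'I_n.+1} -> k).
Hypothesis a_raising : forall u v : 'I_n.+1, (u < v)%N -> forall i j : {ffun 'I_d -> 'I_n.+1},
  \sum_(q | j q == u) a i (upd j q v) = \sum_(q | i q == v) a (upd i q u) j.
Hypothesis a_weight : forall (u : 'I_n.+1) (i j : {ffun 'I_d -> 'I_n.+1}), a i j != 0 ->
  #|[pred q | j q == u]|%:Z = weight_at u + #|[pred q | i q == u]|%:Z.
Hypothesis c1_le : forall h, (c1 h <= d)%N.

Local Notation R0 := ('I_d * 'I_n.+1)%type.

Lemma slot_col_subproof h : (d - c1 h < d)%N.
Proof. by have := c1_le h; have := shape_col sh1 h; lia. Qed.

(* Slot (q, c) of the rectangle R0 has column q and row c; slot_row, slot_col  *)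
(* are coordinates in the diagram of d (1,...,1) + chi.                        *)
Definition slot_of h : R0 := (Ordinal (slot_col_subproof h), low_index h).
Definition slot_row (x : R0) : 'I_n.+1 := if hole slot_of x is Some h then high_index h else x.2.
Definition slot_col (x : R0) : nat := if hole slot_of x is Some h then (d + (c2 h).-1)%N else x.1.

Lemma slot_of_inj : injective slot_of.
Proof.
move=> h h' [] e1 /(congr1 val); rewrite !low_indexE => e2.
apply: (shape_inj sh1).
  by have := le1 h; have := le1 h'; lia.
by have := c1_le h; have := c1_le h'; lia.
Qed.

Lemma slot_box_inj x y : val (slot_row x) = val (slot_row y) -> slot_col x = slot_col y -> x = y.
Proof.
rewrite /slot_row /slot_col.
case: (holeP slot_of_inj x) => [[h -> ->]|[_ ->]]; case: (holeP slot_of_inj y) => [[h' -> ->]|[_ ->]].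
- rewrite !high_indexE => e1 e2; congr slot_of; apply: (shape_inj sh2).
    by have := shape_row sh2 h; have := shape_row sh2 h'; lia.
  by have := shape_col sh2 h; have := shape_col sh2 h'; lia.
- by move=> _ e; have := ltn_ord y.1; rewrite -e; lia.
- by move=> _ e; have := ltn_ord x.1; rewrite e; lia.
- by case: x y => [x1 x2] [y1 y2] /= /val_inj -> /val_inj ->.
Qed.

(** The cut rectangle with [la] appended is an honest Young diagram: the rotated [mu] stays in the
    last r rows, [la] in the first s, and r + s does not exceed the number of rows. *)
Lemma slot_box_closed x i j : (i <= slot_row x)%N -> (j <= slot_col x)%N ->
  exists z, val (slot_row z) = i /\ slot_col z = j.
Proof.
move=> hi hj; have [jd|jd] := ltnP j d; last first.
  move: hi hj; rewrite /slot_row /slot_col; case: (holeP slot_of_inj x) => [[h _ ->]|[_ ->]]; last first.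
    by have := ltn_ord x.1; lia.
  rewrite [(_ <= high_index h)%N](_ : _ = (i <= (r2 h).-1)%N) ?high_indexE // => hi hj.
  have [||g [g1 g2]] := shape_closed sh2 (x := h) (i := i.+1) (j := (j - d).+1).
  - by have := shape_row sh2 h; lia.
  - by have := shape_col sh2 h; lia.
  exists (slot_of g); rewrite !hole_iota ?high_indexE ?g1 ?g2; try exact: slot_of_inj.
  by split; [|lia].
have iN : (i < n.+1)%N by apply: leq_ltn_trans hi (ltn_ord _).
pose z : R0 := (Ordinal jd, Ordinal iN).
exists z; suff nz : z \notin codom slot_of.
  by rewrite /slot_row /slot_col; case: (holeP slot_of_inj z) => [[h e _]|[_ ->]] //; case/negP: nz; rewrite e codom_f.
apply/negP => /codomP[h [] ej /(congr1 val)]; rewrite low_indexE /= => ei.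
move: hi hj; rewrite /slot_row /slot_col; case: (holeP slot_of_inj x) => [[g _ ->]|[nx ->]].
  rewrite [(_ <= high_index g)%N](_ : _ = (i <= (r2 g).-1)%N) ?high_indexE // => hi _.
  by have := le2 g; have := shape_row sh2 g; have := le1 h; lia.
move=> hi hj; case/negP: nx.
have x1 := ltn_ord x.1; have x2 := ltn_ord x.2.
have [||g [g1 g2]] := shape_closed sh1 (x := h) (i := (n.+1 - x.2)%N) (j := (d - x.1)%N).
- by have := le1 h; lia.
- by have := c1_le h; lia.
suff -> : x = slot_of g by exact: codom_f.
rewrite [x]surjective_pairing; congr pair; apply: val_inj; rewrite ?low_indexE /= ?g1 ?g2; lia.
Qed.

Lemma slot_content (u : 'I_n.+1) : (#|[pred x | slot_row x == u]| + #|[pred h | r1 h == (n.+1 - u)%N]| =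
  d + #|[pred h | r2 h == u.+1]|)%N.
Proof.
have card_sum (T : finType) (P : pred T) : #|[pred x | P x]| = (\sum_x P x)%N.
  by rewrite -sum1_card big_mkcond; apply: eq_bigr => x _; rewrite inE; case: (P x).
have split_sum (F : R0 -> nat) :
    (\sum_x F x = \sum_(x | x \notin [set slot_of h | h in [set: I]]) F x + \sum_h F (slot_of h))%N.
  rewrite (bigID (mem [set slot_of h | h in [set: I]])) /= addnC; congr addn.
  rewrite big_imset /=; last by move=> h h' _ _; exact: slot_of_inj.
  by rewrite big_in_setT.
rewrite !card_sum (split_sum (fun x => nat_of_bool (slot_row x == u))).
have : (\sum_(x : R0) (x.2 == u) = d)%N.
  transitivity (\sum_(q < d) \sum_(c < n.+1) (c == u))%N; first by rewrite pair_big /=.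
  rewrite -[RHS]card_ord -sum1_card; apply: eq_bigr => q _.
  by rewrite (bigD1 u) //= eqxx big1 // => c /negbTE ->.
rewrite (split_sum (fun x => nat_of_bool (x.2 == u))) => e0; rewrite -[X in _ = (X + _)%N]e0.
rewrite -!addnA; congr addn.
  apply: eq_bigr => x nx; rewrite /slot_row; case: (holeP slot_of_inj x) => [[h e _]|[_ ->]] //.
  by case/negP: nx; rewrite e imset_f.
rewrite addnC; congr addn; apply: eq_bigr => h _; congr nat_of_bool.
  rewrite /= -val_eqE /= low_indexE; have := le1 h; have := ltn_ord u; have := shape_row sh1 h.
  by move=> *; apply/eqP/eqP; lia.
rewrite /slot_row (hole_iota slot_of_inj) -val_eqE /= high_indexE.
by have := shape_row sh2 h; move=> *; apply/eqP/eqP; lia.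
Qed.

Lemma pairing_spanned : spanned (fun X => \sum_i \sum_j a i j * \prod_q X (i q) (j q)).
Proof.
pose W (b : {perm R0}) := dual_tensor a [ffun p => slot_row ((b^-1)%g p)].
have hW1 : row_inv (fun x => val (slot_row x)) slot_col 0 W.
  move=> x y b e _ _; congr dual_tensor; apply/ffunP => p; rewrite !ffunE invMg tpermV permM.
  by case: tpermP => [->|->|//]; apply: val_inj.
have hW2 : raising (fun x => val (slot_row x)) slot_col 0 W.
  move=> x i b _ ix; have iN : (i < n.+1)%N by apply: ltn_trans ix (ltn_ord _).
  (* The word of b with the letter of x lowered to i. Raising it back at the slot of x gives [W b];
     raising it at the slot of a box z of row i exchanges the letters of x and z. *)
  pose y : {ffun R0 -> 'I_n.+1} := upd [ffun p => slot_row ((b^-1)%g p)] (b x) (Ordinal iN).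
  have ne : Ordinal iN != slot_row x by rewrite -val_eqE /= ltn_eqF.
  have ha : forall i' j' : {ffun 'I_d -> 'I_n.+1}, \sum_(q | j' q == Ordinal iN) a i' (upd j' q (slot_row x)) =
      \sum_(q | i' q == slot_row x) a (upd i' q (Ordinal iN)) j' by move=> i' j'; apply: a_raising.
  transitivity (\sum_(p | y p == Ordinal iN) dual_tensor a (upd y p (slot_row x))); last first.
    exact: dual_tensor_raising ne ha y.
  rewrite [RHS](bigD1 (b x)) /=; last by rewrite updE eqxx.
  apply: (f_equal2 +%R).
    congr dual_tensor; apply/ffunP => p; rewrite updE; case: eqP => [->|np]; rewrite !ffunE ?permK //.
    by case: eqP.
  rewrite [RHS](reindex_inj (@perm_inj _ b)) /=; apply: eq_big => z.
    rewrite updE (inj_eq perm_inj) !ffunE permK andbT; have [->|nz] := eqVneq z x.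
      by rewrite andbF gtn_eqF.
    by rewrite andbT -val_eqE.
  move=> /andP[/eqP rz _]; congr dual_tensor; apply/ffunP => p; rewrite !ffunE invMg tpermV permM.
  have [<-|n1] := eqVneq (b z) p.
    by rewrite permK tpermR.
  have [->|n2] := eqVneq p (b x).
    by rewrite permK tpermL; apply: val_inj.
  rewrite tpermD //; apply/eqP => e2.
    by case/eqP: n2; rewrite e2 permKV.
  by case/eqP: n1; rewrite e2 permKV.
have [V [Valt hV]] := highest_weight_alternating hk slot_box_inj slot_box_closed hW1 hW2.
(* A word that rearranges the rows of the diagram is covered by V; any other word has the wrong
   content, and there the tensor vanishes by its weight. *)
have wE y : dual_tensor a y = \sum_b V b * (y == [ffun p => slot_row ((b^-1)%g p)])%:R.
  have [/existsP[b /eqP yb]|/existsPn nob] := boolP [exists b : {perm R0}, y == [ffun p => slot_row ((b^-1)%g p)]].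
    rewrite {1}yb -/(W b) hV big_mkcond /= [RHS](reindex_inj (mulIg b)) /=.
    apply: eq_bigr => t _.
    have -> : (y == [ffun p => slot_row (((t * b)^-1)%g p)]) =
        [forall x, val (slot_row (t x)) == slot_row x].
      rewrite yb; apply/eqP/forallP => [/ffunP h x|h].
        by have := h (b (t x)); rewrite !ffunE invMg permM !permK => ->.
      apply/ffunP => p; rewrite !ffunE invMg permM.
      by have /eqP/val_inj <- := h ((t^-1)%g ((b^-1)%g p)); rewrite permKV.
    by case: ifP; rewrite ?mulr1 ?mulr0.
  rewrite big1 => [|b _]; last by rewrite (negbTE (nob b)) mulr0.
  apply/eqP; apply: contraT => /dual_tensor_content[i /a_weight ai cnt].
  have [u|b hb] := @perm_of_counts _ _ y slot_row.
    move: (cnt u) (ai u) (slot_content u); rewrite /weight_at.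
    do ?[match goal with |- context[card ?A] => move: (card A) => ? end]; lia.
  by case/eqP: (nob b); apply/ffunP => p; rewrite ffunE -{1}(permKV b p) hb.
have rho_out x : x \notin codom slot_of -> slot_row x = x.2.
  move=> nx; rewrite /slot_row; case: (holeP slot_of_inj x) => [[h e _]|[_ ->]] //.
  by case/negP: nx; rewrite e codom_f.
have kap_out x : x \notin codom slot_of -> slot_col x = x.1.
  move=> nx; rewrite /slot_col; case: (holeP slot_of_inj x) => [[h e _]|[_ ->]] //.
  by case/negP: nx; rewrite e codom_f.
have [t ht] := tensor_contraction hk slot_of_inj rho_out kap_out Valt.
pose C := eps_norm k n ^+ d.
have C0 : C != 0 by rewrite expf_neq0 // eps_norm_neq0.
apply: (@span_eq _ _ _ (fun X => \sum_(x <- t) (C^-1 * sval x.1.1 X) * alternating_monomial x.1.2 x.2 X)); last first.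
  apply: span_sum => x; apply: span_gen; last by exists x.1.2, x.2.
  exact: GL_invariantM (GL_invariant_const _ _) (svalP x.1.1).
move=> X; apply/esym; apply: (mulfI C0); rewrite -dual_tensor_pairing [RHS]mulr_sumr.
under [RHS]eq_bigr => x _ do rewrite /= !mulrA divff // mul1r.
transitivity (\sum_b V b * det_monomial X [ffun p => slot_row ((b^-1)%g p)]).
  under eq_bigr => y _ do rewrite wE mulr_suml.
  rewrite exchange_big /=; apply: eq_bigr => b _.
  rewrite (bigD1 [ffun p => slot_row ((b^-1)%g p)]) //= eqxx mulr1 big1 ?addr0 // => y /negbTE ->.
  by rewrite mulr0 mul0r.
rewrite ht; apply: eq_bigr => x _; congr (_ * _); apply: eq_big => [p|p _].
  apply: eq_forallb => h; rewrite -val_eqE /=.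
  have := c1_le h; have := c1_le (p h); have := shape_col sh1 h; have := shape_col sh1 (p h).
  by move=> *; apply/eqP/eqP; lia.
apply: eq_big => [q|q _].
  apply: eq_forallb => h; rewrite /slot_col !(hole_iota slot_of_inj).
  by have := shape_col sh2 h; have := shape_col sh2 (q h); move=> *; apply/eqP/eqP; lia.
congr (_ * _); apply: eq_bigr => h _.
by rewrite /base_left /base_right /slot_row !(hole_iota slot_of_inj).
Qed.

End Degree.

Theorem highest_weight_spanned (f : 'M[k]_n.+1 -> k) : regular f ->
  (forall (u v : 'I_n.+1) t, (u < v)%N -> forall X,
     f ((1%:M - t *: delta_mx u v) *m X *m (1%:M + t *: delta_mx u v)) = f X) ->
  (forall (u : 'I_n.+1) S, S \in unitmx -> is_diag_mx S -> (forall w, S w w = 2%:R ^+ (w == u)) ->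
     forall X, f (invmx S *m X *m S) = 2%:R ^ weight_at u * f X) ->
  spanned f.
Proof.
move=> freg hU hT; have [L hL] := regular_monomials freg; have [D hD] := sum_homog_parts L.
have fE X : f X = \sum_(d < D) homog_part L d X by rewrite hL hD.
apply: (@span_eq _ _ _ (fun X => \sum_(d < D) homog_part L d X)); first by move=> X; rewrite fE.
apply: span_sum => d.
pose a := @polar_tensor k n L d.
have lin (A B : 'M[k]_n.+1) : [/\ A *m 0 *m B = 0, forall X X', A *m (X + X') *m B = A *m X *m B + A *m X' *m B
     & forall t X, A *m (t *: X) *m B = t *: (A *m X *m B)].
  by split=> [|X X'|t X]; rewrite ?mulmx0 ?mul0mx // ?mulmxDr ?mulmxDl // -scalemxAr -scalemxAl.
have inv (A B : 'M[k]_n.+1) c : (forall X, f (A *m X *m B) = c * f X) ->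
    forall Y : 'I_d -> 'M[k]_n.+1, polar L (fun q => A *m Y q *m B) = c * polar L Y.
  move=> h; have [l0 lD lZ] := lin A B; apply: (polar_invariant hk (phi := fun X => A *m X *m B)) => //.
  by apply: (homog_part_invariant hk) => // X; rewrite -!fE.
have a_raising (u v : 'I_n.+1) : (u < v)%N -> forall i j : {ffun 'I_d -> 'I_n.+1},
    \sum_(q | j q == u) a i (upd j q v) = \sum_(q | i q == v) a (upd i q u) j.
  move=> uv; apply: (polar_tensor_raising hk).
    by apply: contraTneq uv => ->; rewrite ltnn.
  by move=> t Y; rewrite -[RHS]mul1r; apply: inv => X; rewrite mul1r; apply: hU.
have a_weight (u : 'I_n.+1) (i j : {ffun 'I_d -> 'I_n.+1}) : a i j != 0 ->
    #|[pred q | j q == u]|%:Z = weight_at u + #|[pred q | i q == u]|%:Z.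
  apply: (polar_tensor_weight hk) => S Su Sd SE Y; apply: inv; exact: hT SE.
have partE X : homog_part L d X = (d`!%:R)^-1 * \sum_i \sum_j a i j * \prod_q X (i q) (j q).
  rewrite -(polar_multilinear _ (fun _ => X)) polar_diag mulrA mulVf ?mul1r //.
  by rewrite natf_neq0_char0 // -lt0n fact_gt0.
apply: (span_eq (fun X => esym (partE X))); apply: spanM; first exact: GL_invariant_const.
have [/existsP[i /existsP[j aij]]|/existsPn h] :=
    boolP [exists i : {ffun 'I_d -> 'I_n.+1}, [exists j, a i j != 0]]; last first.
  apply: span_eq (span0 _) => X; rewrite big1 // => i _; rewrite big1 // => j _.
  by have /existsPn/(_ j) := h i; rewrite negbK => /eqP ->; rewrite mul0r.
apply: pairing_spanned => // h.
(* At the last index the weight is minus the first part of [mu], and at most d covariant indices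
   take this value. So that part is at most d and the rotated [mu] fits into the rectangle. *)
have := a_weight ord_max i j aij; rewrite /weight_at /= subSnn.
have -> : #|[pred g | r2 g == n.+1]| = 0%N.
  by apply: eq_card0 => g; rewrite inE; apply: ltn_eqF; have := le2 g; lia.
have : (c1 h <= #|[pred g | r1 g == 1%N]|)%N.
  have ex (c : 'I_(c1 h)) : {g | (r1 g == 1%N) && (c1 g == c.+1)}.
    apply: sigW; have [||g [g1 g2]] := shape_closed sh1 (x := h) (i := 1) (j := c.+1).
    - by have := shape_row sh1 h.
    - exact: ltn_ord c.
    - by exists g; rewrite g1 g2 !eqxx.
  rewrite -{1}[c1 h]card_ord -(card_codom (f := fun c => sval (ex c))).
    apply: subset_leq_card; apply/subsetP => g /codomP[c ->]; rewrite inE.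
    by have /andP[] := svalP (ex c).
  move=> c c' e; have /andP[_ /eqP e1] := svalP (ex c); have /andP[_ /eqP e2] := svalP (ex c').
  by apply: val_inj; move: e1; rewrite e e2 => -[].
have := max_card [pred q | i q == ord_max]; rewrite card_ord.
by do ?[match goal with |- context[card ?A] => move: (card A) => ? end]; lia.
Qed.

(** The row indices are at least n + 1 - r and the column indices below s, so every entry is off the
    diagonal and [offdiag_power_reduction] applies on each strand. *)
Lemma alternating_monomial_reduced l al : invariant_span is_reduced_monomial (alternating_monomial l al).
Proof.
have [cc hcc] := fin_all_exists (fun h => offdiag_power_reduction k n.+1 (l h)).
apply: (@span_eq _ _ _ (fun X => \sum_(Q : {ffun I -> 'I_n}) (\prod_h cc h (Q h) X) *
    alternating_monomial (fun h => (Q h).+1) al X)); last first.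
  apply: span_sum => Q; apply: span_gen; last by exists Q, al.
  by apply: GL_invariant_prod => h; case: (hcc h).
move=> X; rewrite /alternating_monomial.
transitivity (\sum_(Q : {ffun I -> 'I_n}) \sum_(p | stab c1 p) \sum_(q | stab c2 q) (\prod_h cc h (Q h) X) *
    ((-1) ^+ p * (-1) ^+ q * \prod_h (X ^+ (Q h).+1) (low_index (p h)) (high_index (q (al h))))).
  by apply: eq_bigr => Q _; rewrite mulr_sumr; apply: eq_bigr => p _; rewrite mulr_sumr.
rewrite exchange_big /=; apply: eq_bigr => p _; rewrite exchange_big /=; apply: eq_bigr => q _.
transitivity ((-1) ^+ p * (-1) ^+ q * \sum_(Q : {ffun I -> 'I_n})
   \prod_h (cc h (Q h) X * (X ^+ (Q h).+1) (low_index (p h)) (high_index (q (al h))))).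
  by rewrite mulr_sumr; apply: eq_bigr => Q _; rewrite big_split /= mulrCA.
rewrite -(bigA_distr_bigA (fun h (m : 'I_n) => cc h m X *
  (X ^+ m.+1) (low_index (p h)) (high_index (q (al h))))) /=; congr (_ * _); apply: eq_bigr => h _.
have [_ ->] := hcc h; first by [].
rewrite -val_eqE low_indexE high_indexE; have := le1 (p h); have := le2 (q (al h)).
by have := shape_row sh2 (q (al h)); move=> *; apply/eqP; lia.
Qed.

End HighestWeight.

(** * Straightening *)

Section AltSum.
Variables (k : fieldType) (I : finType).

(** The permutations x and y place the strands into the two diagrams. E stays abstract, so that
    straightening coefficients serve all matrices X, and also the test functions [probe]. *)
Definition altsum (r1 c1 r2 c2 : I -> nat) (E : {ffun I -> nat} -> {ffun I -> nat} -> k) (x y : {perm I}) : k :=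
  \sum_(p | stab c1 p) \sum_(q | stab c2 q) (-1) ^+ p * (-1) ^+ q *
    E [ffun s => r1 (p (x s))] [ffun s => r2 (q (y s))].

Definition label_invariant (A : Type) (Q : I -> A) (E : {ffun I -> nat} -> {ffun I -> nat} -> k) :=
  forall (h : {perm I}) (i j : {ffun I -> nat}), (forall s, Q (h s) = Q s) ->
    E [ffun s => i (h s)] [ffun s => j (h s)] = E i j.

Lemma stabM (c : I -> nat) p q : stab c p -> stab c q -> stab c (p * q)%g.
Proof.
by move=> /forallP hp /forallP hq; apply/forallP => h; rewrite permM (eqP (hq _)).
Qed.

Lemma stabV (c : I -> nat) p : stab c p -> stab c p^-1%g.
Proof. by move=> /forallP hp; apply/forallP => h; rewrite -{2}(permKV p h) eq_sym. Qed.

Lemma stab_one (c : I -> nat) : stab c 1%g.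
Proof. by apply/forallP => h; rewrite perm1. Qed.

Lemma stab_tperm (c : I -> nat) a b : c a = c b -> stab c (tperm a b).
Proof. by move=> e; apply/forallP => h; case: tpermP => [->|->|//]; rewrite e. Qed.

Lemma stab_mulr (c : I -> nat) p q : stab c q -> stab c (q * p)%g = stab c p.
Proof.
move=> hq; apply/idP/idP => [h|]; last exact: stabM.
by rewrite -(mulKg q p); apply: stabM => //; exact: stabV.
Qed.

Variables (r1 c1 r2 c2 : I -> nat).

Lemma altsum_swap E x y : altsum r1 c1 r2 c2 E x y = altsum r2 c2 r1 c1 (fun i j => E j i) y x.
Proof.
rewrite /altsum exchange_big /=; apply: eq_bigr => q _; apply: eq_bigr => p _.
by rewrite [(-1) ^+ p * _]mulrC.
Qed.

Lemma altsum_stab1 E x y g : stab c1 g -> altsum r1 c1 r2 c2 E (x * g)%g y = (-1) ^+ g * altsum r1 c1 r2 c2 E x y.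
Proof.
move=> hg; rewrite /altsum [in RHS](reindex_inj (mulgI g)) mulr_sumr /=.
apply: eq_big => [p|p _]; first by rewrite stab_mulr.
rewrite mulr_sumr; apply: eq_bigr => q _; rewrite odd_permM signr_addb -!mulrA [RHS]mulrA -expr2 sqrr_sign mul1r.
by congr (_ * (_ * E _ _)); apply/ffunP => s; rewrite !ffunE !permM.
Qed.

Lemma altsum_relabel (A : Type) (Q : I -> A) E x y (h : {perm I}) : label_invariant Q E -> (forall s, Q (h s) = Q s) ->
  altsum r1 c1 r2 c2 E (h * x)%g (h * y)%g = altsum r1 c1 r2 c2 E x y.
Proof.
move=> hE hQ; apply: eq_bigr => p _; apply: eq_bigr => q _; congr (_ * _).
rewrite -(hE h [ffun s => r1 (p (x s))] [ffun s => r2 (q (y s))] hQ).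
by congr E; apply/ffunP => s; rewrite !ffunE permM.
Qed.

End AltSum.

(** * Garnir relations *)

Section Garnir.
Variables (k : fieldType) (I : finType) (r1 c1 r2 c2 : I -> nat).
Hypothesis hk : [pchar k] =i pred0.
Hypothesis sh1 : is_shape r1 c1.
Local Notation altsum := (@altsum k I r1 c1 r2 c2).
Variables (A : Type) (Q : I -> A) (kap : I -> int) (x y : {perm I}) (s0 s1 : I).
Hypothesis row_eq : r1 (x s1) = r1 (x s0).
Hypothesis col_succ : c1 (x s1) = (c1 (x s0)).+1.
Hypothesis kap_sorted : forall s s', c1 (x s) = c1 (x s') -> (r1 (x s) < r1 (x s'))%N -> kap s <= kap s'.
Hypothesis kap_violation : kap s1 <= kap s0.
Hypothesis kap_tie : forall s s', kap s = kap s' -> Q s = Q s' /\ c2 (y s) = c2 (y s').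

Let c := c1 (x s0).
Let i := r1 (x s0).
Let upper := [set z | (c1 z == c) && (i <= r1 z)%N].
Let lower := [set z | (c1 z == c.+1) && (r1 z <= i)%N].
Let D := upper :|: lower.

(** Strands of D in column c have key at least that of [s0] and can only move right; those in column
    c + 1 have key at most that of [s0] and can only move left. Hence no permutation of D lowers
    this pairing of keys with columns. *)
Let moment (g : {perm I}) : int := \sum_s kap s * (c1 (g (x s)))%:Z.
Let shift (g : {perm I}) (s : I) : int := (c1 (g (x s)))%:Z - (c1 (x s))%:Z.

Lemma sum_shift g : \sum_s shift g s = 0.
Proof.
rewrite sumrB; apply/eqP; rewrite subr_eq0; apply/eqP.
rewrite [LHS](reindex_inj (@perm_inj _ x^-1)) [RHS](reindex_inj (@perm_inj _ x^-1)) /=.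
rewrite [RHS](reindex_inj (@perm_inj _ g)) /=.
by apply: eq_bigr => s _; rewrite !permKV.
Qed.

Lemma momentB g : moment g - moment 1%g = \sum_s (kap s - kap s0) * shift g s.
Proof.
transitivity (\sum_s (kap s - kap s0) * shift g s + kap s0 * \sum_s shift g s).
  by rewrite mulr_sumr -big_split /= -sumrB; apply: eq_bigr => s _; rewrite perm1 /shift; ring.
by rewrite sum_shift mulr0 addr0.
Qed.

Lemma upper_kap s : x s \in upper -> kap s0 <= kap s.
Proof.
rewrite inE => /andP[/eqP cs]; rewrite leq_eqVlt => /orP[/eqP e|lt]; last by apply: kap_sorted.
by have -> : s = s0; [apply: (@perm_inj _ x); exact: (shape_inj sh1)|].
Qed.

Lemma lower_kap s : x s \in lower -> kap s <= kap s0.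
Proof.
rewrite inE => /andP[/eqP cs]; rewrite leq_eqVlt => /orP[/eqP e|lt]; last first.
  by apply: le_trans kap_violation; apply: kap_sorted; rewrite ?row_eq ?col_succ.
have -> // : s = s1; apply: (@perm_inj _ x); apply: (shape_inj sh1); rewrite ?row_eq //.
by rewrite col_succ.
Qed.

Lemma shiftP g s : perm_on D g ->
  [\/ x s \in upper /\ (shift g s = 0 \/ shift g s = 1), x s \in lower /\ (shift g s = 0 \/ shift g s = -1) | shift g s = 0].
Proof.
move=> hg; have [xD|xD] := boolP (x s \in D); last first.
  by constructor 3; rewrite /shift (out_perm hg xD) subrr.
have gD : g (x s) \in D by rewrite (perm_closed _ hg).
have colD z : z \in D -> c1 z = c \/ c1 z = c.+1.
  by rewrite !inE => /orP[/andP[/eqP -> _]|/andP[/eqP -> _]]; [left|right].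
have cg := colD _ gD; rewrite /shift.
have [xu|xu] := boolP (x s \in upper); [constructor 1|constructor 2]; split=> //.
- by move: xu; rewrite inE => /andP[/eqP -> _]; case: cg => ->; lia.
- by move: xD; rewrite in_setU (negbTE xu).
- have : x s \in lower by move: xD; rewrite in_setU (negbTE xu).
  by rewrite inE => /andP[/eqP -> _]; case: cg => ->; lia.
Qed.

Lemma shift_term_ge0 g s : perm_on D g -> 0 <= (kap s - kap s0) * shift g s.
Proof.
move=> hg; case: (shiftP s hg) => [[/upper_kap h [|] ->]|[/lower_kap h [|] ->]|->]; lia.
Qed.

Lemma moment_ge g : perm_on D g -> moment 1%g <= moment g.
Proof. by move=> hg; rewrite -subr_ge0 momentB; apply: sumr_ge0 => s _; exact: shift_term_ge0. Qed.

(* When the moment does not increase, g only exchanges strands with equal key, *)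
(* and undoing such an exchange is a column exchange on both sides.            *)
Lemma garnir_tie E g : label_invariant Q E -> perm_on D g -> moment g = moment 1%g ->
  (-1) ^+ g * altsum E (x * g)%g y = altsum E x y.
Proof.
move=> hE; have [m] := ubnP #|[pred s | shift g s == 1]|; elim: m g => // m IH g lem hg hm.
have zero s : (kap s - kap s0) * shift g s = 0.
  have : \sum_s (kap s - kap s0) * shift g s == 0 by rewrite -momentB hm subrr.
  rewrite psumr_eq0; last by move=> z _; exact: shift_term_ge0.
  by move=> /allP/(_ s); rewrite mem_index_enum => /(_ isT) /eqP.
have [/existsP[sa /eqP ha]|/existsPn na] := boolP [exists s, shift g s == 1]; last first.
  have np s : shift g s <= 0.
    case: (shiftP s hg) => [[_ [->|e]] //|[_ [->|->]]|->] //.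
    by have := na s; rewrite e eqxx.
  have : \sum_s - shift g s == 0 by rewrite sumrN sum_shift oppr0.
  rewrite psumr_eq0; last by move=> z _; rewrite oppr_ge0.
  move=> /allP z0; rewrite altsum_stab1 ?mulrA -?expr2 ?sqrr_sign ?mul1r //.
  apply/forallP => z; have := z0 (x^-1%g z); rewrite mem_index_enum => /(_ isT).
  by rewrite oppr_eq0 /shift permKV subr_eq0 eqz_nat.
have [sb hb] : exists s, shift g s = -1.
  have [/existsP[s /eqP hs]|/existsPn nb] := boolP [exists s, shift g s == -1]; first by exists s.
  have ge0 s : 0 <= shift g s.
    case: (shiftP s hg) => [[_ [->|->]] //|[_ [->|e]]|->] //.
    by have := nb s; rewrite e eqxx.
  have := sum_shift g; move/eqP; rewrite psumr_eq0; last by move=> z _; exact: ge0.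
  by move=> /allP/(_ sa); rewrite mem_index_enum ha => /(_ isT).
have ka : kap sa = kap s0 by have := zero sa; rewrite ha mulr1 => /eqP; rewrite subr_eq0 => /eqP.
have kb : kap sb = kap s0 by have := zero sb; rewrite hb mulrN1 => /eqP; rewrite oppr_eq0 subr_eq0 => /eqP.
have [Qab cab] : Q sa = Q sb /\ c2 (y sa) = c2 (y sb) by apply: kap_tie; rewrite ka kb.
have ab : sa != sb by apply/eqP => e; move: ha; rewrite e hb.
pose h := tperm sa sb; pose t := tperm (x sa) (x sb).
have xa : x sa \in upper by case: (shiftP sa hg) => [[]|[_ []]|] //; rewrite ha.
have xb : x sb \in lower by case: (shiftP sb hg) => [[_ []]|[]|] //; rewrite hb.
have tD : perm_on D t by rewrite perm_on_tperm // in_setU ?xa ?xb ?orbT.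
have hx : (h * x = x * t)%g by apply/permP => s; rewrite !permM inj_tperm //; exact: perm_inj.
have hy : (h * y = y * tperm (y sa) (y sb))%g by apply/permP => s; rewrite !permM inj_tperm //; exact: perm_inj.
have e1 : altsum E (x * g)%g y = - altsum E (x * (t * g))%g y.
  rewrite -(altsum_relabel _ _ _ _ (x * g)%g y hE (h := h)); last first.
    by move=> s; rewrite /h; case: tpermP => [->|->|].
  rewrite mulgA hx hy altsum_swap altsum_stab1 ?stab_tperm // odd_tperm (inj_eq perm_inj) ab.
  by rewrite expr1 mulN1r -altsum_swap mulgA.
have shiftE s : shift (t * g)%g s = if s == sa then 0 else if s == sb then 0 else shift g s.
  rewrite /shift permM /t; case: eqP => [->|/eqP na].
    rewrite tpermL; move: hb; rewrite /shift; move: xa xb; rewrite !inE => /andP[/eqP -> _] /andP[/eqP -> _]; lia.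
  case: eqP => [->|/eqP nb].
    rewrite tpermR; move: ha; rewrite /shift; move: xa xb; rewrite !inE => /andP[/eqP -> _] /andP[/eqP -> _]; lia.
  by rewrite tpermD // (inj_eq perm_inj) eq_sym.
rewrite e1 mulrN -mulNr -[RHS](IH (t * g)%g).
- by rewrite odd_permM odd_tperm (inj_eq perm_inj) ab addTb signrN.
- rewrite ltnS in lem; apply: leq_trans lem; apply: proper_card; apply/properP; split.
    by apply/subsetP => s; rewrite !inE shiftE; case: (s == sa) => //; case: (s == sb).
  by exists sa; rewrite inE ?ha // shiftE eqxx.
- exact: perm_onM.
- apply/eqP; rewrite -subr_eq0 momentB; apply/eqP; apply: big1 => s _; rewrite shiftE.
  by case: (s == sa); rewrite ?mulr0 //; case: (s == sb); rewrite ?mulr0.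
Qed.

(** D has more boxes than column c, while a column permutation keeps it in rows that meet column c,
    as column c + 1 is no longer than column c. *)
Lemma garnir_pigeonhole p : stab c1 p -> exists a b, [/\ a != b, a \in D, b \in D & r1 (p a) = r1 (p b)].
Proof.
move=> /forallP hp.
have [/existsP[a /andP[aD /existsP[b /and3P[bD ab /eqP e]]]]|/existsPn none] :=
  boolP [exists a, (a \in D) && [exists b, [&& b \in D, a != b & r1 (p a) == r1 (p b)]]].
  by exists a, b.
exfalso; pose loc i' j' z := odflt z [pick z | (r1 z == i') && (c1 z == j')].
have locP i' j' z w : r1 w = i' -> c1 w = j' -> r1 (loc i' j' z) = i' /\ c1 (loc i' j' z) = j'.
  move=> e1 e2; rewrite /loc; case: pickP => [v /andP[/eqP -> /eqP ->] //|/(_ w)].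
  by rewrite e1 e2 !eqxx.
pose Col := [set z | c1 z == c].
have s1D : x s1 \in D by rewrite !inE col_succ row_eq eqxx leqnn orbT.
have le1 : (#|Col| <= #|D :\ x s1|)%N.
  pose f z := if (i <= r1 z)%N then z else loc (r1 z) c.+1 z.
  have fP z : z \in Col -> r1 (f z) = r1 z /\ c1 (f z) = if (i <= r1 z)%N then c else c.+1.
    rewrite inE => /eqP cz; rewrite /f; case: ifP => // iz.
    have [||w [w1 w2]] := shape_closed sh1 (x := x s1) (i := r1 z) (j := c.+1).
    - by rewrite (shape_row sh1) row_eq -/i; lia.
    - by rewrite col_succ /=.
    - exact: locP w1 w2.
  rewrite -(card_in_imset (f := f) (D := Col)).
    apply: subset_leq_card; apply/subsetP => w /imsetP[z zC ->]; have [f1 f2] := fP z zC.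
    rewrite !inE f1 f2; apply/andP; split.
      apply/eqP => e; move: f1 f2; rewrite e row_eq col_succ -/i -/c => <-.
      by rewrite leqnn; lia.
    by case: ifP => iz; rewrite eqxx //= ltnW ?orbT // ltnNge iz.
  move=> z z' zC zC' e; have [f1 _] := fP z zC; have [f1' _] := fP z' zC'.
  apply: (shape_inj sh1); first by rewrite -f1 e f1'.
  by move: zC zC'; rewrite !inE => /eqP -> /eqP ->.
have le2 : (#|D| <= #|Col|)%N.
  pose f z := loc (r1 (p z)) c z.
  have fP z : z \in D -> r1 (f z) = r1 (p z) /\ c1 (f z) = c.
    move=> zD; have [||w [w1 w2]] := shape_closed sh1 (x := p z) (i := r1 (p z)) (j := c).
    - by rewrite leqnn (shape_row sh1).
    - by rewrite (eqP (hp z)) (shape_col sh1) /=; move: zD; rewrite !inE => /orP[] /andP[/eqP -> _].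
    - exact: locP w1 w2.
  rewrite -(card_in_imset (f := f) (D := D)).
    by apply: subset_leq_card; apply/subsetP => w /imsetP[z zD ->]; rewrite inE (fP z zD).2.
  move=> z z' zD zD' e; apply/eqP; apply: contraT => ne.
  have := none z; rewrite zD /= => /existsPn/(_ z'); rewrite zD' ne /= -(fP z zD).1 e (fP z' zD').1.
  by rewrite eqxx.
by move: (leq_trans le2 le1); rewrite [#|D|](cardsD1 (x s1)) s1D add1n ltnn.
Qed.

Lemma garnir_vanish E : \sum_(g : {perm I} | perm_on D g) (-1) ^+ g * altsum E (x * g)%g y = 0.
Proof.
rewrite /altsum; under eq_bigr => g _ do rewrite mulr_sumr.
rewrite exchange_big /= big1 // => p hp.
have [a [b [ab aD bD e]]] := garnir_pigeonhole hp.
set Z := LHS; apply: (eq_oppr_eq0 hk).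
rewrite {1}/Z (reindex_inj (mulIg (tperm a b))) /= -sumrN; apply: eq_big => g.
  by rewrite perm_on_mulr ?perm_on_tperm.
move=> _; rewrite odd_permM odd_tperm ab addbT signrN mulNr; congr (- (_ * _)).
apply: eq_bigr => q _; congr (_ * E _ _); apply/ffunP => s; rewrite !ffunE !permM.
by case: tpermP => [->|->|].
Qed.

(** The signed sum over all permutations of D vanishes. By [garnir_tie] each term with unchanged
    moment equals the original sum, so a positive multiple of it is minus the sum of the terms with
    larger moment. *)
Lemma garnir : exists z : {perm I} -> k, (forall g, z g != 0 -> moment 1%g < moment g) /\
  forall E, label_invariant Q E -> altsum E x y = \sum_g z g * altsum E (x * g)%g y.
Proof.
pose G0 (g : {perm I}) := perm_on D g && (moment g == moment 1%g).
pose N : k := #|G0|%:R.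
have N0 : N != 0.
  rewrite natf_neq0_char0 // -lt0n; apply/card_gt0P; exists 1%g.
  by rewrite unfold_in /G0 perm_on1 eqxx.
exists (fun g => if perm_on D g && (moment g != moment 1%g) then - N^-1 * (-1) ^+ g else 0); split.
  move=> g; case: ifP => [/andP[hg ne] _|]; last by rewrite eqxx.
  by rewrite lt_neqAle eq_sym ne moment_ge.
move=> E hE; apply: (mulfI N0); rewrite [RHS]mulr_sumr.
have := garnir_vanish E; rewrite (bigID G0) /= => /eqP; rewrite addr_eq0 => /eqP.
rewrite (eq_bigl G0) => [|g]; last by rewrite /G0; case: (perm_on D g).
rewrite (eq_bigr (fun _ => altsum E x y)); last by move=> g /andP[hg /eqP hm]; exact: garnir_tie.
rewrite sumr_const => e; rewrite [LHS]mulr_natl e -sumrN big_mkcond /=; apply: eq_bigr => g _.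
rewrite /G0; case: (perm_on D g) => //=; last by rewrite mul0r mulr0.
case: eqP => _ /=; first by rewrite mul0r mulr0.
by rewrite !mulrA mulrN divff // mulN1r mulNr.
Qed.

End Garnir.

(** * Straightening to pictures *)

Lemma key_inj (K a b u v : nat) : (u < K)%N -> (v < K)%N ->
  (K * a)%:Z - u%:Z = (K * b)%:Z - v%:Z -> a = b /\ u = v.
Proof.
move=> uK vK e; have [ab|ba|ab] := ltngtP a b; last by move: e; rewrite ab; lia.
  have : (K * a.+1 <= K * b)%N by rewrite leq_mul2l ab orbT.
  by rewrite mulnS; lia.
have : (K * b.+1 <= K * a)%N by rewrite leq_mul2l ba orbT.
by rewrite mulnS; lia.
Qed.

Lemma key_le (K a b u v : nat) : (u < K)%N -> (v < K)%N ->
  (K * a)%:Z - u%:Z <= (K * b)%:Z - v%:Z -> (a <= b)%N.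
Proof.
move=> uK vK e; rewrite leqNgt; apply/negP => ba.
have : (K * b.+1 <= K * a)%N by rewrite leq_mul2l ba orbT.
by rewrite mulnS; lia.
Qed.

Section Straightening.
Variables (I : finType) (K : nat) (Q : I -> nat).

Definition key (c : I -> nat) (y : {perm I}) (s : I) : int := (K * Q s)%:Z - (c (y s))%:Z.

Definition col_sorted (r1 c1 r2 c2 : I -> nat) (x y : {perm I}) : bool :=
  [forall s, forall s', (c1 (x s) == c1 (x s')) && (r1 (x s) < r1 (x s'))%N ==>
     (key c2 y s < key c2 y s') || ((key c2 y s == key c2 y s') && (r2 (y s) < r2 (y s'))%N)].

Definition row_strict (r1 c1 c2 : I -> nat) (x y : {perm I}) : bool :=
  [forall s, forall s', (r1 (x s) == r1 (x s')) && (c1 (x s') == (c1 (x s)).+1) ==>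
     (key c2 y s < key c2 y s')].

Definition good_side (r1 c1 r2 c2 : I -> nat) x y := col_sorted r1 c1 r2 c2 x y && row_strict r1 c1 c2 x y.

Definition meas_col (c1 c2 : I -> nat) (x y : {perm I}) : int :=
  \sum_s ((K * Q s)%:Z * ((c1 (x s))%:Z + (c2 (y s))%:Z) - (c1 (x s))%:Z * (c2 (y s))%:Z).
Definition meas_key (r1 c1 r2 c2 : I -> nat) (x y : {perm I}) : int :=
  \sum_s ((r1 (x s))%:Z * key c2 y s + (r2 (y s))%:Z * key c1 x s).
Definition meas_row (r1 r2 : I -> nat) (x y : {perm I}) : int :=
  \sum_s ((r1 (x s))%:Z * (r2 (y s))%:Z).

(* All straightening moves increase these three statistics lexicographically:  *)
(* Garnir relations the first, column exchanges the second or the third.       *)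
Definition lex_lt (r1 c1 r2 c2 : I -> nat) x y x' y' : bool :=
  (meas_col c1 c2 x y < meas_col c1 c2 x' y') ||
  ((meas_col c1 c2 x y == meas_col c1 c2 x' y') &&
   ((meas_key r1 c1 r2 c2 x y < meas_key r1 c1 r2 c2 x' y') ||
    ((meas_key r1 c1 r2 c2 x y == meas_key r1 c1 r2 c2 x' y') &&
     (meas_row r1 r2 x y < meas_row r1 r2 x' y')))).

Lemma lex_lt_swap r1 c1 r2 c2 x y x' y' : lex_lt r1 c1 r2 c2 x y x' y' = lex_lt r2 c2 r1 c1 y x y' x'.
Proof.
have h1 u v : meas_col c1 c2 u v = meas_col c2 c1 v u.
  by apply: eq_bigr => s _; rewrite addrC [X in _ - X]mulrC [X in _ * X - _]addrC addrC.
have h2 u v : meas_key r1 c1 r2 c2 u v = meas_key r2 c2 r1 c1 v u by apply: eq_bigr => s _; rewrite addrC.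
have h3 u v : meas_row r1 r2 u v = meas_row r2 r1 v u by apply: eq_bigr => s _; rewrite mulrC.
by rewrite /lex_lt !h1 !h2 !h3.
Qed.

Lemma lex_lt_trans r1 c1 r2 c2 x y x' y' x'' y'' : lex_lt r1 c1 r2 c2 x y x' y' ->
  lex_lt r1 c1 r2 c2 x' y' x'' y'' -> lex_lt r1 c1 r2 c2 x y x'' y''.
Proof. by rewrite /lex_lt; lia. Qed.

Lemma lex_lt_irr r1 c1 r2 c2 x y : lex_lt r1 c1 r2 c2 x y x y = false.
Proof. by rewrite /lex_lt !ltxx !andbF. Qed.

Section Side.
Variables (k : fieldType) (r1 c1 r2 c2 : I -> nat).
Hypothesis hk : [pchar k] =i pred0.
Hypothesis sh1 : is_shape r1 c1.
Hypothesis sh2 : is_shape r2 c2.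
Hypothesis c1K : forall z, (c1 z < K)%N.
Hypothesis c2K : forall z, (c2 z < K)%N.
Local Notation altsum := (@altsum k I r1 c1 r2 c2).

Lemma sumB_two_terms (F G : I -> int) s s' : s != s' -> (forall z, z != s -> z != s' -> F z = G z) ->
  \sum_z F z - \sum_z G z = F s + F s' - (G s + G s').
Proof.
move=> ss h; rewrite (bigD1 s) //= (bigD1 s') /= 1?eq_sym //.
rewrite [X in _ - X](bigD1 s) //= [X in _ - (_ + X)](bigD1 s') /= 1?eq_sym //.
rewrite (eq_bigr G) => [|z /andP[z1 z2]]; last exact: h.
by ring.
Qed.

(** A pair in the wrong order within a column is exchanged at the cost of a sign. Once columns are
    sorted, an adjacent pair violating [row_strict] satisfies the hypotheses of [garnir]. *)
Lemma straighten_side x y : ~~ good_side r1 c1 r2 c2 x y ->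
  exists z : {perm I} -> k, (forall g, z g != 0 -> lex_lt r1 c1 r2 c2 x y (x * g)%g y) /\
    forall E, label_invariant Q E -> altsum E x y = \sum_g z g * altsum E (x * g)%g y.
Proof.
rewrite negb_and => hng.
have [cs|ncs] := boolP (col_sorted r1 c1 r2 c2 x y); last first.
  move: (ncs) => /forallPn[s /forallPn[s']]; rewrite negb_imply => /andP[/andP[/eqP cc rr] hv].
  have ss : s != s' by apply: contraTneq rr => ->; rewrite ltnn.
  pose t := tperm (x s) (x s').
  have c1t z : c1 (t z) = c1 z by rewrite /t; case: tpermP => [->|->|].
  have xt z : z != s -> z != s' -> (x * t)%g z = x z.
    by move=> z1 z2; rewrite permM tpermD // (inj_eq perm_inj) eq_sym.
  have xts : (x * t)%g s = x s' by rewrite permM tpermL.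
  have xts' : (x * t)%g s' = x s by rewrite permM tpermR.
  exists (fun g => - (g == t)%:R); split.
    move=> g; rewrite oppr_eq0; case: (g =P t) => [-> _|_]; last by rewrite eqxx.
    have e1 : meas_col c1 c2 (x * t)%g y = meas_col c1 c2 x y.
      by apply: eq_bigr => z _; rewrite permM c1t.
    have d2 : meas_key r1 c1 r2 c2 (x * t)%g y - meas_key r1 c1 r2 c2 x y =
        ((r1 (x s'))%:Z - (r1 (x s))%:Z) * (key c2 y s - key c2 y s').
      rewrite (sumB_two_terms ss); last by move=> z z1 z2; rewrite /key xt.
      rewrite /key xts xts' cc; ring.
    have d3 : meas_row r1 r2 (x * t)%g y - meas_row r1 r2 x y =
        ((r1 (x s'))%:Z - (r1 (x s))%:Z) * ((r2 (y s))%:Z - (r2 (y s'))%:Z).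
      rewrite (sumB_two_terms ss); last by move=> z z1 z2; rewrite xt.
      by rewrite xts xts'; ring.
    rewrite /lex_lt e1 ltxx eqxx /=.
    have [lt|gt|eq] := ltgtP (key c2 y s) (key c2 y s').
    - by move: hv; rewrite lt.
    - by rewrite -subr_gt0 d2 mulr_gt0 // subr_gt0 // ltz_nat.
    - move: hv; rewrite eq ltxx eqxx /= -leqNgt leq_eqVlt => /orP[/eqP re|rl].
        have [_ c2e] := key_inj (c2K _) (c2K _) eq.
        have /perm_inj e : y s = y s' by apply: (shape_inj sh2).
        by move: ss; rewrite e eqxx.
      have -> : meas_key r1 c1 r2 c2 (x * t)%g y = meas_key r1 c1 r2 c2 x y.
        by apply/eqP; rewrite -subr_eq0 d2 eq subrr mulr0.
      by rewrite ltxx eqxx -subr_gt0 d3 mulr_gt0 // subr_gt0 ltz_nat.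
  move=> E hE; rewrite (bigD1 t) //= eqxx big1 ?addr0 => [|g /negbTE ->]; last by rewrite oppr0 mul0r.
  by rewrite altsum_stab1 ?stab_tperm // odd_tperm (inj_eq perm_inj) ss expr1 !mulN1r opprK.
move: hng; rewrite cs /= => /forallPn[s /forallPn[s']]; rewrite negb_imply => /andP[/andP[/eqP rr /eqP cc]].
rewrite -leNgt => hv.
have [z z' e1 e2|z z' e|z [z1 z2]] :=
  @garnir k I r1 c1 r2 c2 hk sh1 _ Q (key c2 y) x y s s' (esym rr) cc _ hv.
- have := forallP (forallP cs z) z'; rewrite e1 eqxx e2 /= => /orP[/ltW//|/andP[/eqP -> _]].
  exact: lexx.
- exact: key_inj e.
exists z; split=> // g /z1; rewrite /lex_lt => h; apply/orP; left.
rewrite -subr_gt0; suff -> : meas_col c1 c2 (x * g)%g y - meas_col c1 c2 x y =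
   \sum_s0 key c2 y s0 * (c1 (g (x s0)))%:Z - \sum_s0 key c2 y s0 * (c1 ((1 : {perm I})%g (x s0)))%:Z by rewrite subr_gt0.
rewrite -!sumrB; apply: eq_bigr => a _; rewrite permM perm1 /key; ring.
Qed.

End Side.

Variables (k : fieldType) (r1 c1 r2 c2 : I -> nat).
Hypothesis hk : [pchar k] =i pred0.
Hypothesis sh1 : is_shape r1 c1.
Hypothesis sh2 : is_shape r2 c2.
Hypothesis c1K : forall z, (c1 z < K)%N.
Hypothesis c2K : forall z, (c2 z < K)%N.

Definition good x y := good_side r1 c1 r2 c2 x y && good_side r2 c2 r1 c1 y x.

(** Induction on the number of pairs that are larger for [lex_lt]; this order is symmetric in the
    two diagrams, so moves on either side make progress. *)
Theorem straightening x y : exists z : {perm I} * {perm I} -> k,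
  (forall p, z p != 0 -> good p.1 p.2) /\
  forall E, label_invariant Q E ->
    altsum r1 c1 r2 c2 E x y = \sum_p z p * altsum r1 c1 r2 c2 E p.1 p.2.
Proof.
have [m] := ubnP #|[pred p : {perm I} * {perm I} | lex_lt r1 c1 r2 c2 x y p.1 p.2]|.
elim: m x y => // m IH x y lem.
have [gd|ngd] := boolP (good x y).
  exists (fun p => (p == (x, y))%:R); split=> [p|E hE]; first by case: (p =P (x, y)) => [->//|_]; rewrite eqxx.
  rewrite (bigD1 (x, y)) //= eqxx mul1r big1 ?addr0 // => p /negbTE ->; by rewrite mul0r.
suff [z [z1 z2]] : exists z : {perm I} * {perm I} -> k,
    (forall p, z p != 0 -> lex_lt r1 c1 r2 c2 x y p.1 p.2) /\
    forall E, label_invariant Q E ->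
      altsum r1 c1 r2 c2 E x y = \sum_p z p * altsum r1 c1 r2 c2 E p.1 p.2.
  have step p : exists w : {perm I} * {perm I} -> k, (forall q, w q != 0 -> good q.1 q.2) /\
      (z p != 0 -> forall E, label_invariant Q E ->
       altsum r1 c1 r2 c2 E p.1 p.2 = \sum_q w q * altsum r1 c1 r2 c2 E q.1 q.2).
    have [zp|zp] := eqVneq (z p) 0; first by exists (fun _ => 0); split=> // q; rewrite eqxx.
    have lt := z1 p zp; have [|w [w1 w2]] := IH p.1 p.2; last by exists w.
    rewrite ltnS in lem; apply: leq_trans lem; apply: proper_card; apply/properP; split.
      by apply/subsetP => q; rewrite !inE; exact: lex_lt_trans.
    by exists p; rewrite inE // lex_lt_irr.
  have [w hw] := fin_all_exists step.
  exists (fun q => \sum_p z p * w p q); split.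
    move=> q nz; have [/forallP h|/forallPn[p]] := boolP [forall p, z p * w p q == 0].
      by case/eqP: nz; apply: big1 => p _; apply/eqP.
    by rewrite mulf_eq0 negb_or => /andP[_]; case: (hw p) => h _; exact: h.
  move=> E hE; rewrite z2 //; under [RHS]eq_bigr do rewrite mulr_suml.
  rewrite [RHS]exchange_big /=; apply: eq_bigr => p _.
  have [zp|zp] := eqVneq (z p) 0.
    by rewrite zp mul0r big1 // => q _; rewrite !mul0r.
  have [_ ->] // := hw p; rewrite mulr_sumr; apply: eq_bigr => q _; by rewrite mulrA.
move: ngd; rewrite negb_and => /orP[ng|ng].
  have [z [z1 z2]] := straighten_side hk sh1 sh2 c2K ng.
  exists (fun p => if p.2 == y then z (x^-1 * p.1)%g else 0); split.
    move=> [a b] /=; case: (b =P y) => [-> /z1|_]; last by rewrite eqxx.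
    by rewrite mulKVg.
  move=> E hE; rewrite z2 //.
  rewrite -(pair_bigA _ (fun a b => (if b == y then z (x^-1 * a)%g else 0) * altsum r1 c1 r2 c2 E a b)) /=.
  rewrite [RHS](reindex_inj (mulgI x)) /=; apply: eq_bigr => g _.
  rewrite (bigD1 y) //= eqxx mulKg big1 ?addr0 // => b; case: (b =P y) => // _ _; by rewrite mul0r.
have [z [z1 z2]] := straighten_side hk sh2 sh1 c1K ng.
exists (fun p => if p.1 == x then z (y^-1 * p.2)%g else 0); split.
  move=> [a b] /=; case: (a =P x) => [-> /z1|_]; last by rewrite eqxx.
  by rewrite lex_lt_swap mulKVg.
move=> E hE; rewrite altsum_swap z2; last by move=> h i j hh; exact: hE.
rewrite -(pair_bigA _ (fun a b => (if a == x then z (y^-1 * b)%g else 0) * altsum r1 c1 r2 c2 E a b)) /=.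
rewrite exchange_big [RHS](reindex_inj (mulgI y)) /=; apply: eq_bigr => g _.
rewrite (bigD1 x) //= eqxx mulKg big1 ?addr0; last by move=> b; case: (b =P x) => // _ _; rewrite mul0r.
by rewrite -altsum_swap.
Qed.

End Straightening.

(** * Pictures *)

Section Picture.
Variables (I : finType) (K : nat) (Q : I -> nat).

Definition pkey (c : I -> nat) (a : I) : int := (K * Q a)%:Z - (c a)%:Z.

(* Strands carry a box of either diagram and a label; sorting by [pkey] is by  *)
(* label first and then by the column in the other diagram, from right to left. *)
Record half_picture (r c r' c' : I -> nat) : Prop := HalfPicture {
  hp_shape : is_shape r c;
  hp_bound : forall a, (c a < K)%N;
  hp_col : forall a b, c a = c b -> (r a < r b)%N ->
    pkey c' a < pkey c' b \/ (pkey c' a = pkey c' b /\ (r' a < r' b)%N);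
  hp_row : forall a b, r a = r b -> c b = (c a).+1 -> pkey c' a < pkey c' b }.

Lemma hp_row_strict r c r' c' : half_picture r c r' c' ->
  forall a b, r a = r b -> (c a < c b)%N -> pkey c' a < pkey c' b.
Proof.
move=> H a b e; have [m] := ubnP (c b - c a); elim: m b e => // m IH b e; rewrite ltnS => hm lt.
have sh := hp_shape H.
have [||z [z1 z2]] := shape_closed sh (x := b) (i := r b) (j := (c b).-1).
- by rewrite leqnn (shape_row sh).
- by have := shape_col sh a; lia.
have zb : pkey c' z < pkey c' b by apply: (hp_row H); rewrite ?z1 // z2; lia.
have [e2|ne] := eqVneq (c a) (c z).
  by rewrite (shape_inj sh _ e2) // z1.
by apply: lt_trans zb; apply: IH; lia.
Qed.

Lemma hp_col_weak r c r' c' : half_picture r c r' c' ->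
  forall a b, c a = c b -> (r a <= r b)%N -> pkey c' a <= pkey c' b.
Proof.
move=> H a b e; rewrite leq_eqVlt => /orP[/eqP e2|lt].
  by rewrite (shape_inj (hp_shape H) e2 e).
by case: (hp_col H e lt) => [/ltW|[->]].
Qed.

Variables (r c r' c' : I -> nat).
Hypothesis H1 : half_picture r c r' c'.
Hypothesis H2 : half_picture r' c' r c.

Lemma picture_admissible a b : Q a = Q b -> c' a = c' b -> (r' a < r' b)%N ->
  (r a < r b)%N /\ (c b <= c a)%N.
Proof.
move=> eQ ec lt; have [h|[h h2]] := hp_col H2 ec lt; last first.
  by split=> //; move: h; rewrite /pkey eQ; lia.
have cba : (c b < c a)%N by move: h; rewrite /pkey eQ; lia.
split; last exact: ltnW.
rewrite ltnNge; apply/negP => rba; have sh := hp_shape H1.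
(* The box where the row of b meets the column of a would put the key of b strictly below the key of
   a, but these keys agree. *)
have [||x [x1 x2]] := shape_closed sh (x := a) (i := r b) (j := c a).
- by rewrite (shape_row sh).
- by rewrite (shape_col sh) leqnn.
have k1 : pkey c' b < pkey c' x by apply: (hp_row_strict H1); rewrite ?x2.
have k2 : pkey c' x <= pkey c' a by apply: (hp_col_weak H1); rewrite ?x1.
by move: (lt_le_trans k1 k2); rewrite /pkey eQ ec ltxx.
Qed.

Lemma picture_label_row a b : r a = r b -> (c a <= c b)%N -> (Q a <= Q b)%N.
Proof.
move=> e; rewrite leq_eqVlt => /orP[/eqP e2|lt].
  by rewrite (shape_inj (hp_shape H1) e e2).
have := ltW (hp_row_strict H1 e lt).
by apply: key_le; exact: (hp_bound H2).
Qed.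

Lemma picture_label_col a b : c a = c b -> (r a <= r b)%N -> (Q a <= Q b)%N.
Proof.
by move=> e le; have := hp_col_weak H1 e le; apply: key_le; exact: (hp_bound H2).
Qed.

Lemma pkey_inj (d : I -> nat) a b : (forall z, (d z < K)%N) -> pkey d a = pkey d b -> Q a = Q b /\ d a = d b.
Proof. by move=> h; exact: key_inj. Qed.

(* A violation in some row of the two columns forces another one strictly lower. *)
Lemma picture_row_adjacent a b : r a = r b -> c b = (c a).+1 -> Q a = Q b -> (r' a <= r' b)%N.
Proof.
have b1 := hp_bound H1; have b2 := hp_bound H2; have sh := hp_shape H1; have sh' := hp_shape H2.
have [m] := ubnP (\max_z r z - r a); elim: m a b => // m IH a b; rewrite ltnS => hm er ec eQ.
rewrite leqNgt; apply/negP => viol.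
have kab := hp_row H1 er ec.
have cba : (c' b < c' a)%N by move: kab; rewrite /pkey eQ; lia.
have [||u [u1 u2]] := shape_closed sh' (x := a) (i := r' b) (j := c' a).
- by rewrite (shape_row sh') ltnW.
- by rewrite (shape_col sh') leqnn.
have [||v [v1 v2]] := shape_closed sh' (x := a) (i := r' a) (j := c' b).
- by rewrite (shape_row sh') leqnn.
- by rewrite (shape_col sh') ltnW.
have k1 : pkey c b < pkey c u by apply: (hp_row_strict H2); rewrite ?u1 ?u2.
have k2 : pkey c u <= pkey c a by apply: (hp_col_weak H2); rewrite ?u1 ?u2 // ltnW.
have k3 : pkey c v < pkey c a by apply: (hp_row_strict H2); rewrite ?v1 ?v2.
have k4 : pkey c b <= pkey c v by apply: (hp_col_weak H2); rewrite ?v1 ?v2 // ltnW.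
have kb : pkey c b = pkey c a - 1 by rewrite /pkey eQ ec; lia.
have ku : pkey c u = pkey c a by lia.
have kv : pkey c b = pkey c v by lia.
have [Qv cv] := pkey_inj b1 kv.
have cs : c' a = (c' b).+1.
  apply/eqP; rewrite eqn_leq cba andbT leqNgt; apply/negP => gap.
  have [||w [w1 w2]] := shape_closed sh' (x := u) (i := r' b) (j := (c' b).+1).
  - by rewrite u1 leqnn (shape_row sh').
  - by rewrite u2 /=; exact: ltnW.
  have k5 : pkey c b < pkey c w by apply: (hp_row_strict H2); rewrite ?w1 ?w2.
  have k6 : pkey c w < pkey c u by apply: (hp_row_strict H2); rewrite ?w1 ?w2 ?u1 ?u2.
  by lia.
have rbv : (r b < r v)%N.
  have lt : (r' b < r' v)%N by rewrite v1.
  by case: (hp_col H2 (esym v2) lt) => [|[]//]; rewrite kv ltxx.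
have [||w [w1 w2]] := shape_closed sh (x := v) (i := r v) (j := c a).
- by rewrite leqnn (shape_row sh).
- by rewrite (shape_col sh) -cv ec /=.
have k5 : pkey c' w < pkey c' v by apply: (hp_row H1); rewrite ?w1 // w2 -cv.
have law : (r a < r w)%N by rewrite w1 er.
have kva : pkey c' v = pkey c' a + 1 by rewrite /pkey -Qv eQ v2 cs; lia.
have [k6|[k6 k7]] := hp_col H1 (esym w2) law; first by lia.
have [Qw cw] := pkey_inj b2 k6.
have lev : (r v <= \max_z r z)%N by exact: (leq_bigmax (F := r)).
have : (r' w <= r' v)%N.
  apply: IH => //; first by lia.
  - by rewrite -cv ec w2.
  - by rewrite -Qw -Qv eQ.
by rewrite v1; lia.
Qed.

Lemma picture_row_weak a b : r a = r b -> (c a <= c b)%N -> Q a = Q b -> (r' a <= r' b)%N.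
Proof.
move=> e; have sh := hp_shape H1.
have [m] := ubnP (c b - c a); elim: m b e => // m IH b e; rewrite ltnS => hm le eQ.
have [e2|ne] := eqVneq (c a) (c b); first by rewrite (shape_inj sh e e2).
have [||z [z1 z2]] := shape_closed sh (x := b) (i := r b) (j := (c b).-1).
- by rewrite leqnn (shape_row sh).
- by have := shape_col sh a; lia.
have qz : Q z = Q a.
  apply/eqP; rewrite eqn_leq {1}eQ; apply/andP; split; apply: picture_label_row; rewrite ?z1 ?z2 //; lia.
have h1 : (r' z <= r' b)%N by apply: picture_row_adjacent; rewrite ?z1 ?z2 ?qz //; lia.
by apply: leq_trans h1; apply: IH; rewrite ?z1 ?z2 ?qz //; lia.
Qed.

End Picture.

(** * Triangularity of the representatives *)

(** Blockwise rearrangement inequality with its equality case. A transposition makes the moved point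
    with largest x fixed; this cannot lower the sum, and it leaves fewer moved points. *)
Lemma rearrangement (T : finType) (B : T -> nat) (x y : T -> int) (w : {perm T}) :
  (forall a b, B a = B b -> x a < x b -> y a <= y b) ->
  (forall a b, B a = B b -> x a = x b -> a = b) ->
  (forall a, B (w a) = B a) ->
  \sum_a x (w a) * y a <= \sum_a x a * y a /\
  (\sum_a x (w a) * y a = \sum_a x a * y a -> forall a, y (w a) = y a).
Proof.
move=> hxy hinj; have [m] := ubnP #|[pred a | w a != a]|; elim: m w => // m IH w lem hw.
have [/existsP[a0 ma0]|/existsPn fixw] := boolP [exists a, w a != a]; last first.
  have fw a : w a = a by apply/eqP; have := fixw a; rewrite negbK.
  by split=> [|_ a]; rewrite ?fw //; apply: ler_sum => a _; rewrite fw.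
have [b0 mb0' max0'] := @Order.TotalTheory.arg_maxP _ _ _ a0 (fun a => w a != a) x ma0.
have max0 a : w a != a -> x a <= x b0 := max0' a.
have mb0 : w b0 != b0 := mb0'.
pose b2 := w b0; pose b1 := (w^-1)%g b0.
have wb1 : w b1 = b0 by rewrite permKV.
have n10 : b1 != b0 by apply: contraNneq mb0 => e; rewrite -{1}e wb1.
pose w' := (w * tperm b0 b2)%g.
have w'0 : w' b0 = b0 by rewrite permM tpermR.
have w'1 : w' b1 = b2 by rewrite permM wb1 tpermL.
have w'o a : a != b0 -> a != b1 -> w' a = w a.
  by move=> h0 h1; rewrite permM tpermD // -?wb1 (inj_eq perm_inj) eq_sym.
have B2 : B b2 = B b0 by rewrite hw.
have B1 : B b1 = B b0 by rewrite -wb1 hw.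
have hw' a : B (w' a) = B a by rewrite permM -(hw a); case: tpermP => [->|->|].
have x2 : x b2 < x b0.
  rewrite lt_neqAle max0 ?andbT; last by rewrite (inj_eq perm_inj).
  by apply: contraNneq mb0 => e; apply/eqP/(hinj _ _ (hw _)).
have y1 : y b1 <= y b0.
  apply: hxy => //; rewrite lt_neqAle max0 ?andbT; last by rewrite wb1 eq_sym.
  by apply: contraNneq n10 => e; apply/eqP/hinj.
have lt' : (#|[pred a | w' a != a]| < m)%N.
  rewrite ltnS in lem; apply: leq_trans lem; apply: proper_card; apply/properP; split.
    apply/subsetP => a; rewrite !inE; have [->|n0] := eqVneq a b0; first by rewrite w'0 eqxx.
    by have [->|n1] := eqVneq a b1; [rewrite wb1 [b0 == _]eq_sym n10|rewrite w'o].
  by exists b0; rewrite inE // w'0 eqxx.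
have [h1 h2] := IH w' lt' hw'.
have d : \sum_a x (w' a) * y a - \sum_a x (w a) * y a = (x b0 - x b2) * (y b0 - y b1).
  rewrite (sumB_two_terms (s := b0) (s' := b1)) 1?eq_sym //; last by move=> z z0 z1; rewrite w'o.
  by rewrite w'0 w'1 wb1 -/b2; ring.
have dge : 0 <= \sum_a x (w' a) * y a - \sum_a x (w a) * y a.
  by rewrite d mulr_ge0 // subr_ge0 // ltW.
split; first by apply: le_trans h1; rewrite -subr_ge0.
move=> e; have e' : \sum_a x (w' a) * y a = \sum_a x a * y a.
  by apply/eqP; rewrite eq_le h1 -e -subr_ge0.
have yw' := h2 e'; have : (x b0 - x b2) * (y b0 - y b1) == 0 by rewrite -d e e' subrr.
rewrite mulf_eq0 !subr_eq0 (gt_eqF x2) /= => /eqP y01 a.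
have [->|n0] := eqVneq a b0; first by rewrite -/b2 -w'1 yw' y01.
by have [->|n1] := eqVneq a b1; [rewrite wb1|rewrite -w'o].
Qed.

(** Applying [rearrangement] to w with y' and to its inverse with y gives opposite inequalities
    between the same two sums. The equality case and strict monotonicity then leave no room for w to
    move anything. *)
Lemma strict_rearrangement (T : finType) (B : T -> nat) (x y y' : T -> int) (w : {perm T}) :
  (forall a, y' a = y (w a)) ->
  (forall a b, B a = B b -> x a < x b -> y a < y b) ->
  (forall a b, B a = B b -> x a < x b -> y' a < y' b) ->
  (forall a b, B a = B b -> x a = x b -> a = b) ->
  (forall a, B (w a) = B a) -> w = 1%g.
Proof.
move=> yw hy hy' hinj hw.
have hw' a : B ((w^-1)%g a) = B a by rewrite -hw permKV.
have [||| h1 h2] := @rearrangement T B x y (w^-1)%g => //.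
  by move=> a b e /(hy _ _ e)/ltW.
have [||| h3 h4] := @rearrangement T B x y' w => //.
  by move=> a b e /(hy' _ _ e)/ltW.
have e1 : \sum_a x ((w^-1)%g a) * y a = \sum_a x a * y' a.
  by rewrite (reindex_inj (@perm_inj _ w)); apply: eq_bigr => a _; rewrite permK yw.
have e2 : \sum_a x (w a) * y' a = \sum_a x a * y a.
  by rewrite [RHS](reindex_inj (@perm_inj _ w)); apply: eq_bigr => a _; rewrite yw.
rewrite e1 in h1 h2; rewrite e2 in h3 h4.
have e : \sum_a x a * y' a = \sum_a x a * y a by apply/eqP; rewrite eq_le h1 h3.
apply/permP => a; rewrite perm1; apply: hinj; rewrite ?hw //.
apply/eqP; rewrite eq_le; apply/andP; split; rewrite leNgt; apply/negP => /hy' h.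
  by have := h4 (esym e) a; move: (h (esym (hw a))) => /lt_eqF + e3; rewrite e3 eqxx.
by have := h4 (esym e) a; move: (h (hw a)) => /lt_eqF + e3; rewrite e3 eqxx.
Qed.

Section Pictures.
Variables (k : fieldType) (I : finType) (m K : nat) (r1 c1 r2 c2 : I -> nat).
Hypothesis hk : [pchar k] =i pred0.
Hypothesis sh1 : is_shape r1 c1.
Hypothesis sh2 : is_shape r2 c2.
Hypothesis c1K : forall z, (c1 z < K)%N.
Hypothesis c2K : forall z, (c2 z < K)%N.
Hypothesis r2K : forall z, (r2 z < K)%N.

(** The placement into the first diagram is normalised to the identity, the second component is the
    placement into the second one. Labels start at 0 here, one below the tableau entries. *)
Definition labelling := ({ffun I -> 'I_m} * {perm I})%type.
Implicit Types p q : labelling.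

Definition label_of p (a : I) : nat := p.1 a.

(** Only the triples (label, row, row) up to renaming of strands matter. Products of matrix entries
    and the test functions [probe] are both of this kind. *)
Definition perm_invariant (F : {ffun I -> 'I_m * nat * nat} -> k) :=
  forall (g : {perm I}) (f : {ffun I -> 'I_m * nat * nat}), F [ffun a => f (g a)] = F f.

Definition labelled_sum (F : {ffun I -> 'I_m * nat * nat} -> k) p : k :=
  \sum_(s | stab c1 s) \sum_(t | stab c2 t) (-1) ^+ s * (-1) ^+ t *
    F [ffun a => (p.1 a, r1 (s a), r2 (t (p.2 a)))].

Definition is_picture p : bool := good K (label_of p) r1 c1 r2 c2 1%g p.2.

Lemma is_picture_halves p : is_picture p ->
  half_picture K (label_of p) r1 c1 (fun a => r2 (p.2 a)) (fun a => c2 (p.2 a)) /\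
  half_picture K (label_of p) (fun a => r2 (p.2 a)) (fun a => c2 (p.2 a)) r1 c1.
Proof.
move=> /andP[/andP[/forallP cs1 /forallP rs1] /andP[/forallP cs2 /forallP rs2]].
split; split=> //.
- move=> a b e lt; have := forallP (cs1 a) b; rewrite !perm1 e eqxx lt /= => /orP[|/andP[/eqP h1 h2]]; by [left|right].
- by move=> a b e ec; have := forallP (rs1 a) b; rewrite !perm1 e ec !eqxx.
- split=> [a|a|a b e1 e2|a i j hi hj].
  + exact: shape_row sh2 _.
  + exact: shape_col sh2 _.
  + by apply: (@perm_inj _ p.2); apply: (shape_inj sh2).
  + have [z [z1 z2]] := shape_closed sh2 hi hj; exists ((p.2^-1)%g z); by rewrite permKV.
- move=> a b e lt; have := forallP (cs2 a) b; rewrite !perm1 e eqxx lt /key /= !perm1.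
  by move=> /orP[|/andP[/eqP h1 h2]]; [left|right].
- by move=> a b e ec; have := forallP (rs2 a) b; rewrite /key !perm1 e ec !eqxx.
Qed.

Lemma labelled_sum_straightening p : exists z : labelling -> k, (forall q, z q != 0 -> is_picture q) /\
  forall F, perm_invariant F -> labelled_sum F p = \sum_q z q * labelled_sum F q.
Proof.
have [z [z1 z2]] := straightening (label_of p) hk sh1 sh2 c1K c2K 1%g p.2.
(* Renames the strands so that the first placement becomes the identity again. *)
pose conv (xy : {perm I} * {perm I}) : labelling := ([ffun a => p.1 ((xy.1^-1)%g a)], (xy.1^-1 * xy.2)%g).
have convP x y : good K (label_of p) r1 c1 r2 c2 x y -> is_picture (conv (x, y)).
  move=> /andP[/andP[/forallP cs1 /forallP rs1] /andP[/forallP cs2 /forallP rs2]].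
  have h1 a := forallP (cs1 ((x^-1)%g a)).
  apply/andP; split; apply/andP; split; apply/forallP => a; apply/forallP => b; rewrite /key /label_of /= !ffunE !perm1 !permM.
  - by have := forallP (cs1 ((x^-1)%g a)) ((x^-1)%g b); rewrite !permKV.
  - by have := forallP (rs1 ((x^-1)%g a)) ((x^-1)%g b); rewrite !permKV.
  - by have := forallP (cs2 ((x^-1)%g a)) ((x^-1)%g b); rewrite /key !permKV.
  - by have := forallP (rs2 ((x^-1)%g a)) ((x^-1)%g b); rewrite /key !permKV.
exists (fun q => \sum_(xy | conv xy == q) z xy); split.
  move=> q nz; have [/existsP[[x y] /andP[/eqP <- h]]|/existsPn h] := boolP [exists xy, (conv xy == q) && (z xy != 0)].
    exact/convP/(z1 (x, y)).
  case/eqP: nz; apply: big1 => xy e; apply/eqP; have := h xy; by rewrite e /= negbK.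
move=> F hF.
pose E (i j : {ffun I -> nat}) := F [ffun s => (p.1 s, i s, j s)].
have hE : label_invariant (label_of p) E.
  move=> h i j hh; rewrite /E -[RHS](hF h); congr F; apply/ffunP => s; rewrite !ffunE.
  by congr (_, _, _); apply: val_inj; rewrite /= -[LHS]hh.
have conv_usum xy : altsum r1 c1 r2 c2 E xy.1 xy.2 = labelled_sum F (conv xy).
  apply: eq_bigr => s _; apply: eq_bigr => t _; congr (_ * _); rewrite /E -(hF (xy.1^-1)%g).
  by congr F; apply/ffunP => a; rewrite !ffunE /= permM permKV.
have -> : labelled_sum F p = altsum r1 c1 r2 c2 E 1%g p.2.
  apply: eq_bigr => s _; apply: eq_bigr => t _; congr (_ * _).
  by congr F; apply/ffunP => a; rewrite !ffunE perm1.
rewrite z2 //; under [RHS]eq_bigr => q _ do rewrite mulr_suml.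
rewrite (exchange_big_dep xpredT) //=; apply: eq_bigr => xy _.
by rewrite (big_pred1 (conv xy)) ?conv_usum // => q; rewrite eq_sym.
Qed.

(** Orders by label and then by the row in the second diagram, which is the entry of the special
    tableau of that label. *)
Definition entry_key p (a : I) : int := (K * label_of p a)%:Z + (r2 (p.2 a))%:Z.

Lemma entry_key_inj p p' a b : entry_key p a = entry_key p' b -> label_of p a = label_of p' b /\ r2 (p.2 a) = r2 (p'.2 b).
Proof.
have ha := r2K (p.2 a); have hb := r2K (p'.2 b); rewrite /entry_key => e.
have [] := @key_inj K (label_of p' b) (label_of p a) (r2 (p.2 a)) (r2 (p'.2 b)) ha hb; first by lia.
by move=> -> ->.
Qed.

Lemma entry_key_le p p' a b : (label_of p a < label_of p' b)%N \/ (label_of p a = label_of p' b /\ (r2 (p.2 a) <= r2 (p'.2 b))%N) ->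
  entry_key p a <= entry_key p' b.
Proof.
have ha := r2K (p.2 a); rewrite /entry_key => -[h|[-> h]]; last by lia.
have : (K * (label_of p a).+1 <= K * label_of p' b)%N by rewrite leq_mul2l h orbT.
by rewrite mulnS; lia.
Qed.

Lemma picture_entry_key_lt p a b : is_picture p -> c1 a = c1 b -> (r1 a < r1 b)%N -> entry_key p a < entry_key p b.
Proof.
move=> /is_picture_halves[H1 H2] e lt; have := picture_label_col H1 H2 e (ltnW lt).
rewrite leq_eqVlt => /orP[/eqP eq|h].
  by have [lt2 _] := picture_admissible H2 H1 eq e lt; rewrite /entry_key eq; lia.
have ha := r2K (p.2 a); rewrite /entry_key.
have : (K * (label_of p a).+1 <= K * label_of p b)%N by rewrite leq_mul2l h orbT.
by rewrite mulnS; lia.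
Qed.

(** In every row of the second diagram the keys strictly increase from left to right, which forces
    the order of the strands of that row; [strict_rearrangement] with the rows as blocks makes this
    precise. *)
Lemma picture_eq p p' : is_picture p -> is_picture p' -> p.1 = p'.1 ->
  (forall a, r2 (p.2 a) = r2 (p'.2 a)) -> p = p'.
Proof.
move=> /is_picture_halves[_ H] /is_picture_halves[_ H'] eQ ej.
have lE : label_of p = label_of p' by rewrite /label_of eQ.
suff e : (p'.2^-1 * p.2)%g = 1%g.
  by case: p p' eQ e {H H' ej lE} => [Q al] [Q' al'] /= -> e; congr (_, _); rewrite -[al](mulKVg al') e mulg1.
apply: (strict_rearrangement (B := r2) (x := fun z => (c2 z)%:Z) (y := fun z => pkey K (label_of p) c1 ((p.2^-1)%g z))
   (y' := fun z => pkey K (label_of p) c1 ((p'.2^-1)%g z))).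
- by move=> a; rewrite permM permK.
- by move=> a b e lt; apply: (hp_row_strict H); rewrite !permKV //; lia.
- by move=> a b e lt; rewrite lE; apply: (hp_row_strict H'); rewrite !permKV //; lia.
- by move=> a b e1 /eqP; rewrite eqz_nat => /eqP e2; apply: (shape_inj sh2).
- by move=> a; rewrite permM ej permKV.
Qed.

Record is_rep p (al : {perm I}) : Prop := IsRep {
  rep_row : forall a, r2 (al a) = r2 (p.2 a);
  rep_label : forall a b, c2 (al a) = c2 (al b) -> (r2 (al a) <= r2 (al b))%N -> (label_of p a <= label_of p b)%N;
  rep_col : forall a b, label_of p a = label_of p b -> c2 (al a) = c2 (al b) -> (r2 (al a) < r2 (al b))%N -> (c1 b <= c1 a)%N }.

(* Chosen so that passing from a picture to any picture that contributes to    *)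
(* the expansion of its representative can only increase it: see              *)
(* [col_rearrangement] and [row_rearrangement].                                *)
Definition stat p : int := \sum_a ((c1 a)%:Z * entry_key p a - (K * label_of p a)%:Z * (r2 (p.2 a))%:Z).

Section Term.
Variables (p p' : labelling) (al s t g : {perm I}).
Hypothesis hp : is_picture p.
Hypothesis hp' : is_picture p'.
Hypothesis hal : is_rep p al.
Hypothesis hs : stab c1 s.
Hypothesis ht : stab c2 t.
Hypothesis gQ : forall a, p.1 a = p'.1 (g a).
Hypothesis gr : forall a, r1 (s a) = r1 (g a).
Hypothesis gj : forall a, r2 (t (al a)) = r2 (p'.2 (g a)).

Let phi (a : I) : int := (c1 a)%:Z - (K * label_of p a)%:Z.
Let mid : int := \sum_a ((c1 a)%:Z * (K * label_of p a)%:Z + (r2 (t (al a)))%:Z * phi a).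
Let rho := (s^-1 * g)%g.

(** In a row of the first diagram the picture p' has weakly increasing [entry_key]
    ([picture_row_weak] within a label), and [rho] preserves these rows. So [mid] is a rearranged
    version of [stat p']. *)
Lemma row_rearrangement : mid <= stat p' /\ (mid = stat p' -> forall b, entry_key p' (rho b) = entry_key p' b).
Proof.
have [H1 H2] := is_picture_halves hp'.
have [||| h1 h2] := @rearrangement I r1 (fun b => (c1 b)%:Z) (entry_key p') (rho^-1)%g.
- move=> a b e lt; apply: entry_key_le; have lt' : (c1 a <= c1 b)%N by lia.
  have := picture_label_row H1 H2 e lt'; rewrite leq_eqVlt => /orP[/eqP eq|]; last by left.
  by right; split=> //; apply: (picture_row_weak H1 H2).
- by move=> a b e1 /eqP; rewrite eqz_nat => /eqP e2; apply: (shape_inj sh1).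
- by move=> b; rewrite -{2}(permKV rho b) [in RHS]permM -gr permKV.
have e1 : \sum_b (c1 ((rho^-1)%g b))%:Z * entry_key p' b = \sum_a (c1 a)%:Z * entry_key p' (g a).
  rewrite (reindex_inj (@perm_inj _ g)) /=; apply: eq_bigr => a _.
  by rewrite invMg invgK permM permK (eqP (forallP hs a)).
have e2 : mid = \sum_a (c1 a)%:Z * entry_key p' (g a) - \sum_a (K * label_of p' a)%:Z * (r2 (p'.2 a))%:Z.
  rewrite [X in _ - X](reindex_inj (@perm_inj _ g)) -sumrB; apply: eq_bigr => a _.
  by rewrite /phi gj /entry_key /label_of gQ; ring.
rewrite e2 /stat sumrB -e1 lerD2r; split=> // e b; apply/esym.
rewrite -{1}(permK rho b); apply: h2; apply: (addIr _ e).
Qed.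

(** Down a column of the second diagram [phi] weakly decreases along [al]: labels increase by
    [rep_label], and within a label columns move left by [rep_col]. Permuting such columns by t can
    only raise the pairing with the rows. *)
Lemma col_rearrangement : stat p <= mid /\ (stat p = mid -> forall a, phi ((al^-1)%g (t (al a))) = phi a).
Proof.
have [||| h1 h2] := @rearrangement I c2 (fun b => (r2 b)%:Z) (fun z => - phi ((al^-1)%g z)) t.
- move=> a b e lt; rewrite lerN2 /phi; set a' := (al^-1)%g a; set b' := (al^-1)%g b.
  have ea : a = al a' by rewrite permKV.
  have eb : b = al b' by rewrite permKV.
  have lt' : (r2 (al a') < r2 (al b'))%N by rewrite -ea -eb; lia.
  have := rep_label hal (a := a') (b := b'); rewrite -ea -eb => /(_ e) le.
  have {le} : (label_of p a' <= label_of p b')%N by apply: le; lia.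
  rewrite leq_eqVlt => /orP[/eqP eq|h].
    by have := rep_col hal eq; rewrite -ea -eb => /(_ e); rewrite eq; lia.
  have : (K * (label_of p a').+1 <= K * label_of p b')%N by rewrite leq_mul2l h orbT.
  by have := c1K b'; rewrite mulnS; lia.
- by move=> a b e1 /eqP; rewrite eqz_nat => /eqP e2; apply: (shape_inj sh2).
- by move=> z; apply/eqP; exact: forallP ht z.
have e0 (x : I -> int) : \sum_z x z * - phi ((al^-1)%g z) = - \sum_a x (al a) * phi a.
  rewrite (reindex_inj (@perm_inj _ al)) -sumrN; apply: eq_bigr => a _; by rewrite permK mulrN.
have e1 : stat p = \sum_a (c1 a)%:Z * (K * label_of p a)%:Z + \sum_a (r2 (al a))%:Z * phi a.
  rewrite -big_split; apply: eq_bigr => a _; rewrite /entry_key /phi (rep_row hal) /=; ring.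
rewrite e1 /mid big_split /= lerD2l; rewrite !e0 lerN2 in h1; split=> // /addrI e a.
have := h2 _ (al a); rewrite permK => h; apply: oppr_inj; apply: h.
by rewrite !e0 -e.
Qed.

Lemma term_stat_le : stat p <= stat p'.
Proof. exact: le_trans col_rearrangement.1 row_rearrangement.1. Qed.

(** Equality in both inequalities makes the conjugate [th] of t by [al] preserve labels and first
    columns, and match the entry keys of p and p' through s. Both keys strictly increase down the
    columns of the first diagram, so s = [th]. Then s and t are conjugate, their signs cancel, and
    the pictures coincide by [picture_eq]. *)
Lemma term_stat_eq : stat p = stat p' -> p = p' /\ (-1) ^+ s * (-1) ^+ t = 1 :> k.
Proof.
move=> e; have m1 : stat p = mid by apply/eqP; rewrite eq_le col_rearrangement.1 e row_rearrangement.1.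
have hphi := col_rearrangement.2 m1; have hrho := row_rearrangement.2 (etrans (esym m1) e).
pose th := (al * t * al^-1)%g.
have thE a : th a = (al^-1)%g (t (al a)) by rewrite !permM.
have thP a : label_of p (th a) = label_of p a /\ c1 (th a) = c1 a.
  have := hphi a; rewrite -thE /phi => e2.
  by apply: (@key_inj K _ _ (c1 (th a)) (c1 a)) => //; lia.
have keyE a : entry_key p (th a) = entry_key p' (s a).
  have e1 : rho (s a) = g a by rewrite permM permK.
  have e2 : al (th a) = t (al a) by rewrite thE permKV.
  by rewrite -hrho e1 /entry_key (thP a).1 -(rep_row hal) e2 gj /label_of gQ.
have om : (th^-1 * s)%g = 1%g.
  apply: (strict_rearrangement (B := c1) (x := fun z => (r1 z)%:Z) (y := entry_key p') (y' := entry_key p)).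
  - by move=> a; rewrite permM -keyE permKV.
  - by move=> a b ec lt; apply: picture_entry_key_lt => //; lia.
  - by move=> a b ec lt; apply: picture_entry_key_lt => //; lia.
  - by move=> a b e1 /eqP; rewrite eqz_nat => /eqP e2; apply: (shape_inj sh1).
  - by move=> a; rewrite permM (eqP (forallP hs _)) -(thP ((th^-1)%g a)).2 permKV.
have sth : s = th by rewrite -[s](mulKVg th) om mulg1.
split.
  have key_eq a : entry_key p a = entry_key p' a.
    by have := keyE ((th^-1)%g a); rewrite sth permKV.
  apply: picture_eq => //; last by move=> a; case: (entry_key_inj (key_eq a)).
  by apply/ffunP => a; apply: val_inj; case: (entry_key_inj (key_eq a)).
by rewrite sth /th !odd_permM odd_permV addbAC addbb addFb -expr2 sqrr_sign.
Qed.

End Term.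

(** Test function detecting the index pattern of p' up to renaming of strands; applied to
    [labelled_sum] it reads off the coefficient of that pattern. *)
Definition probe p' (f : {ffun I -> 'I_m * nat * nat}) : k :=
  [exists g : {perm I}, f == [ffun a => (p'.1 (g a), r1 (g a), r2 (p'.2 (g a)))]]%:R.

Lemma probe_invariant p' : perm_invariant (probe p').
Proof.
move=> h f; rewrite /probe; congr (nat_of_bool _)%:R; apply/existsP/existsP => -[g /eqP e].
  exists (h^-1 * g)%g; apply/eqP/ffunP => a.
  by have := congr1 (fun F : {ffun I -> 'I_m * nat * nat} => F ((h^-1)%g a)) e; rewrite !ffunE permKV permM.
by exists (h * g)%g; rewrite e; apply/eqP/ffunP => a; rewrite !ffunE permM.
Qed.

Lemma probe_term p p' al s t : is_picture p -> is_picture p' -> is_rep p al -> stab c1 s -> stab c2 t ->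
  probe p' [ffun a => (p.1 a, r1 (s a), r2 (t (al a)))] != 0 ->
  stat p <= stat p' /\ (stat p = stat p' -> p = p' /\ (-1) ^+ s * (-1) ^+ t = 1 :> k).
Proof.
move=> hp hp' hal hs ht; rewrite /probe; case: existsP => [[g /eqP/ffunP e] _|_]; last by rewrite eqxx.
have e3 a : (p.1 a, r1 (s a), r2 (t (al a))) = (p'.1 (g a), r1 (g a), r2 (p'.2 (g a))).
  by have := e a; rewrite !ffunE.
by split; [apply: (term_stat_le _ _ hal hs ht (g := g))|apply: (term_stat_eq _ _ hal hs ht (g := g))] => // a; case: (e3 a).
Qed.

Lemma probe_neq0 p p' al : is_picture p -> is_picture p' -> is_rep p al ->
  labelled_sum (probe p') (p.1, al) != 0 -> stat p <= stat p' /\ (stat p = stat p' -> p = p').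
Proof.
move=> hp hp' hal nz; have [[s t]|] := pickP [pred st | [&& stab c1 st.1, stab c2 st.2 &
  probe p' [ffun a => (p.1 a, r1 (st.1 a), r2 (st.2 (al a)))] != 0]].
  by case/and3P => /= hs ht /(probe_term hp hp' hal hs ht)[h1 h2]; split=> // /h2[].
move=> none; case/eqP: nz; apply: big1 => s hs; apply: big1 => t ht.
by have := none (s, t); rewrite /= hs ht /= => /negbFE/eqP ->; rewrite mulr0.
Qed.

(** By [term_stat_eq] all nonzero terms have sign +1 and the identity pair is one of them, so the
    value is a positive integer, nonzero in characteristic 0. *)
Lemma probe_diag p al : is_picture p -> is_rep p al -> labelled_sum (probe p) (p.1, al) != 0.
Proof.
move=> hp hal; pose N (s t : {perm I}) : nat :=
  [exists g : {perm I}, [ffun a => (p.1 a, r1 (s a), r2 (t (al a)))] ==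
    [ffun a => (p.1 (g a), r1 (g a), r2 (p.2 (g a)))]].
have -> : labelled_sum (probe p) (p.1, al) = (\sum_(s : {perm I} | stab c1 s) \sum_(t : {perm I} | stab c2 t) N s t)%:R.
  rewrite natr_sum; apply: eq_bigr => s hs; rewrite natr_sum; apply: eq_bigr => t ht.
  rewrite -/(probe p _); have [->|nz] := eqVneq (probe p [ffun a => (p.1 a, r1 (s a), r2 (t (al a)))]) 0.
    by rewrite mulr0.
  by have [_ /(_ erefl)[_ ->]] := probe_term hp hp hal hs ht nz; rewrite mul1r.
rewrite natf_neq0_char0 // (bigD1 1%g) ?stab_one //= (bigD1 1%g) ?stab_one //=.
suff -> : N 1%g 1%g = 1%N by [].
rewrite /N; case: existsP => // -[]; exists 1%g; apply/eqP/ffunP => a; rewrite !ffunE !perm1.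
by rewrite (rep_row hal).
Qed.

Theorem representatives_span (rep : labelling -> {perm I}) : (forall p, is_picture p -> is_rep p (rep p)) ->
  forall p0, exists z : labelling -> k, (forall q, z q != 0 -> is_picture q) /\
    forall F, perm_invariant F -> labelled_sum F p0 = \sum_q z q * labelled_sum F (q.1, rep q).
Proof.
move=> hrep p0; pose T := {q : labelling | is_picture q}; pose N := #|{: T}|.
pose pic (i : 'I_N) : labelling := val (enum_val i).
have picP i : is_picture (pic i) := valP (enum_val i).
have pic_inj : injective pic by move=> i j /val_inj/enum_val_inj.
have sum_pic (G : labelling -> k) : (forall q, ~~ is_picture q -> G q = 0) -> \sum_q G q = \sum_i G (pic i).
  move=> hG; rewrite (bigID is_picture) /= [X in _ + X]big1 ?addr0; last by [].
  have -> : \sum_i G (pic i) = \sum_(x : T) G (val x).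
    by rewrite (reindex (@enum_val _ {: T})) //=; exists enum_rank => x _; [exact: enum_valK|exact: enum_rankK].
  exact: big_sub.
have [Z ZP] : exists Z : labelling -> labelling -> k, forall p, (forall q, Z p q != 0 -> is_picture q) /\
  forall F, perm_invariant F -> labelled_sum F p = \sum_q Z p q * labelled_sum F q.
  exact: fin_all_exists labelled_sum_straightening.
pose vec F : 'cV[k]_N := \col_i labelled_sum F (pic i).
pose M : 'M[k]_N := \matrix_(i, j) Z ((pic i).1, rep (pic i)) (pic j).
pose R F : 'cV[k]_N := \col_i labelled_sum F ((pic i).1, rep (pic i)).
have expand F p : perm_invariant F -> labelled_sum F p = \sum_i Z p (pic i) * labelled_sum F (pic i).
  move=> hF; rewrite (ZP p).2 // sum_pic // => q nq; have [->|/(ZP p).1 h] := eqVneq (Z p q) 0; first by rewrite mul0r.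
  by rewrite h in nq.
have MR F : perm_invariant F -> M *m vec F = R F.
  move=> hF; apply/colP => i; rewrite !mxE expand //; apply: eq_bigr => j _; by rewrite !mxE.
(* A row vector killed by M is a relation among representatives valid for every F. Testing it with
   the probe of the picture of least [stat] in its support leaves only the diagonal term, which is
   nonzero. Linear independence of the pictures never enters. *)
have Mu : M \in unitmx.
  rewrite -row_free_unit; apply: inj_row_free => x xM0.
  have combE F : perm_invariant F -> \sum_i x 0 i * labelled_sum F ((pic i).1, rep (pic i)) = 0.
    move=> hF; have := mulmxA x M (vec F); rewrite xM0 mul0mx MR // => /matrixP/(_ 0 0); rewrite !mxE => e.
    by rewrite -[RHS]e; apply: eq_bigr => i _; rewrite !mxE.
  apply/eqP/negPn/negP => /rV0Pn[i0 nz0].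
  have [i1 nz1 min1] := @Order.TotalTheory.arg_minP _ _ _ i0 (fun i => x 0 i != 0) (fun i => stat (pic i)) nz0.
  have := combE _ (probe_invariant (pic i1)); rewrite (bigD1 i1) //= big1 ?addr0 => [|i ne].
    by move/eqP; rewrite mulf_eq0 (negbTE nz1) (negbTE (probe_diag (picP i1) (hrep _ (picP i1)))).
  have [->|nzi] := eqVneq (x 0 i) 0; first by rewrite mul0r.
  have [->|nzu] := eqVneq (labelled_sum (probe (pic i1)) ((pic i).1, rep (pic i))) 0; first by rewrite mulr0.
  have [le1 eq1] := probe_neq0 (picP i) (picP i1) (hrep _ (picP i)) nzu.
  by case/eqP: ne; apply/pic_inj/eq1/eqP; rewrite eq_le le1; exact: min1.
pose y : 'rV[k]_N := (\row_i Z p0 (pic i)) *m invmx M.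
exists (fun q => \sum_(i | pic i == q) y 0 i); split.
  move=> q; have [/existsP[i /eqP <-] //|/existsPn none] := boolP [exists i, pic i == q].
  by rewrite big_pred0 ?eqxx // => i; apply/negbTE/none.
move=> F hF; rewrite expand //.
have -> : \sum_i Z p0 (pic i) * labelled_sum F (pic i) = ((\row_i Z p0 (pic i)) *m vec F) 0 0.
  by rewrite mxE; apply: eq_bigr => i _; rewrite !mxE.
have -> : (\row_i Z p0 (pic i)) *m vec F = y *m R F.
  by rewrite /y -mulmxA -MR // mulKmx.
rewrite mxE; under [RHS]eq_bigr => q _ do rewrite mulr_suml.
rewrite (exchange_big_dep xpredT) //=; apply: eq_bigr => i _.
by rewrite (big_pred1 (pic i)) ?mxE // => q; rewrite eq_sym.
Qed.

End Pictures.

(** * Alternating monomials are highest weight functions *)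

Section Alternation.
Variables (k : fieldType) (I : finType) (N : nat) (c : I -> nat) (rho : I -> 'I_N) (w : 'I_N -> nat) (B : 'M[k]_N).
Hypothesis hk : [pchar k] =i pred0.
Hypothesis w_inj : injective w.
Hypothesis rho_closed : forall h l, (w (rho h) <= w l)%N -> exists h', c h' = c h /\ rho h' = l.
Hypothesis B_diag : forall i, B i i = 1.
Hypothesis B_tri : forall i l, B i l != 0 -> (w i <= w l)%N.

(* If f is injective on columns, the two sums agree term by term: a nonzero    *)
(* term forces f h >= rho (p h), hence f = rho o g for a column permutation g,  *)
(* and the sums over all boxes are equal.                                      *)
Lemma column_determinant (f : I -> 'I_N) :
  \sum_(p | stab c p) (-1) ^+ p * \prod_h B (rho (p h)) (f h) =
  \sum_(p | stab c p) (-1) ^+ p * \prod_h (rho (p h) == f h)%:R.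
Proof.
have [/existsP[a /existsP[b /and3P[ab /eqP cab /eqP fab]]]|/existsPn finj] :=
    boolP [exists a, exists b, [&& a != b, c a == c b & f a == f b]].
  have vanish (A : I -> 'I_N -> k) : \sum_(p | stab c p) (-1) ^+ p * \prod_h A (p h) (f h) = 0.
    set Z := LHS; apply: (eq_oppr_eq0 hk).
    rewrite {1}/Z (reindex_inj (mulgI (tperm a b))) /= -sumrN; apply: eq_big => p.
      by rewrite stab_mulr // stab_tperm.
    move=> _; rewrite odd_permM odd_tperm ab addTb signrN mulNr; congr (- (_ * _)).
    rewrite (reindex_inj (@perm_inj _ (tperm a b))) /=; apply: eq_bigr => h _.
    by rewrite permM tpermK; congr A; case: tpermP => [->|->|].
  by rewrite (vanish (fun x l => B (rho x) l)) (vanish (fun x l => (rho x == l)%:R)).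
have f_inj h h' : c h = c h' -> f h = f h' -> h = h'.
  move=> e1 e2; apply/eqP; apply: contraT => ne; have := finj h => /existsPn/(_ h').
  by rewrite ne e1 e2 !eqxx.
apply: eq_bigr => p /forallP hp; congr (_ * _).
have [/forallP fp|] := boolP [forall h, rho (p h) == f h].
  by rewrite !big1 // => h _; rewrite (eqP (fp h)) ?eqxx ?B_diag.
move=> nf; transitivity (0 : k); last first.
  move: nf => /forallPn[h /negbTE nh]; by rewrite (bigD1 h) //= nh mul0r.
apply/eqP; apply: contraNT nf => /prodf_neq0 nz.
have le h : (w (rho (p h)) <= w (f h))%N by exact: (B_tri (nz h isT)).
have [g gP] : exists g : I -> I, forall h, c (g h) = c h /\ rho (g h) = f h.
  apply: (@fin_all_exists _ (fun=> I) (fun h u => c u = c h /\ rho u = f h)) => h; have [h' [e1 e2]] := rho_closed (le h).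
  by exists h'; rewrite e1 (eqP (hp h)).
have g_inj : injective g.
  by move=> h h' e; apply: f_inj; [rewrite -(gP h).1 e (gP h').1|rewrite -(gP h).2 e (gP h').2].
have sum_eq : (\sum_h w (rho (p h)) = \sum_h w (f h))%N.
  have e (x : I -> I) : injective x -> (\sum_h w (rho (x h)) = \sum_h w (rho h))%N.
    by move=> hx; rewrite [RHS](reindex_inj hx).
  by rewrite (e _ (@perm_inj _ p)) -(e _ g_inj); apply: eq_bigr => h _; rewrite (gP h).2.
apply/forallP => h; apply/eqP/w_inj/eqP; rewrite eqn_leq le /=.
have : (\sum_(h' | h' != h) w (rho (p h')) <= \sum_(h' | h' != h) w (f h'))%N by apply: leq_sum.
by move: sum_eq; rewrite (bigD1 h) //= [X in _ = X](bigD1 h) //=; lia.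
Qed.

(** Expanding the matrix product over the intermediate indices f isolates the sums of
    [column_determinant], which do not distinguish B from the identity. *)
Lemma alternating_mulmx (M : I -> 'M[k]_N) (j : I -> 'I_N) :
  \sum_(p | stab c p) (-1) ^+ p * \prod_h (B *m M h) (rho (p h)) (j h) =
  \sum_(p | stab c p) (-1) ^+ p * \prod_h M h (rho (p h)) (j h).
Proof.
have expand (A : 'M[k]_N) : \sum_(p | stab c p) (-1) ^+ p * \prod_h (A *m M h) (rho (p h)) (j h) =
    \sum_(f : {ffun I -> 'I_N}) (\sum_(p | stab c p) (-1) ^+ p * \prod_h A (rho (p h)) (f h)) * \prod_h M h (f h) (j h).
  under eq_bigr => p _.
    under eq_bigr => h _ do rewrite mxE.
    rewrite bigA_distr_bigA mulr_sumr.
    over.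
  rewrite exchange_big; apply: eq_bigr => f _; rewrite mulr_suml; apply: eq_bigr => p _.
  by rewrite big_split /= mulrA.
rewrite expand; under eq_bigr => f _ do rewrite column_determinant.
transitivity (\sum_(p | stab c p) (-1) ^+ p * \prod_h (1%:M *m M h) (rho (p h)) (j h)).
  rewrite expand; apply: eq_bigr => f _; congr (_ * _); apply: eq_bigr => p _; congr (_ * _).
  by apply: eq_bigr => h _; rewrite mxE.
by apply: eq_bigr => p _; congr (_ * _); apply: eq_bigr => h _; rewrite mul1mx.
Qed.

End Alternation.

Section Forward.
Variables (k : fieldType) (n : nat) (I : finType) (r1 c1 r2 c2 : I -> nat) (r s : nat).
Hypothesis hk : [pchar k] =i pred0.
Hypothesis sh1 : is_shape r1 c1.
Hypothesis sh2 : is_shape r2 c2.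
Hypothesis le1 : forall h, (r1 h <= r)%N.
Hypothesis le2 : forall h, (r2 h <= s)%N.
Hypothesis hrs : (r + s <= n.+1)%N.
Hypothesis r_gt0 : (0 < r)%N.
Variables (l : I -> nat) (al : {perm I}).
Local Notation mono := (@alternating_monomial k n I r1 c1 r2 c2 l al).
Local Notation low := (low_index n r1).
Local Notation high := (high_index n r2).

Lemma alternating_monomial_regular : regular mono.
Proof.
apply: regular_sum => p; apply: regular_sum => q; apply: regularM; first exact: regular_const.
by apply: regular_prod => h; exact: regular_expmx.
Qed.

Let antisum (M : I -> 'M[k]_n.+1) :=
  \sum_(p | stab c1 p) \sum_(q | stab c2 q) (-1) ^+ p * (-1) ^+ q * \prod_h M h (low (p h)) (high (q (al h))).

Lemma low_closed h (u : 'I_n.+1) : (low h <= u)%N -> exists h', c1 h' = c1 h /\ low h' = u.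
Proof.
rewrite (low_indexE sh1 hrs r_gt0) => hu.
have [||h' [e1 e2]] := shape_closed sh1 (x := h) (i := (n.+1 - u)%N) (j := c1 h).
- by have := ltn_ord u; lia.
- by rewrite leqnn (shape_col sh1).
exists h'; split=> //; apply: val_inj; rewrite (low_indexE sh1 hrs r_gt0) e1 /=; have := ltn_ord u; lia.
Qed.

Lemma high_closed h (u : 'I_n.+1) : (u <= high h)%N -> exists h', c2 h' = c2 h /\ high h' = u.
Proof.
rewrite (high_indexE le2 hrs r_gt0) => hu.
have [||h' [e1 e2]] := shape_closed sh2 (x := h) (i := u.+1) (j := c2 h).
- by have := shape_row sh2 h; lia.
- by rewrite leqnn (shape_col sh2).
by exists h'; split=> //; apply: val_inj; rewrite (high_indexE le2 hrs r_gt0) e1.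
Qed.

Lemma antisum_mull (B : 'M[k]_n.+1) M : upper_unitriangular B -> antisum (fun h => B *m M h) = antisum M.
Proof.
move=> /andP[tri /forallP dia]; rewrite /antisum exchange_big [RHS]exchange_big /=; apply: eq_bigr => q _.
have := @alternating_mulmx k I n.+1 c1 low (fun u => u) B hk (@ord_inj _) low_closed _ _ M (fun h => high (q (al h))).
have rearr (A : I -> 'M[k]_n.+1) : \sum_(p | stab c1 p) (-1) ^+ p * (-1) ^+ q * \prod_h (A h) (low (p h)) (high (q (al h))) =
  (-1) ^+ q * \sum_(p | stab c1 p) (-1) ^+ p * \prod_h A h (low (p h)) (high (q (al h))).
  by rewrite mulr_sumr; apply: eq_bigr => p _; rewrite mulrA; congr (_ * _); rewrite mulrC.
rewrite !rearr => -> //.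
- by move=> i; apply/eqP/dia.
- move=> i j; rewrite leqNgt; apply: contraNN => lt; move/is_trig_mxP: tri => /(_ j i lt).
  by rewrite mxE => ->.
Qed.

(** Transposition makes the right factor a left one. The index order is reversed by [n - u], so that
    the transposed matrix is triangular in the required sense and the columns of [la] are closed. *)
Lemma antisum_mulr (B : 'M[k]_n.+1) M : upper_unitriangular B -> antisum (fun h => M h *m B) = antisum M.
Proof.
move=> /andP[tri /forallP dia]; rewrite /antisum; apply: eq_bigr => p _.
have := @alternating_mulmx k I n.+1 c2 high (fun u => n - u)%N B^T hk _ _ _ _
  (fun h => (M ((al^-1)%g h))^T) (fun h => low (p ((al^-1)%g h))).
have rearr (A : I -> 'M[k]_n.+1) : \sum_(q | stab c2 q) (-1) ^+ p * (-1) ^+ q * \prod_h (A h) (low (p h)) (high (q (al h))) =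
  (-1) ^+ p * \sum_(q | stab c2 q) (-1) ^+ q * \prod_h (A ((al^-1)%g h))^T (high (q h)) (low (p ((al^-1)%g h))).
  rewrite mulr_sumr; apply: eq_bigr => q _; rewrite mulrA; congr (_ * _).
  by rewrite [RHS](reindex_inj (@perm_inj _ al)); apply: eq_bigr => h _; rewrite mxE permK.
rewrite !rearr => e; congr (_ * _).
under eq_bigr => q _ do under eq_bigr => h _ do rewrite trmx_mul.
apply: e.
- move=> u v e; apply: val_inj; have := ltn_ord u; have := ltn_ord v; rewrite /=; lia.
- move=> h u hu; apply: high_closed; have := ltn_ord u; have := ltn_ord (high h); lia.
- by move=> i; rewrite mxE; apply/eqP/dia.
- move=> i j; rewrite leqNgt; apply: contraNN => lt; move/is_trig_mxP: tri => /(_ i j) h.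
  rewrite -h ?mxE //; have := ltn_ord i; have := ltn_ord j; lia.
Qed.

Lemma unitriangular_unit (S : 'M[k]_n.+1) : upper_unitriangular S -> S \in unitmx.
Proof.
move=> /andP[tri /forallP dia]; rewrite unitmxE -det_tr det_trig // big1 ?unitr1 // => i _.
by rewrite mxE; apply/eqP/dia.
Qed.

Lemma alternating_monomial_U S : upper_unitriangular S -> Defs.act S mono =1 mono.
Proof.
move=> hS X; have uS := unitriangular_unit hS.
have e A : mono A = antisum (fun h => A ^+ l h) by [].
rewrite /Defs.act !e -(antisum_mull _ hS).
transitivity (antisum (fun h => X ^+ l h *m S)); last exact: antisum_mulr.
apply: eq_bigr => p _; apply: eq_bigr => q _; congr (_ * _); apply: eq_bigr => h _.
by rewrite expmx_conj // !mulmxA mulmxV // mul1mx.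
Qed.

Lemma alternating_monomial_torus D : torus D ->
  Defs.act D mono =1 (fun X => (\prod_u D u u ^ weight_at r1 r2 u) * mono X).
Proof.
move=> /andP[/is_diag_mxP dD uD] X.
have D0 u : D u u != 0.
  have : \det D != 0 by rewrite -unitfE -unitmxE.
  have -> : D = diag_mx (\row_i D i i).
    apply/matrixP => i j; rewrite !mxE; case: eqVneq => [->|ne]; rewrite ?mulr1n //.
    by rewrite mulr0n dD.
  by rewrite det_diag => /prodf_neq0/(_ u isT); rewrite mxE !mxE eqxx mulr1n.
have mulD (A : 'M[k]_n.+1) i j : (A *m D) i j = A i j * D j j.
  rewrite mxE (bigD1 j) //= big1 ?addr0 // => u ne; by rewrite dD ?mulr0.
have Dmul (A : 'M[k]_n.+1) i j : (D *m A) i j = D i i * A i j.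
  rewrite mxE (bigD1 i) //= big1 ?addr0 // => u ne; by rewrite dD ?mul0r // eq_sym.
have inv (A : 'M[k]_n.+1) i j : (invmx D *m A *m D) i j = (D i i)^-1 * D j j * A i j.
  rewrite mulD; apply: (mulfI (D0 i)); rewrite mulrA -Dmul mulmxA mulmxV // mul1mx.
  by rewrite !mulrA divff // mul1r mulrC.
have w1 (p : {perm I}) : \prod_h (D (low (p h)) (low (p h)))^-1 = \prod_h (D (low h) (low h))^-1.
  by rewrite [RHS](reindex_inj (@perm_inj _ p)).
have w2 (q : {perm I}) : \prod_h D (high (q (al h))) (high (q (al h))) = \prod_h D (high h) (high h).
  by rewrite [RHS](reindex_inj (@perm_inj _ q)) [RHS](reindex_inj (@perm_inj _ al)).
have -> : \prod_u D u u ^ weight_at r1 r2 u = (\prod_h (D (low h) (low h))^-1) * \prod_h D (high h) (high h).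
  rewrite (partition_big low xpredT) // [X in _ * X](partition_big high xpredT) //= -big_split /=.
  apply: eq_bigr => u _; rewrite /weight_at expfzDr // mulrC -exprz_inv.
  congr (_ * _).
    rewrite (eq_bigr (fun _ => (D u u)^-1)) => [|h /eqP ->] //; rewrite prodr_const -exprnP; congr (_ ^+ _).
    apply: eq_card => h; rewrite !inE [RHS]unfold_in eqnE (low_indexE sh1 hrs r_gt0) /=.
    by apply/eqP/eqP; have := ltn_ord u; have := le1 h; lia.
  rewrite (eq_bigr (fun _ => D u u)) => [|h /eqP ->] //; rewrite prodr_const -exprnP; congr (_ ^+ _).
  apply: eq_card => h; rewrite !inE [RHS]unfold_in eqnE (high_indexE le2 hrs r_gt0) /=.
  by apply/eqP/eqP; have := shape_row sh2 h; lia.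
rewrite /Defs.act mulr_sumr; apply: eq_bigr => p _; rewrite mulr_sumr; apply: eq_bigr => q _.
rewrite mulrCA; congr (_ * _); rewrite -(w1 p) -(w2 q) -!big_split; apply: eq_bigr => h _ /=.
by rewrite expmx_conj // inv.
Qed.

End Forward.

(** * Young diagrams and special tableaux *)

Lemma in_young la (b : nat * nat) : (b \in young la) = (0 < b.1)%N && (0 < b.2 <= nth 0%N la b.1.-1)%N.
Proof.
case: b => i j; rewrite /young in_fset; apply/allpairsPdep/idP => /=.
  by move=> [i' [j' [h1 h2 [-> ->]]]]; move: h1 h2; rewrite !mem_iota; lia.
move=> h; exists i, j; rewrite !mem_iota; split=> //; last by lia.
by have [lt|ge] := ltnP i.-1 (size la); [lia|move: h; rewrite (nth_default _ ge); lia].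
Qed.

Lemma young_row_pos la (b : young la) : (0 < row_of b)%N.
Proof. by have := valP b; rewrite in_young => /andP[]. Qed.

Lemma young_row_le la (b : young la) : (row_of b <= size la)%N.
Proof.
have := valP b; rewrite in_young /row_of => /andP[h1 h2]; rewrite leqNgt; apply/negP => lt.
have ge : (size la <= (val b).1.-1)%N by move: lt; clear; case: (val b).1 => //= u; rewrite ltnS.
by rewrite (nth_default _ ge) in h2; case: (val b).2 h2.
Qed.

Lemma partition_nth_le la i j : is_partition la -> (i <= j)%N -> (nth 0%N la j <= nth 0%N la i)%N.
Proof.
move=> /andP[hs _] ij; have [lt|ge] := ltnP j (size la); last by rewrite (nth_default _ ge).
have tr : transitive geq by move=> x y z h1 h2; exact: leq_trans h2 h1.
by apply: (sorted_leq_nth tr leqnn 0%N hs) => //; rewrite inE; lia.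
Qed.

Lemma young_shape la : is_partition la -> is_shape (@row_of (young la)) (@col_of (young la)).
Proof.
move=> hla; split.
- exact: young_row_pos.
- by move=> b; have := valP b; rewrite in_young => /andP[_ /andP[]].
- move=> b b' e1 e2; apply: val_inj; move: e1 e2; rewrite /row_of /col_of.
  by case: (val b) (val b') => [i j] [i' j'] /= -> ->.
- move=> b i j hi hj; have inY : (i, j) \in young la.
    rewrite in_young /=; move: hi hj; rewrite /row_of /col_of; have := valP b; rewrite in_young.
    case: (val b) => i0 j0 /= h hi hj.
    have : (nth 0%N la i0.-1 <= nth 0%N la i.-1)%N by apply: partition_nth_le => //; lia.
    by lia.
  by exists (Sub (i, j) inY); rewrite /row_of /col_of SubK.
Qed.

Lemma young_count la (P : pred (nat * nat)) :
  #|[pred b : young la | P (val b)]| = (\sum_(i < size la) count (fun j => P (i.+1, j.+1)) (iota 0 (nth 0 la i)))%N.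
Proof.
pose s := [seq (i, j) | i <- iota 1 (size la), j <- iota 1 (nth 0%N la i.-1)].
have us : uniq s.
  apply: allpairs_uniq_dep => [|x _|[x y] [x' y'] _ _ [-> ->]] //; exact: iota_uniq.
have -> : #|[pred b : young la | P (val b)]| = count P s.
  have -> : #|[pred b : young la | P (val b)]| = count P (map val (Finite.enum (young la))).
    by rewrite count_map cardE /enum_mem size_filter; apply: eq_count => b; rewrite inE.
  apply/seq.permP/uniq_perm => // [|b].
    by rewrite map_inj_uniq; [rewrite -enumT; exact: enum_uniq|exact: val_inj].
  have -> : (b \in s) = (b \in young la) by rewrite in_fset.
  apply/mapP/idP => [[x _ ->]|hb]; first exact: valP.
  by exists (Sub b hb); rewrite ?SubK // -enumT mem_enum.
rewrite /s count_flatten sumnE !big_map -[1%N]addn0 iotaDl big_map -[X in iota 0 X]subn0 -/(index_iota _ _) big_mkord.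
apply: eq_bigr => i _; rewrite count_map -[1%N]addn0 iotaDl count_map /= add1n; apply: eq_count => j /=.
by rewrite !add1n.
Qed.

Lemma young_row_count la i : #|[pred b : young la | row_of b == i.+1]| = nth 0%N la i.
Proof.
rewrite (young_count la (fun b => b.1 == i.+1)).
transitivity (\sum_(j < size la) (if j == i :> nat then nth 0 la j else 0))%N.
  apply: eq_bigr => j _; rewrite (eq_count (a2 := fun=> j == i :> nat)) => [|u]; last by rewrite eqSS.
  by case: eqP => _; rewrite ?count_predT ?count_pred0 ?size_iota.
have [lt|ge] := ltnP i (size la).
  rewrite (bigD1 (Ordinal lt)) //= eqxx big1 ?addn0 // => j; rewrite -val_eqE /= => /negbTE -> //.
rewrite (nth_default _ ge) big1 // => j _; case: eqP => // e; have := ltn_ord j; lia.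
Qed.

Lemma card_young la : #|(predT : pred (young la))| = sumn la.
Proof.
have -> : #|(predT : pred (young la))| = #|[pred b : young la | predT (val b)]| by apply: eq_card.
rewrite (young_count la predT) sumnE (big_nth 0%N) big_mkord; apply: eq_bigr => i _.
by rewrite count_predT size_iota.
Qed.

Lemma bipartition_weightE n la mu u : (size la + size mu <= n)%N -> (u < n)%N ->
  (bipartition_weight n la mu)`_u = (nth 0%N la u)%:Z - (nth 0%N mu (n - u.+1))%:Z.
Proof.
move=> hs un; rewrite /bipartition_weight nth_cat size_map.
case: ltnP => h1.
  by rewrite (nth_map 0%N) // [nth _ mu _]nth_default ?subr0 //; lia.
rewrite [nth 0%N la u]nth_default // sub0r nth_cat size_nseq nth_nseq.
case: ltnP => h2; first by rewrite [nth _ mu _]nth_default ?oppr0 //; lia.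
rewrite nth_rev size_map; last by lia.
rewrite (nth_map 0%N); last by lia.
by do 3 f_equal; lia.
Qed.

Lemma bij_card_set (A B : finType) (g : A -> B) (P : pred B) : bijective g ->
  #|[set a | P (g a)]| = #|[set b | P b]|.
Proof.
move=> hg; rewrite -(on_card_preimset (f := g) (R := [set b | P b])); last first.
  exact: (subon_bij (fun _ _ => isT) (onW_bij _ hg)).
by apply: eq_card => a; rewrite !inE.
Qed.

(** * Special tableaux on label classes *)

Section Fibers.
Variables (E : diagram) (T : tableau E) (i : nat).

Lemma fiber_parent (b : fiber T i) : exists a : E, val a = val b /\ T a = i.
Proof.
have /imfsetP[a ha e] := valP b; exists a; split=> //; by move: ha; rewrite /= inE => /eqP.
Qed.

Lemma fiber_lift (a : E) : T a = i -> exists b : fiber T i, val b = val a.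
Proof.
move=> h; have inF : val a \in fiber T i by apply/imfsetP; exists a => //=; rewrite inE h.
by exists (Sub (val a) inF); rewrite SubK.
Qed.

End Fibers.

Section Restriction.
Variables (D E : diagram) (m : nat) (P : tableau D) (Q : tableau E) (alpha : {ffun E -> D}).
Hypothesis alpha_bij : bijective alpha.
Hypothesis alpha_label : forall a, P (alpha a) = Q a.
Hypothesis alpha_admissible : forall a b, Q a = Q b -> col_of (alpha a) = col_of (alpha b) ->
  (row_of (alpha a) < row_of (alpha b))%N -> (row_of a < row_of b)%N.
Hypothesis row_pos : forall b : D, (0 < row_of b)%N.
Hypothesis row_weak_restr : forall a b, Q a = Q b -> row_of a = row_of b -> (col_of a <= col_of b)%N ->
  (row_of (alpha a) <= row_of (alpha b))%N.
Hypothesis col_strict_restr : forall a b, Q a = Q b -> col_of a = col_of b -> (row_of a < row_of b)%N ->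
  (row_of (alpha a) < row_of (alpha b))%N.

(** Packages a picture as special tableaux, one for each label; the hypotheses are what
    [picture_admissible] and [picture_row_weak] provide. *)
Lemma restricted_special_tuple : exists2 S : tableau_tuple m Q, special_tuple P S &
  forall (i : 'I_m) (a : E) (b : fiber Q i.+1), val a = val b -> S i b = row_of (alpha a).
Proof.
pose par_ex (i : 'I_m) := fin_all_exists (fun b : fiber Q i.+1 => fiber_parent b).
have [par parP] : exists par : forall i : 'I_m, fiber Q i.+1 -> E,
    forall i b, val (par i b) = val b /\ Q (par i b) = i.+1.
  have [par parP] := fin_all_exists par_ex; by exists par.
have [al alP] : exists al : forall i : 'I_m, {ffun fiber Q i.+1 -> fiber P i.+1},
    forall i b, val (al i b) = val (alpha (par i b)).
  suff h : forall i : 'I_m, exists f : {ffun fiber Q i.+1 -> fiber P i.+1}, forall b, val (f b) = val (alpha (par i b)).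
    by have [al alP] := fin_all_exists h; exists al.
  move=> i.
  have [f fP] : exists f : fiber Q i.+1 -> fiber P i.+1, forall b, val (f b) = val (alpha (par i b)).
    apply: (@fin_all_exists _ (fun=> fiber P i.+1) (fun b u => val u = val (alpha (par i b)))) => b.
      by apply: fiber_lift; rewrite alpha_label (parP i b).2.
  by exists (finfun f) => b; rewrite ffunE.
have al_bij i : bijective (al i).
  have [g1 gK1 gK2] := alpha_bij.
  have [f fP] : exists f : fiber P i.+1 -> fiber Q i.+1, forall d, al i (f d) = d.
    apply: (@fin_all_exists _ (fun=> fiber Q i.+1) (fun d b => al i b = d)) => d; have [d' [e1 e2]] := fiber_parent d.
    have [|b eb] := @fiber_lift E Q i.+1 (g1 d'); first by rewrite -alpha_label gK2.
    exists b; apply: val_inj; rewrite alP -e1; congr val; rewrite -(gK2 d'); congr (alpha _).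
    by apply: val_inj; rewrite (parP i b).1.
  exists f => // b; have e : val (alpha (par i (f (al i b)))) = val (alpha (par i b)) by rewrite -!alP fP.
  apply: val_inj; rewrite -!(parP i _).1; congr val; apply: (can_inj gK1); exact: val_inj.
have par_eq i (a : E) b : val a = val b -> par i b = a.
  by move=> e; apply: val_inj; rewrite (parP i b).1 -e.
exists (fun i => [ffun b => row_of (al i b)]) => [i|i a b e].
  have rowE b : row_of (al i b) = row_of (alpha (par i b)) by rewrite /row_of alP.
  have colE b : col_of (al i b) = col_of (alpha (par i b)) by rewrite /col_of alP.
  have rowE' b : row_of b = row_of (par i b) by rewrite /row_of (parP i b).1.
  have colE' b : col_of b = col_of (par i b) by rewrite /col_of (parP i b).1.
  have QE b b' : Q (par i b) = Q (par i b') by rewrite !(parP i _).2.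
  split.
  - split=> [b|b b' er ec|b b' ec er]; rewrite ?ffunE !rowE //.
    + by apply: row_weak_restr; rewrite -?rowE' -?colE'.
    + by apply: col_strict_restr; rewrite -?rowE' -?colE'.
  - move=> j; rewrite /occurrences -(bij_card_set (fun d => row_tableau (fiber P i.+1) d == j) (al_bij i)).
    by apply: eq_card => b; rewrite !inE !ffunE.
  - exists (al i); split=> //; first by apply/ffunP => b; rewrite !ffunE.
    by move=> b b'; rewrite !rowE !colE !rowE' => ec er; apply: alpha_admissible.
by rewrite ffunE /row_of alP (par_eq i a b e).
Qed.

End Restriction.

Section Represented.
Variables (D E : diagram) (m : nat) (P : tableau D) (Q : tableau E) (alpha : {ffun E -> D}) (S : tableau_tuple m Q).
Hypothesis repr : represents P alpha S.

Lemma represents_row (i : 'I_m) (a : E) (b : fiber Q i.+1) : val a = val b -> row_of (alpha a) = S i b.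
Proof.
move=> e; have [_ _ /(_ i)[al [h1 _ ->]]] := repr.
by rewrite !ffunE /row_of (h1 a b e).
Qed.

Lemma represents_admissible (i : 'I_m) (a b : E) : Q a = i.+1 -> Q b = i.+1 ->
  col_of (alpha a) = col_of (alpha b) -> (row_of (alpha a) < row_of (alpha b))%N ->
  (row_of a < row_of b)%N /\ (col_of b <= col_of a)%N.
Proof.
move=> qa qb; have [_ _ /(_ i)[al [h1 [_ h2] _]]] := repr.
have [a' ea] := fiber_lift qa; have [b' eb] := fiber_lift qb.
have e1 : val (alpha a) = val (al a') by apply: h1.
have e2 : val (alpha b) = val (al b') by apply: h1.
by have := h2 a' b'; rewrite /row_of /col_of e1 e2 ea eb.
Qed.

End Represented.

(** * From [u_fun] to alternating monomials on one set of strands *)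

Section Transport.
Variables (A B : finType) (f : A -> B) (g : B -> A).
Hypothesis fK : cancel f g.
Hypothesis gK : cancel g f.

Lemma transport_inj (q : {perm A}) : injective (fun b => f (q (g b))).
Proof. by move=> x y /(can_inj fK)/perm_inj/(can_inj gK). Qed.

Definition transport (q : {perm A}) : {perm B} := perm (@transport_inj q).

Lemma transport_tperm x y : transport (tperm x y) = tperm (f x) (f y).
Proof.
apply/permP => b; rewrite permE; case: (tpermP (f x)) => [->|->|n1 n2]; rewrite ?fK ?tpermL ?tpermR //.
by rewrite tpermD ?gK //; apply/eqP => e; [apply: n1|apply: n2]; rewrite e gK.
Qed.

Lemma transportM p q : transport (p * q)%g = (transport p * transport q)%g.
Proof. by apply/permP => b; rewrite !permE /= !permE /= fK. Qed.

Lemma odd_transport q : odd_perm (transport q) = odd_perm q.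
Proof.
have [ts -> _] := prod_tpermP q; elim: ts => [|[x y] ts IH].
  rewrite big_nil odd_perm1; have -> : transport 1%g = 1%g; last by rewrite odd_perm1.
  by apply/permP => b; rewrite permE !perm1 gK.
by rewrite big_cons transportM !odd_permM IH transport_tperm !odd_tperm (inj_eq (can_inj fK)).
Qed.

End Transport.

Lemma bijection_of_card (A B : finType) : #|A| = #|B| ->
  exists (f : A -> B) (g : B -> A), cancel f g /\ cancel g f.
Proof.
move=> e; exists (fun a => enum_val (cast_ord e (enum_rank a))), (fun b => enum_val (cast_ord (esym e) (enum_rank b))).
by split=> x; rewrite enum_valK ?cast_ordK ?cast_ordKV enum_rankK.
Qed.

(** For size N = n + 1, row r - i + 1 of the lower left corner is row N + 1 - i of the matrix, which
    has ordinal n + 1 - i. *)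
Lemma entry_phiE (k : fieldType) (n r s : nat) (hrs : (r + s <= n.+1)%N) (X : 'M[k]_n.+1) (l i j : nat) :
  (0 < l <= n)%N -> (0 < i <= r)%N -> (0 < j <= s)%N ->
  entry_fun l (r - i + 1) j (@phi k n.+1 r s n hrs X) = (X ^+ l) (inord (n.+1 - i)) (inord j.-1).
Proof.
move=> hl hi hj; rewrite /entry_fun.
have h1 : (l.-1 < n)%N by lia.
have h2 : ((r - i + 1).-1 < r)%N by lia.
have h3 : (j.-1 < s)%N by lia.
rewrite (insubT (fun x => x < n)%N h1) (insubT (fun x => x < r)%N h2) (insubT (fun x => x < s)%N h3).
rewrite /phi mxE; congr ((X ^+ _) _ _) => /=; first by lia.
  by apply: val_inj; rewrite /= inordK; lia.
by apply: val_inj; rewrite /= inordK; lia.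
Qed.

Definition pulled_row (D E : diagram) (f : E -> D) (a : E) := row_of (f a).
Definition pulled_col (D E : diagram) (f : E -> D) (a : E) := col_of (f a).

Section Bridge.
Variables (k : fieldType) (n r s : nat) (la mu : seq nat).
Hypothesis hk : [pchar k] =i pred0.
Hypothesis hrs : (r + s <= n.+1)%N.
Hypothesis hr : (0 < r)%N.
Hypothesis hla : is_partition la.
Hypothesis hmu : is_partition mu.
Hypothesis hmur : (size mu <= r)%N.
Hypothesis hlas : (size la <= s)%N.
Variables (f : young mu -> young la) (g : young la -> young mu).
Hypothesis fK : cancel f g.
Hypothesis gK : cancel g f.

Local Notation I := (young mu).
Local Notation r1 := (@row_of (young mu)).
Local Notation c1 := (@col_of (young mu)).
Local Notation r2 := (pulled_row f).
Local Notation c2 := (pulled_col f).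

Lemma transported_shape : is_shape r2 c2.
Proof.
have sh := young_shape hla; split=> [a|a|a b e1 e2|a i j hi hj].
- exact: shape_row sh _.
- exact: shape_col sh _.
- by apply: (can_inj fK); apply: (shape_inj sh).
- by have [z [z1 z2]] := shape_closed sh hi hj; exists (g z); rewrite /pulled_row /pulled_col gK.
Qed.

Lemma r1_le a : (r1 a <= r)%N. Proof. exact: leq_trans (young_row_le a) hmur. Qed.
Lemma r2_le a : (r2 a <= s)%N. Proof. exact: leq_trans (young_row_le (f a)) hlas. Qed.

Lemma u_funE (Q : tableau (young mu)) (alpha : {ffun young mu -> young la}) (al : {perm I}) X :
  (forall a, (0 < Q a <= n)%N) -> (forall a, alpha a = f (al a)) ->
  u_fun Q alpha (@phi k n.+1 r s n hrs X) = alternating_monomial r1 c1 r2 c2 Q al X.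
Proof.
move=> hQ hal; rewrite /u_fun /alternating_monomial; apply: eq_big => [p|p _]; first by rewrite inE.
rewrite (reindex (transport fK gK)) /=; last first.
  exists (transport gK fK) => q _; apply/permP => b; rewrite !permE /= ?permE /= ?fK ?gK ?fK ?gK //.
apply: eq_big => q.
  rewrite inE; apply/forallP/forallP => h a.
    by have := h (f a); rewrite permE fK.
  by have := h (g a); rewrite permE /pulled_col gK.
move=> _; rewrite odd_transport; congr (_ * _); apply: eq_bigr => a _.
rewrite entry_phiE //.
- by rewrite hal permE fK /low_index /high_index.
- by rewrite r1_le young_row_pos.
- by rewrite young_row_pos /= (leq_trans (young_row_le _)).
Qed.

Lemma weight_atE (u : 'I_n.+1) : weight_at r1 r2 u = (bipartition_weight n.+1 la mu)`_u.
Proof.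
rewrite bipartition_weightE //; last by clear -hrs hmur hlas; lia.
rewrite /weight_at; congr (_%:Z - _%:Z).
  rewrite -(young_row_count la u) -[LHS]cardsE -[RHS]cardsE.
  by apply: (bij_card_set (fun b => row_of b == u.+1)); exists g.
by rewrite -(young_row_count mu); apply: eq_card => b; rewrite !inE; congr (_ == _); have := ltn_ord u; clear; lia.
Qed.

Lemma u_fun_highest_weight (Q : tableau (young mu)) (alpha : {ffun young mu -> young la}) :
  (forall a, (0 < Q a <= n)%N) -> bijective alpha ->
  U_invariant_of_weight (bipartition_weight n.+1 la mu) (u_fun Q alpha \o @phi k n.+1 r s n hrs).
Proof.
move=> hQ [alpha' aK aK'].
have al_inj : injective (fun a => g (alpha a)) by move=> a b /(can_inj gK)/(can_inj aK).
pose al := perm al_inj.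
have e X : (u_fun Q alpha \o @phi k n.+1 r s n hrs) X = alternating_monomial r1 c1 r2 c2 Q al X.
  by apply: u_funE => // a; rewrite permE gK.
have sh1 := young_shape hmu; have sh2 := transported_shape.
split.
- by apply: (regular_eq _ (@alternating_monomial_regular k n _ r1 c1 r2 c2 Q al)) => X; rewrite e.
- move=> S hS X; rewrite /Defs.act !e.
  exact: (alternating_monomial_U hk sh1 sh2 r2_le hrs hr Q al hS X).
- move=> D hD X; rewrite /Defs.act !e.
  have := alternating_monomial_torus sh1 sh2 r1_le r2_le hrs hr Q al hD X.
  rewrite /Defs.act => ->; congr (_ * _); apply: eq_bigr => u _; by rewrite weight_atE.
Qed.

End Bridge.

Lemma weight_label_le (E : diagram) (Q : tableau E) n (nu : n.-tuple nat) : positive_entries Q -> has_weight Q nu ->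
  forall a, (0 < Q a <= n)%N.
Proof.
move=> pos hw a; rewrite pos /= leqNgt; apply/negP => lt.
have := hw (Q a).-1; rewrite prednK ?pos // nth_default; last by rewrite size_tuple; lia.
by move/eqP; rewrite cards_eq0 => /eqP/setP/(_ a); rewrite !inE eqxx.
Qed.

(** * The corollary *)

Section Backward.
Variables (k : fieldType) (n r s : nat) (la mu : seq nat) (t : nat).
Hypothesis hk : [pchar k] =i pred0.
Hypothesis hrs : (r + s <= n.+1)%N.
Hypothesis hr : (0 < r)%N.
Hypothesis hla : is_partition la.
Hypothesis hmu : is_partition mu.
Hypothesis hmut : sumn mu = t.
Hypothesis hmur : (size mu <= r)%N.
Hypothesis hlas : (size la <= s)%N.
Variable Rep : n.-tuple nat -> tableau (young la) -> tableau (young mu) -> {set {ffun young mu -> young la}}.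
Hypothesis hRep : forall (nu : n.-tuple nat) P Q, tableau_data t nu P Q -> is_rep_set n P Q (Rep nu P Q).
Variables (f : young mu -> young la) (g : young la -> young mu).
Hypothesis fK : cancel f g.
Hypothesis gK : cancel g f.

Local Notation I := (young mu).
Local Notation r1 := (@row_of (young mu)).
Local Notation c1 := (@col_of (young mu)).
Local Notation r2 := (pulled_row f).
Local Notation c2 := (pulled_col f).

Definition generator (h : 'M[k]_n.+1 -> k) : Prop :=
  exists (nu : n.-tuple nat) (P : tableau (young la)) (Q : tableau (young mu)) (alpha : {ffun young mu -> young la}),
    [/\ tableau_data t nu P Q, alpha \in Rep nu P Q & h = u_fun Q alpha \o @phi k n.+1 r s n hrs].

Let sh1 : is_shape r1 c1 := young_shape hmu.
Let sh2 : is_shape r2 c2 := transported_shape hla fK gK.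

(** A value of K exceeding all the coordinates, which makes the keys compare lexicographically. *)
Definition size_bound : nat := (\sum_(a : I) (c1 a + c2 a + r2 a)).+1.

Lemma size_boundP (a : I) : [/\ (c1 a < size_bound)%N, (c2 a < size_bound)%N & (r2 a < size_bound)%N].
Proof. by rewrite /size_bound (bigD1 a) //=; split; lia. Qed.

(** The labels give Q, and P is Q transported along the bijection of p; the picture conditions make
    both ordered and the restrictions special. The representative found in [Rep] shares these
    special tableaux, hence the rows of p; order of P and admissibility give the rest of
    [is_rep]. *)
Lemma picture_representative (p : labelling I n) : is_picture size_bound r1 c1 r2 c2 p ->
  exists al, is_rep c1 r2 c2 p al /\
    exists2 h, generator h & h =1 alternating_monomial r1 c1 r2 c2 (fun a => (p.1 a).+1) al.
Proof.
have b1 a : (c1 a < size_bound)%N by case: (size_boundP a).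
have b2 a : (c2 a < size_bound)%N by case: (size_boundP a).
move=> /(is_picture_halves sh1 sh2 b1 b2)[H1 H2].
pose Q : tableau (young mu) := [ffun a => (p.1 a).+1].
pose alpha : {ffun young mu -> young la} := [ffun a => f (p.2 a)].
pose back (b : young la) := (p.2^-1)%g (g b).
pose P : tableau (young la) := [ffun b => Q (back b)].
have backK a : back (alpha a) = a by rewrite /back ffunE fK permK.
have alphaK b : alpha (back b) = b by rewrite ffunE permKV gK.
have alpha_bij : bijective alpha by exists back.
have PQ a : P (alpha a) = Q a by rewrite ffunE backK.
have QE a b : Q a = Q b -> label_of p a = label_of p b by rewrite !ffunE => -[].
have rowE a : row_of (alpha a) = r2 (p.2 a) by rewrite ffunE.
have colE a : col_of (alpha a) = c2 (p.2 a) by rewrite ffunE.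
have rowE' b : row_of b = r2 (p.2 (back b)) by rewrite -{1}(alphaK b) rowE.
have colE' b : col_of b = c2 (p.2 (back b)) by rewrite -{1}(alphaK b) colE.
pose nu : n.-tuple nat := [tuple occurrences Q i.+1 | i < n].
have wQ : has_weight Q nu.
  move=> i; have [lt|ge] := ltnP i n.
    by rewrite -(tnth_nth 0%N nu (Ordinal lt)) tnth_mktuple.
  rewrite nth_default ?size_tuple //; apply/eqP; rewrite cards_eq0; apply/eqP/setP => a.
  by rewrite !inE ffunE eqSS; have := ltn_ord (p.1 a); lia.
have wP : has_weight P nu.
  move=> i; rewrite -wQ /occurrences -(bij_card_set (fun b => P b == i.+1) alpha_bij).
  by apply: eq_card => a; rewrite !inE PQ.
have nut : sumn nu = t.
  rewrite -hmut -(card_young mu) -sum1_card (partition_big p.1 xpredT) //= sumnE big_map big_enum /=.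
  apply: eq_bigr => i _; rewrite sum1_card /occurrences cardsE; apply: eq_card => a.
  by rewrite !unfold_in /= !eqnE ffunE eqSS.
have data : tableau_data t nu P Q.
  split=> //; split=> [b|a b er ec|a b ec er].
  - by rewrite !ffunE.
  - by rewrite !ffunE ltnS; apply: (picture_label_row H2 H1); rewrite /= -?rowE' -?colE'.
  - by rewrite !ffunE ltnS; apply: (picture_label_col H2 H1); rewrite /= -?rowE' -?colE'.
  - by rewrite !ffunE.
  - by rewrite !ffunE ltnS; apply: (picture_label_row H1 H2).
  - by rewrite !ffunE ltnS; apply: (picture_label_col H1 H2).
have [||||S hS rowS] := @restricted_special_tuple (young la) (young mu) n P Q alpha alpha_bij PQ.
- move=> a b /QE eQ; rewrite !colE !rowE => ec er.
  by case: (picture_admissible H1 H2 eQ ec er).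
- exact: young_row_pos.
- by move=> a b /QE eQ er ec; rewrite !rowE; apply: (picture_row_weak H1 H2).
- move=> a b /QE eQ ec er; rewrite !rowE.
  by case: (picture_admissible H2 H1 eQ ec er).
have [alpha' [[inR hrep] _]] := (hRep data).2 S hS.
have [[beta bK bK'] PQ' _] := hrep.
have al_inj : injective (fun a => g (alpha' a)) by move=> a b /(can_inj gK)/(can_inj bK).
pose al := perm al_inj.
have alE a : alpha' a = f (al a) by rewrite permE gK.
have [_ ordP ordQ _ _] := data.
have hQ := weight_label_le (let: And3 h _ _ := ordQ in h) wQ.
exists al; split; last first.
  exists (u_fun Q alpha' \o @phi k n.+1 r s n hrs); first by exists nu, P, Q, alpha'.
  move=> X; rewrite /= (u_funE hrs hmur hlas fK gK _ hQ alE).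
  apply: eq_bigr => x _; apply: eq_bigr => y _; congr (_ * _); apply: eq_bigr => a _.
  by rewrite ffunE.
split=> [a|a b ec er|a b eQ ec er].
- have [b eb] := @fiber_lift _ Q (p.1 a).+1 a (ffunE _ _).
  by rewrite /pulled_row -alE (represents_row hrep (esym eb)) (rowS (p.1 a) a b (esym eb)) rowE.
- have [_ _ ordc] := ordP; have := ordc (alpha' a) (alpha' b); rewrite !PQ' !alE !ffunE ltnS; exact.
- have qa : Q a = (p.1 a).+1 by rewrite ffunE.
  have qb : Q b = (p.1 a).+1 by rewrite ffunE; move: eQ; rewrite /label_of => ->.
  by have [] := represents_admissible hrep qa qb; rewrite ?alE.
Qed.

Theorem highest_weight_in_span (h : 'M[k]_n.+1 -> k) :
  U_invariant_of_weight (bipartition_weight n.+1 la mu) h -> invariant_span generator h.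
Proof.
move=> [reg hU hT].
have le1 a : (r1 a <= r)%N := r1_le hmur a.
have le2 a : (r2 a <= s)%N := r2_le hlas f a.
have : invariant_span (is_alternating_monomial r1 c1 r2 c2) h.
  apply: (highest_weight_spanned hk sh1 sh2 le1 le2 hrs hr reg).
  - move=> u v c uv X.
    pose S : 'M[k]_n.+1 := 1%:M + c *: delta_mx u v.
    have EE : delta_mx u v *m delta_mx u v = 0 :> 'M[k]_n.+1.
      by rewrite mul_delta_mx_0 // -val_eqE /= gtn_eqF.
    have SV : (1%:M - c *: delta_mx u v) *m S = 1%:M.
      rewrite mulmxDr mulmx1 mulmxDl mul1mx -scalemxAr mulNmx -scalemxAl EE.
      by rewrite scaler0 oppr0 scaler0 addr0 subrK.
    have uS : upper_unitriangular S.
      apply/andP; split; last first.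
        have nuv : (u == v) = false by rewrite -val_eqE /= (ltn_eqF uv).
        by apply/forallP => i; rewrite !mxE eqxx; case: (i =P u) => [->|_] /=; rewrite ?nuv mulr0 addr0.
      apply/is_trig_mxP => i j ij; rewrite !mxE -!val_eqE /= (gtn_eqF ij) add0r.
      case: (nat_of_ord j =P u) => [ju|_]; case: (nat_of_ord i =P v) => [iv|_]; rewrite /= ?mulr0 //.
      by move: ij uv; rewrite ju iv; lia.
    have <- : invmx S = 1%:M - c *: delta_mx u v.
      by have := congr1 (fun A => A *m invmx S) SV; rewrite /= mulmxK ?unitriangular_unit // mul1mx.
    exact: hU uS X.
  - move=> u S uS dS hS X; have := hT S _ X; rewrite /Defs.act => -> //; last by rewrite /torus dS.
    congr (_ * _); rewrite /torus_char (bigD1 u) //= big1 ?mulr1 => [|w /negbTE nw].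
      by rewrite hS eqxx (weight_atE hrs hmur hlas fK gK).
    by rewrite hS nw expr0 exp1rz.
apply: span_trans => _ [l [al0 ->]].
apply: span_trans (alternating_monomial_reduced k sh1 sh2 le1 le2 hrs hr l al0) => _ [Q [be ->]].
have [rep repP] : exists rep : labelling I n -> {perm I}, forall p, is_picture size_bound r1 c1 r2 c2 p ->
    is_rep c1 r2 c2 p (rep p) /\
    exists2 h, generator h & h =1 alternating_monomial r1 c1 r2 c2 (fun a => (p.1 a).+1) (rep p).
  suff hex (p : labelling I n) : exists al, is_picture size_bound r1 c1 r2 c2 p -> is_rep c1 r2 c2 p al /\
      exists2 h, generator h & h =1 alternating_monomial r1 c1 r2 c2 (fun a => (p.1 a).+1) al.
    by have [rep repP] := fin_all_exists hex; exists rep.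
  have [pic|npic] := boolP (is_picture size_bound r1 c1 r2 c2 p); last by exists 1%g.
  by have [al hal] := picture_representative pic; exists al.
have b1 a : (c1 a < size_bound)%N by case: (size_boundP a).
have b2 a : (c2 a < size_bound)%N by case: (size_boundP a).
have b3 a : (r2 a < size_bound)%N by case: (size_boundP a).
(* With this F the labelled sum is the alternating monomial evaluated at X, and the coefficients
   from [representatives_span] are scalars independent of X. *)
pose F (X : 'M[k]_n.+1) (w : {ffun I -> 'I_n * nat * nat}) : k :=
  \prod_a (X ^+ (w a).1.1.+1) (inord (n.+1 - (w a).1.2)) (inord (w a).2.-1).
have F_inv X : perm_invariant (F X).
  move=> x w; rewrite /F [RHS](reindex_inj (@perm_inj _ x)) /=.
  by apply: eq_bigr => a _; rewrite ffunE.
have labelled_sumE X (p : labelling I n) : labelled_sum r1 c1 r2 c2 (F X) p =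
    alternating_monomial r1 c1 r2 c2 (fun a => (p.1 a).+1) p.2 X.
  apply: eq_bigr => x _; apply: eq_bigr => y _; congr (_ * _); apply: eq_bigr => a _.
  by rewrite ffunE.
have [z [z1 z2]] := representatives_span hk sh1 sh2 b1 b2 b3 (fun p pic => (repP p pic).1) (Q, be).
apply: (@span_eq _ _ _ (fun X => \sum_q z q * labelled_sum r1 c1 r2 c2 (F X) (q.1, rep q))) => [X|].
  by rewrite -z2 // labelled_sumE.
apply: span_sum => q; have [z0|nz] := eqVneq (z q) 0.
  by apply: span_eq (span0 _) => X; rewrite z0 mul0r.
have [_ [h' gh' eh']] := repP q (z1 q nz).
apply: (@span_eq _ _ _ (fun X => z q * h' X)) => [X|]; first by rewrite eh' labelled_sumE.
by apply: span_gen => //; exact: GL_invariant_const.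
Qed.

End Backward.

(** * Both inclusions together *)

Lemma invariant_span_highest_weight (k : fieldType) n chi (G : ('M[k]_n -> k) -> Prop) f :
  (forall g, G g -> U_invariant_of_weight chi g) -> (forall S, upper_unitriangular S -> S \in @unitmx k n) ->
  invariant_span G f -> U_invariant_of_weight chi f.
Proof.
move=> hG hunit [N [c [g [h1 h2 h3]]]].
have h i := hG _ (h2 i).
split.
- apply: (regular_eq (fun A => esym (h3 A))); apply: regular_sum => i; apply: regularM.
    by case: (h1 i).
  by case: (h i).
- move=> S hS A; rewrite /Defs.act !h3; apply: eq_bigr => i _.
  have [_ hc] := h1 i; have [_ hu _] := h i.
  by have := hc S (hunit S hS) A; have := hu S hS A; rewrite /Defs.act => -> ->.
- move=> D hD A; rewrite /Defs.act !h3 mulr_sumr; apply: eq_bigr => i _.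
  have [_ hc] := h1 i; have [_ _ ht] := h i; have /andP[_ uD] := hD.
  by have := hc D uD A; have := ht D hD A; rewrite /Defs.act => -> ->; rewrite mulrCA.
Qed.

Theorem corollary3 (k : closedFieldType) (hk : [pchar k] =i pred0)
  (n r s : nat) (hn : (1 <= n)%N) (hr : (1 <= r)%N) (hs : (1 <= s)%N)
  (hrs : (r + s <= n)%N)
  (la mu : seq nat) (t : nat)
  (hla : is_partition la) (hmu : is_partition mu)
  (hlat : sumn la = t) (hmut : sumn mu = t)
  (hmur : (size mu <= r)%N) (hlas : (size la <= s)%N)
  (Rep : n.-1.-tuple nat -> tableau (young la) -> tableau (young mu) ->
         {set {ffun young mu -> young la}})
  (hRep : forall (nu : n.-1.-tuple nat) P Q, tableau_data t nu P Q ->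
          is_rep_set n.-1 P Q (Rep nu P Q)) :
  forall f : 'M[k]_n -> k,
    invariant_span
      (fun g : 'M[k]_n -> k =>
         exists (nu : n.-1.-tuple nat) (P : tableau (young la))
                (Q : tableau (young mu)) (alpha : {ffun young mu -> young la}),
           [/\ tableau_data t nu P Q,
               alpha \in Rep nu P Q &
               g = u_fun Q alpha \o @phi k n r s n.-1 hrs]) f
    <-> U_invariant_of_weight (bipartition_weight n la mu) f.
Proof.
case: n hn hrs Rep hRep => // n _ hrs Rep hRep f.
(* The sizes of both partitions are t, so a bijection of boxes exists; any one serves to identify
   the two sets of strands. *)
have [|b [b' [bK bK']]] := @bijection_of_card (young mu) (young la).
  by rewrite !card_young hlat.
split; last exact: (@highest_weight_in_span k n r s la mu t hk hrs hr hla hmu hmut hmur hlas Rep hRep b b' bK bK' f).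
apply: invariant_span_highest_weight; last exact: unitriangular_unit.
move=> g [nu [P [Q [alpha [data inR ->]]]]].
have [S [_ [bij _ _]]] := (hRep nu P Q data).1 alpha inR.
have [_ _ [pos _ _] _ wQ] := data.
exact: (u_fun_highest_weight hk hrs hr hla hmu hmur hlas bK bK' (weight_label_le pos wQ) bij).
Qed.
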